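(* Let $z=(z_1,z_2)^\top\in V$ be arbitrary, where $z_1\in\mathrm{Dom}((-A)^{1/2})$ and $z_2\in L^2(D)$, and for $T>0$ define $$J_T=\frac1T\int_0^T\langle X^{x_0}(t),z\rangle_V^2\,dt .$$ 1) If $z\neq 0$, then the process $$\bar a_T=\frac{1}{4bJ_T}\langle Qz_1,z_1\rangle_{\mathrm{Dom}((-A)^{1/2})}+\frac{1}{4J_T}\langle Qz_2,z_2\rangle_{L^2(D)}$$ is a strongly consistent estimator of the parameter $a$, i.e. $\bar a_T\to a$ $\mathbb P$-a.s. as $T\to\infty$. 2) If $z_1\neq 0$, then the process $$\bar b_T=\frac{\langle Qz_1,z_1\rangle_{\mathrm{Dom}((-A)^{1/2})}}{4aJ_T-\langle Qz_2,z_2\rangle_{L^2(D)}}$$ is a strongly consistent estimator of the parameter $b$, i.e. $\bar b_T\to b$ $\mathbb P$-a.s. as $T\to\infty$.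
   Context: Let $D\subset\mathbb R^d$ be a bounded domain with smooth boundary and $\{e_n\}_{n\in\mathbb N}$ an orthonormal basis of $L^2(D)$. Let $A$ be the operator on $L^2(D)$ with $Ae_n=-\alpha_ne_n$, $\alpha_n>0$ for all $n$, $\alpha_n\to\infty$, with $\mathrm{Dom}(A)=\{x:\sum_n\alpha_n^2\langle x,e_n\rangle_{L^2(D)}^2<\infty\}$. The space $\mathrm{Dom}((-A)^{1/2})=\{x:\sum_n\alpha_n\langle x,e_n\rangle_{L^2(D)}^2<\infty\}$ has inner product $\langle x,y\rangle_{\mathrm{Dom}((-A)^{1/2})}=\langle(-A)^{1/2}x,(-A)^{1/2}y\rangle_{L^2(D)}$. Let $\Phi_1$ be a Hilbert--Schmidt operator on $L^2(D)$ such that $Q=\Phi_1\Phi_1^*$ satisfies $Qe_n=\lambda_ne_n$ with $\lambda_n>0$ for all $n$ and $\sum_n\lambda_n<\infty$. Let $V=\mathrm{Dom}((-A)^{1/2})\times L^2(D)$ with inner product $\langle(x_1,x_2)^\top,(y_1,y_2)^\top\rangle_V=\langle x_1,y_1\rangle_{\mathrm{Dom}((-A)^{1/2})}+\langle x_2,y_2\rangle_{L^2(D)}$. Let $a>0$, $b>0$ and define $\mathcal A$ on $\mathrm{Dom}(\mathcal A)=\mathrm{Dom}(A)\times\mathrm{Dom}((-A)^{1/2})$ by $\mathcal A(x_1,x_2)^\top=(x_2,\;bAx_1-2ax_2)^\top$; it generates an exponentially stable strongly continuous semigroup $(S(t),t\ge0)$ on $V$. Let $\Phi=\begin{pmatrix}0&0\\0&\Phi_1\end{pmatrix}$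 on $V$. The driving process is $(0,B(t))^\top$ with $(B(t),t\ge0)$ a standard cylindrical Brownian motion on $L^2(D)$ (again denoted $B$), and $x_0$ is a $V$-valued random variable with $\mathbb E\|x_0\|_V^2<\infty$, independent of $B$. The process $X^{x_0}(t)=S(t)x_0+\int_0^tS(t-u)\Phi\,dB(u)$, $t\ge0$, is the (mild) solution of $dX(t)=\mathcal AX(t)\,dt+\Phi\,dB(t)$, $X(0)=x_0$. *)

(* Defs.v *)
From mathcomp Require Import all_boot all_order all_algebra.
From mathcomp Require Import all_classical all_reals all_analysis.
Import Order.TTheory GRing.Theory Num.Theory.
Import numFieldNormedType.Exports.

Set Implicit Arguments.
Unset Strict Implicit.
Unset Printing Implicit Defensive.

Local Open Scope classical_set_scope.
Local Open Scope ring_scope.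

(* L^2(D) is represented by square-integrable functions, without quotienting
   by a.e. equality: the inner product is then only positive semi-definite and
   equality of vectors is [seqv], i.e. the seminorm of the difference is 0.
   The definitions of this section are for a linear subspace [V] of [E] with
   such an inner product. *)
Section semi_inner_product_space.
Context {R : realType} {E : lmodType R}.
Variables (V : set E) (ip : E -> E -> R).

Definition snorm (x : E) : R := Num.sqrt (ip x x).

Definition seqv (x y : E) : Prop := snorm (x - y) = 0.

Definition bounded_linear_op (L : E -> E) : Prop :=
  [/\ forall x, V x -> V (L x),
      forall (c : R) x y, V x -> V y ->
        seqv (L (c *: x + y)) (c *: L x + L y) &
      exists C : R, forall x, V x -> snorm (L x) <= C * snorm x].

Definition C0_semigroup (S : R -> E -> E) : Prop :=
  [/\ forall t, 0 <= t -> bounded_linear_op (S t),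
      forall x, V x -> seqv (S 0 x) x,
      forall s t x, 0 <= s -> 0 <= t -> V x ->
        seqv (S (s + t) x) (S s (S t x)) &
      forall x, V x -> snorm (S t x - x) @[t --> 0^'+] --> (0 : R)].

(* The generator of [S] is [G] with domain exactly [dom]. *)
Definition generated_by (S : R -> E -> E) (dom : set E) (G : E -> E) : Prop :=
  forall x y, V x -> V y ->
    (snorm (t^-1 *: (S t x - x) - y) @[t --> 0^'+] --> (0 : R))
    <-> (dom x /\ seqv y (G x)).

Definition norm_open (U : set E) : Prop :=
  U `<=` V /\ forall x, U x ->
    exists2 r : R, 0 < r & forall y, V y -> snorm (y - x) < r -> U y.

End semi_inner_product_space.

Section L2.
Context {R : realType}.

Lemma one_le_two : (1 <= 2%:E :> \bar R)%E.
Proof. by rewrite lee_fin ler1n. Qed.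

Context {dT : measure_display} {T : measurableType dT}.
Variable mu : {measure set T -> \bar R}.

Definition L2 : lmodType R := LfunType mu one_le_two.

Definition L2ip (f g : LfunType mu one_le_two) : R :=
  \int[mu]_x (f x * g x).

End L2.

Notation borel_Rd R d := (g_sigma_algebraType (@open 'rV[R]_d)).

Section domain_of_Rd.
Variables (R : realType) (d : nat).

(* This determines [leb], since boxes generate the Borel sets. *)
Definition is_lebesgue (leb : {measure set (borel_Rd R d) -> \bar R}) : Prop :=
  forall a b : 'rV[R]_d, (forall i, a ord0 i <= b ord0 i) ->
    leb [set x : 'rV[R]_d | forall i, a ord0 i <= x ord0 i <= b ord0 i]
    = (\prod_i (b ord0 i - a ord0 i))%:E.

Lemma open_borel (D : set 'rV[R]_d) :
  open D -> measurable (D : set (borel_Rd R d)).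
Proof. exact: sub_sigma_algebra. Qed.

Definition restrict_leb (leb : {measure set (borel_Rd R d) -> \bar R})
    (D : set 'rV[R]_d) (oD : open D) : {measure set (borel_Rd R d) -> \bar R} :=
  mrestr leb (open_borel oD).

Definition iter_partial (s : seq 'I_d) (f : 'rV[R]_d -> R) : 'rV[R]_d -> R :=
  foldr (fun i g x => 'D_(delta_mx ord0 i) g x) f s.

Definition smooth_on (U : set 'rV[R]_d) (f : 'rV[R]_d -> R) : Prop :=
  forall (s : seq 'I_d) x, U x ->
    {for x, continuous (iter_partial s f)} /\
    forall i, derivable (iter_partial s f) x (delta_mx ord0 i).

(* Near each boundary point, D is the sublevel set of a smooth function with
   nonvanishing gradient. *)
Definition smooth_boundary (D : set 'rV[R]_d) : Prop :=
  forall p, (closure D `\` interior D) p ->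
    exists (U : set 'rV[R]_d) (phi : 'rV[R]_d -> R),
      [/\ open U, U p, smooth_on U phi,
          forall x, U x -> exists i, 'D_(delta_mx ord0 i) phi x != 0 &
          D `&` U = [set x | phi x < 0] `&` U].

End domain_of_Rd.

Section operators.
Context {R : realType} {dT : measure_display} {T : measurableType dT}.
Variable mu : {measure set T -> \bar R}.
Local Notation H := (L2 mu).
Local Notation ip := (@L2ip R dT T mu).
Implicit Types (e : nat -> H) (c al : nat -> R).

Definition orthonormal_basis e : Prop :=
  (forall i j, ip (e i) (e j) = (i == j)%:R) /\
  forall x : H,
    snorm ip (x - \sum_(n < N) ip x (e n) *: e n) @[N --> \oo] --> (0 : R).

Definition dom_A e al : set H :=
  [set x | cvgn (series (fun n => al n ^+ 2 * ip x (e n) ^+ 2))].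

Definition dom_A12 e al : set H :=
  [set x | cvgn (series (fun n => al n * ip x (e n) ^+ 2))].

(* L x = \sum_n c_n <x, e_n> e_n for x in [dom] *)
Definition diagonal_on (dom : set H) e c (L : H -> H) : Prop :=
  forall x, dom x ->
    snorm ip (L x - \sum_(n < N) (c n * ip x (e n)) *: e n) @[N --> \oo]
      --> (0 : R).

Definition hilbert_schmidt e (L : H -> H) : Prop :=
  bounded_linear_op setT ip L /\
  cvgn (series (fun n => ip (L (e n)) (L (e n)))).

Definition adjoint_of (L Ls : H -> H) : Prop :=
  forall x y, ip (L x) y = ip x (Ls y).

Definition Vspace e al : set (H * H)%type := [set x | dom_A12 e al x.1].

(* The inner product of Dom((-A)^{1/2}); [A12] stands for (-A)^{1/2}. *)
Definition ipA12 (A12 : H -> H) (x y : H) : R := ip (A12 x) (A12 y).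

Definition ipV (A12 : H -> H) (x y : (H * H)%type) : R :=
  ipA12 A12 x.1 y.1 + ip x.2 y.2.

Definition dom_wave e al : set (H * H)%type :=
  [set x | dom_A e al x.1 /\ dom_A12 e al x.2].

Definition wave_op (A : H -> H) (a b : R) (x : (H * H)%type) : (H * H)%type :=
  (x.2, b *: A x.1 - (2 * a) *: x.2).

Definition noise_op (Phi1 : H -> H) (x : (H * H)%type) : (H * H)%type :=
  (0, Phi1 x.2).

End operators.

Arguments one_le_two {R}.

Section probability.
Context {R : realType} {dO : measure_display} {Om : measurableType dO}.
Variable P : probability Om R.

(* The library's normal_prob is not a Dirac mass when the deviation is 0. *)
Definition centered_gaussian (X : Om -> R) (v : R) : Prop :=
  if v == 0 then {ae P, forall w, X w = 0}
  else forall C : set (measurableTypeR R), measurable C ->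
    P (X @^-1` C) = normal_prob 0 (Num.sqrt v) C.

Definition independent_families (F G : set (set Om)) : Prop :=
  forall A C, F A -> G C -> P (A `&` C) = (P A * P C)%E.

Section cylindrical.
Context {H : lmodType R}.
Variables (ip : H -> H -> R) (W : R -> H -> Om -> R).

Definition sigma_until (s : R) : set (set Om) :=
  <<s [set A | exists r h (C : set (measurableTypeR R)),
        [/\ 0 <= r <= s, measurable C & A = W r h @^-1` C]] >>.

Definition sigma_process : set (set Om) :=
  <<s [set A | exists r h (C : set (measurableTypeR R)),
        [/\ 0 <= r, measurable C & A = W r h @^-1` C]] >>.

(* [W t h] is the real random variable <B(t), h>. *)
Record cylindrical_BM : Prop := {
  cbm_measurable : forall t h, 0 <= t -> measurable_fun setT (W t h);
  cbm_linear : forall t (c : R) h k, 0 <= t ->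
    {ae P, forall w, W t (c *: h + k) w = c * W t h w + W t k w};
  cbm_start : forall h, {ae P, forall w, W 0 h w = 0};
  cbm_gaussian : forall s t h, 0 <= s -> s <= t ->
    centered_gaussian (fun w => W t h w - W s h w) ((t - s) * ip h h);
  cbm_independent : forall s t h, 0 <= s -> s <= t ->
    independent_families (sigma_until s)
      [set A | exists2 C : set (measurableTypeR R), measurable C &
         A = (fun w => W t h w - W s h w) @^-1` C];
  cbm_continuous : forall h,
    {ae P, forall w, {within `[0, +oo[, continuous (fun t : R => W t h w)}}
}.

End cylindrical.

Section random_vectors.
Context {E : lmodType R}.
Variables (V : set E) (ipE : E -> E -> R).

Definition random_vector (X : Om -> E) : Prop :=
  (forall w, V (X w)) /\
  forall U, norm_open V ipE U -> measurable (X @^-1` U).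

Definition sigma_vector (X : Om -> E) : set (set Om) :=
  <<s [set A | exists2 U, norm_open V ipE U & A = X @^-1` U] >>.

(* jointly measurable process indexed by [0, +oo[ *)
Definition measurable_process (X : R -> Om -> E) : Prop :=
  (forall t w, 0 <= t -> V (X t w)) /\
  forall U, norm_open V ipE U ->
    measurable [set p : (measurableTypeR R * Om)%type |
                 0 <= p.1 /\ U (X p.1 p.2)].

Context {H : lmodType R}.
Variables (ip : H -> H -> R) (e : nat -> H) (W : R -> H -> Om -> R).

(* (s, t, h, v) encodes the integrand u |-> 1_{]s, t]}(u) <., h> v *)
Definition elementary : choiceType := (R * R * H * E)%type.

Definition elementary_on (T : R) (c : elementary) : Prop :=
  let: (s, t, _, v) := c in [/\ 0 <= s, s <= t, t <= T & V v].

Definition step_op (F : seq elementary) (u : R) (k : H) : E :=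
  \sum_(c <- F) let: (s, t, h, v) := c in
    if s < u <= t then ip k h *: v else 0.

Definition step_integral (F : seq elementary) (w : Om) : E :=
  \sum_(c <- F) let: (s, t, h, v) := c in (W t h w - W s h w) *: v.

Definition HS_sqnorm (L : H -> E) : \bar R :=
  (\sum_(n <oo) (ipE (L (e n)) (L (e n)))%:E)%E.

(* I = \int_0^T Psi(u) dB(u), as the L^2(Om; V)-limit of the integrals of step
   functions that converge to Psi in L^2(0, T; HS), where HS is the space of
   Hilbert-Schmidt operators from H to V. *)
Definition wiener_integral (T : R) (Psi : R -> H -> E) (I : Om -> E) : Prop :=
  random_vector I /\
  exists F : nat -> seq elementary,
    [/\ forall k c, c \in F k -> elementary_on T c,
        (\int[lebesgue_measure]_(u in `[0%R, T]%classic)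
           HS_sqnorm (fun h => (Psi u h - step_op (F k) u h)%R))%E
           @[k --> \oo] --> 0%E &
        (\int[P]_w
           (ipE (I w - step_integral (F k) w)%R
                (I w - step_integral (F k) w)%R)%:E)%E
           @[k --> \oo] --> 0%E].

(* X(t) = S(t) x0 + \int_0^t S(t - u) Phi dB(u) a.s., for every t >= 0;
   [Phi] is the operator from H to V in front of dB. *)
Definition mild_solution (S : R -> E -> E) (Phi : H -> E) (x0 : Om -> E)
    (X : R -> Om -> E) : Prop :=
  measurable_process X /\
  forall t, 0 <= t -> exists I : Om -> E,
    wiener_integral t (fun u h => S (t - u) (Phi h)) I /\
    {ae P, forall w, seqv ipE (X t w) (S t (x0 w) + I w)}.

Definition time_avg (X : R -> Om -> E) (z : E) (T : R) (w : Om) : R :=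
  T^-1 * \int[lebesgue_measure]_(t in `[0, T]%classic) (ipE (X t w) z) ^+ 2.

End random_vectors.
End probability.

(* Main.v *)
Require Import Defs.
From mathcomp Require Import all_boot all_order all_algebra.
From mathcomp Require Import all_classical all_reals all_analysis.
From mathcomp Require Import measurable_realfun ring lra.
Import Order.TTheory GRing.Theory Num.Theory.
Import numFieldNormedType.Exports.

Set Implicit Arguments.
Unset Strict Implicit.
Unset Printing Implicit Defensive.

(* Write <X(t), z> = m(t) + G(t) with m(t) = <S(t) x0, z>, which decays
   exponentially, and G the contribution of the noise. In the coordinates along
   e_k the semigroup is a damped oscillator x' = y, y' = - b al_k x - 2 a y, whose
   quadratic Lyapunov functions give the exponential decay of S and the exact
   value of the integral of the squared response over [0, +oo[. The adjoints
   Phi1^* e_k are orthogonal with squared norms lam_k, so the modes decouple in the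
   covariance of G: E[G(s) G(t)] is O(exp(- w |t - s|)), and E[G(t)^2] converges
   exponentially fast to
     s2 = sum_k lam_k (z_2k^2 + al_k z_1k^2 / b) / (4 a)
        = (<Q z2, z2> + <Q z1, z1>_Dom / b) / (4 a).
   By Isserlis' formula G^2 then has an exponentially decaying covariance, which
   gives a strong law of large numbers; since m is negligible pathwise, J_T -> s2
   almost surely. Solving the formula for s2 for a, resp. b, gives the two estimators. *)

Local Open Scope classical_set_scope.
Local Open Scope ring_scope.

(** * Semi-inner products *)

(** Vectors matter only up to seminorm 0 and operators are constrained only up to such null vectors,
    so most arguments go through coefficients along [e] and through pairings rather than identities
    of vectors. [S] is known only through its generator: the oscillator equations hold first on the
    domain and reach all of [V] through truncations. Differentiating an orbit from the left needs
    operator bounds near each [t > 0]; they come from a Baire argument in the time variable instead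
    of the uniform boundedness principle, which would ask for a complete [V]. The noise is only a
    mean-square limit of step integrals. Instead of joint Gaussian laws, second and fourth moments
    of single step integrals are propagated; polarisation gives Isserlis' formula for them, and
    Fatou keeps one inequality in the limit, the direction that a variance bound requires. The
    Wiener integrals are given separately for each [t], up to null sets; [X] minus its mean part
    serves as a jointly measurable version. Rates are uniform over modes because [al] is bounded
    below by some [al0 > 0]. *)

Record semi_inner_product {R : realType} {E : lmodType R} (V : set E)
    (ip : E -> E -> R) : Prop := SemiInnerProduct {
  sip0 : V 0;
  sip_lin : forall (c : R) x y, V x -> V y -> V (c *: x + y);
  sipC : forall x y, V x -> V y -> ip x y = ip y x;
  sipP : forall (c : R) x y z, V x -> V y -> V z ->
    ip (c *: x + y) z = c * ip x z + ip y z;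
  sip_ge0 : forall x, V x -> 0 <= ip x x }.

Section semi_inner_product_theory.
Context {R : realType} {E : lmodType R} {V : set E} {ip : E -> E -> R}.
Hypothesis sip : semi_inner_product V ip.
Local Notation sn := (snorm ip).

Lemma sipVZ (c : R) x : V x -> V (c *: x).
Proof. by move=> Vx; rewrite -[_ *: _]addr0; apply: (sip_lin sip) => //; exact: (sip0 sip). Qed.

Lemma sipVD x y : V x -> V y -> V (x + y).
Proof. by move=> Vx Vy; rewrite -[x]scale1r; exact: (sip_lin sip). Qed.

Lemma sipVB x y : V x -> V y -> V (x - y).
Proof. by move=> Vx Vy; rewrite addrC -scaleN1r; exact: (sip_lin sip). Qed.

Lemma sipV_sum (I : Type) (r : seq I) (Q : pred I) (F : I -> E) :
  (forall i, Q i -> V (F i)) -> V (\sum_(i <- r | Q i) F i).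
Proof. by move=> h; apply: big_ind => //; [exact: (sip0 sip)|exact: sipVD]. Qed.

Lemma sip0l x : V x -> ip 0 x = 0.
Proof.
move=> Vx; have := sipP sip 1 (sip0 sip) (sip0 sip) Vx.
by rewrite scaler0 addr0 mul1r => /eqP; rewrite -subr_eq subrr eq_sym => /eqP.
Qed.

Lemma sipZl c x z : V x -> V z -> ip (c *: x) z = c * ip x z.
Proof.
by move=> Vx Vz; rewrite -[c *: x]addr0 (sipP sip)// ?sip0l ?addr0//; exact: (sip0 sip).
Qed.

Lemma sipDl x y z : V x -> V y -> V z -> ip (x + y) z = ip x z + ip y z.
Proof. by move=> Vx Vy Vz; rewrite -{1}[x]scale1r (sipP sip)// mul1r. Qed.

Lemma sipBl x y z : V x -> V y -> V z -> ip (x - y) z = ip x z - ip y z.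
Proof.
by move=> Vx Vy Vz; rewrite addrC -scaleN1r (sipP sip)// mulN1r addrC.
Qed.

Lemma sipZr c x z : V x -> V z -> ip z (c *: x) = c * ip z x.
Proof. by move=> Vx Vz; rewrite (sipC sip)//; [rewrite sipZl// (sipC sip)|exact: sipVZ]. Qed.

Lemma sipDr x y z : V x -> V y -> V z -> ip z (x + y) = ip z x + ip z y.
Proof.
move=> Vx Vy Vz; rewrite (sipC sip)//; last exact: sipVD.
by rewrite sipDl// (sipC sip Vx Vz)// (sipC sip Vy Vz).
Qed.

Lemma sipBr x y z : V x -> V y -> V z -> ip z (x - y) = ip z x - ip z y.
Proof.
move=> Vx Vy Vz; rewrite (sipC sip)//; last exact: sipVB.
by rewrite sipBl// (sipC sip Vx Vz)// (sipC sip Vy Vz).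
Qed.

Lemma sip_suml (I : Type) (r : seq I) (Q : pred I) (F : I -> E) z :
  (forall i, Q i -> V (F i)) -> V z ->
  ip (\sum_(i <- r | Q i) F i) z = \sum_(i <- r | Q i) ip (F i) z.
Proof.
move=> h Vz; elim: r => [|i r IH]; first by rewrite !big_nil sip0l.
rewrite !big_cons; case: ifPn => // Qi.
by rewrite sipDl ?IH//; [exact: h|exact: sipV_sum].
Qed.

Lemma sip_sumr (I : Type) (r : seq I) (Q : pred I) (F : I -> E) z :
  (forall i, Q i -> V (F i)) -> V z ->
  ip z (\sum_(i <- r | Q i) F i) = \sum_(i <- r | Q i) ip z (F i).
Proof.
move=> h Vz; rewrite (sipC sip)//; last exact: sipV_sum.
by rewrite sip_suml//; apply: eq_bigr => i Qi; rewrite (sipC sip)//; exact: h.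
Qed.

Lemma snorm_ge0 x : 0 <= sn x. Proof. exact: sqrtr_ge0. Qed.

Lemma sqr_snorm x : V x -> sn x ^+ 2 = ip x x.
Proof. by move=> Vx; rewrite sqr_sqrtr//; exact: (sip_ge0 sip). Qed.

Lemma sip_sqrD x y : V x -> V y ->
  ip (x + y) (x + y) = ip x x + 2 * ip x y + ip y y.
Proof.
move=> Vx Vy; have Vxy := sipVD Vx Vy.
by rewrite sipDl// !sipDr// (sipC sip Vy Vx)//; ring.
Qed.

Lemma sip_sqrB x y : V x -> V y ->
  ip (x - y) (x - y) = ip x x - 2 * ip x y + ip y y.
Proof.
move=> Vx Vy; have Vxy := sipVB Vx Vy.
by rewrite sipBl// !sipBr// (sipC sip Vy Vx)//; ring.
Qed.

Lemma sip_cauchy_schwarz x y : V x -> V y ->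
  ip x y ^+ 2 <= ip x x * ip y y.
Proof.
move=> Vx Vy; have x0 := sip_ge0 sip Vx; have y0 := sip_ge0 sip Vy.
have q (c : R) : 0 <= c ^+ 2 * ip x x + 2 * c * ip x y + ip y y.
  have := sip_ge0 sip (sip_lin sip c Vx Vy).
  by rewrite sip_sqrD//; [rewrite !sipZl// ?sipZr//; [move=> h; nra|exact: sipVZ]|exact: sipVZ].
have [x00|xn0] := eqVneq (ip x x) 0.
  rewrite x00 mul0r; have [->|xy0] := eqVneq (ip x y) 0; first by rewrite expr0n.
  (* A null vector [x] makes the quadratic affine in [c]; if the pairing were nonzero, this [c]
     would give it the value -1. *)
  have := q (- (ip y y + 1) / (2 * ip x y)); rewrite x00 mulr0 add0r.
  have -> : 2 * (- (ip y y + 1) / (2 * ip x y)) * ip x y = - (ip y y + 1) by field.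
  by lra.
have xp : 0 < ip x x by rewrite lt_def xn0.
(* The minimiser of the quadratic. *)
have := q (- ip x y / ip x x).
have -> : (- ip x y / ip x x) ^+ 2 * ip x x + 2 * (- ip x y / ip x x) * ip x y
  + ip y y = (ip x x * ip y y - ip x y ^+ 2) / ip x x by field.
by rewrite pmulr_lge0 ?invr_gt0// subr_ge0.
Qed.

Lemma sip_le_snorm x y : V x -> V y -> `|ip x y| <= sn x * sn y.
Proof.
move=> Vx Vy; rewrite -ler_sqr ?nnegrE ?mulr_ge0 ?snorm_ge0//.
by rewrite real_normK ?num_real// exprMn !sqr_snorm// sip_cauchy_schwarz.
Qed.

Lemma snormD x y : V x -> V y -> sn (x + y) <= sn x + sn y.
Proof.
move=> Vx Vy; rewrite -ler_sqr ?nnegrE ?addr_ge0 ?snorm_ge0//.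
rewrite sqr_snorm; last exact: sipVD.
rewrite sip_sqrD// sqrrD !sqr_snorm// mulr2n.
have := sip_le_snorm Vx Vy; have := ler_norm (ip x y); lra.
Qed.

Lemma snormZ c x : V x -> sn (c *: x) = `|c| * sn x.
Proof.
move=> Vx; rewrite /snorm sipZl//; last exact: sipVZ.
by rewrite sipZr// mulrA -expr2 sqrtrM ?sqr_ge0// sqrtr_sqr.
Qed.

Lemma snormN x : V x -> sn (- x) = sn x.
Proof. by move=> Vx; rewrite -scaleN1r snormZ// normrN1 mul1r. Qed.

Lemma snorm_distC x y : V x -> V y -> sn (x - y) = sn (y - x).
Proof. by move=> Vx Vy; rewrite -opprB snormN//; exact: sipVB. Qed.

Lemma snormB_le x y z : V x -> V y -> V z -> sn (x - z) <= sn (x - y) + sn (y - z).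
Proof.
move=> Vx Vy Vz; have -> : x - z = (x - y) + (y - z) by rewrite addrA subrK.
by apply: snormD; exact: sipVB.
Qed.

Lemma snorm_le_dist x y : V x -> V y -> sn x <= sn y + sn (x - y).
Proof. by move=> Vx Vy; rewrite -{1}[x](subrKC y); apply: snormD => //; exact: sipVB. Qed.

Lemma dist_snorm x y : V x -> V y -> `|sn x - sn y| <= sn (x - y).
Proof.
move=> Vx Vy; rewrite ler_norml.
have := snorm_le_dist Vx Vy; have := snorm_le_dist Vy Vx.
by rewrite (snorm_distC Vy Vx) => *; apply/andP; split; lra.
Qed.

Lemma snorm0 : sn 0 = 0.
Proof. by rewrite /snorm sip0l ?sqrtr0//; exact: (sip0 sip). Qed.

Lemma seqv_ipl x y z : V x -> V y -> V z -> seqv ip x y -> ip x z = ip y z.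
Proof.
move=> Vx Vy Vz xy; apply/eqP; rewrite -subr_eq0 -sipBl// -normr_le0.
have := sip_le_snorm (sipVB Vx Vy) Vz.
by rewrite [sn (x - y)]xy mul0r.
Qed.

Lemma seqv_sym x y : V x -> V y -> seqv ip x y -> seqv ip y x.
Proof. by move=> Vx Vy; rewrite /seqv snorm_distC. Qed.

Lemma seqv_trans x y z : V x -> V y -> V z -> seqv ip x y -> seqv ip y z -> seqv ip x z.
Proof.
move=> Vx Vy Vz xy yz; apply/eqP; rewrite -normr_le0 ger0_norm ?snorm_ge0//.
by have := snormB_le Vx Vy Vz; rewrite [sn (x - y)]xy [sn (y - z)]yz addr0.
Qed.

Section limits.
Context {I : Type} {F : set_system I} {FF : ProperFilter F}.

Lemma cvg_snorm (x : I -> E) l : (forall i, V (x i)) -> V l ->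
  sn (x i - l) @[i --> F] --> (0 : R) -> sn (x i) @[i --> F] --> sn l.
Proof.
move=> Vx Vl h; apply/cvgrPdist_le => e e0.
near=> i; rewrite (le_trans (dist_snorm Vl (Vx i)))// snorm_distC//.
have : `|0 - sn (x i - l)| <= e.
  by near: i; move/cvgrPdist_le: h; apply.
by rewrite sub0r normrN ger0_norm ?snorm_ge0.
Unshelve. all: by end_near.
Qed.

Lemma cvg_ip (x y : I -> E) l m : (forall i, V (x i)) -> (forall i, V (y i)) ->
  V l -> V m -> sn (x i - l) @[i --> F] --> (0 : R) ->
  sn (y i - m) @[i --> F] --> (0 : R) -> ip (x i) (y i) @[i --> F] --> ip l m.
Proof.
move=> Vx Vy Vl Vm hx hy.
have h : sn (x i - l) * sn (y i) + sn l * sn (y i - m) @[i --> F] --> (0 : R).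
  rewrite -[X in _ --> X](_ : 0 * sn m + sn l * 0 = 0); last by rewrite mul0r mulr0 addr0.
  apply: cvgD; first by apply: cvgM => //; exact: cvg_snorm.
  by apply: cvgM => //; exact: cvg_cst.
apply/cvgrPdist_le => e e0; near=> i.
have -> : ip l m - ip (x i) (y i) = - (ip (x i - l) (y i) + ip l (y i - m)).
  by rewrite sipBl// sipBr//; ring.
rewrite normrN (le_trans (ler_normD _ _))//.
apply: (@le_trans _ _ (sn (x i - l) * sn (y i) + sn l * sn (y i - m))).
  by apply: lerD; apply: sip_le_snorm => //; exact: sipVB.
have : `|0 - (sn (x i - l) * sn (y i) + sn l * sn (y i - m))| <= e.
  by near: i; move/cvgrPdist_le: h; apply.
rewrite sub0r normrN ger0_norm//.
by rewrite addr_ge0 ?mulr_ge0 ?snorm_ge0.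
Unshelve. all: by end_near.
Qed.

Lemma cvg_ipl (x : I -> E) l z : (forall i, V (x i)) ->
  V l -> V z -> sn (x i - l) @[i --> F] --> (0 : R) ->
  ip (x i) z @[i --> F] --> ip l z.
Proof.
move=> Vx Vl Vz hx; apply: cvg_ip => //.
by rewrite subrr snorm0; exact: cvg_cst.
Qed.

End limits.
End semi_inner_product_theory.

(** * Square-integrable functions *)

Section square_integrable.
Context {R : realType} {d : measure_display} {T : measurableType d}.
Variable mu : {measure set T -> \bar R}.

(** Plain functions rather than [LfunType], so that one semi-inner product serves random variables
    under [P] and functions of time under Lebesgue measure. *)
Definition square_integrable (f : T -> R) : Prop :=
  measurable_fun setT f /\ mu.-integrable setT (EFin \o (fun x => f x ^+ 2)).

Lemma square_integrable_mul f g : square_integrable f -> square_integrable g ->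
  mu.-integrable setT (EFin \o (fun x => f x * g x)).
Proof.
move=> [mf if2] [mg ig2].
apply: (le_integrable measurableT _ _ (integrableD measurableT if2 ig2)).
  by apply/measurable_EFinP; exact: measurable_funM.
move=> x _ /=; rewrite lee_fin [leRHS]ger0_norm ?addr_ge0 ?sqr_ge0//.
by rewrite normrM -[f x ^+ 2]real_normK ?num_real// -[g x ^+ 2]real_normK ?num_real//; nra.
Qed.

Lemma square_integrable_lin c f g : square_integrable f -> square_integrable g ->
  square_integrable (fun x => c * f x + g x).
Proof.
move=> [mf if2] [mg ig2]; split.
  by apply: measurable_funD => //; exact: measurable_funM.
have h : mu.-integrable setT (EFin \o (fun x => 2 * c ^+ 2 * f x ^+ 2 + 2 * g x ^+ 2)).
  rewrite (_ : _ \o _ = (fun x => ((2 * c ^+ 2)%:E * (f x ^+ 2)%:E) + (2%:E * (g x ^+ 2)%:E)))%E//.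
  by apply: integrableD => //; exact: integrableZl.
apply: (le_integrable measurableT _ _ h).
  by apply/measurable_EFinP; apply: measurable_funX; apply: measurable_funD => //; exact: measurable_funM.
move=> x _ /=; rewrite lee_fin ger0_norm ?sqr_ge0// (le_trans _ (ler_norm _))//.
by have := sqr_ge0 (c * f x - g x); nra.
Qed.

Lemma square_integrable0 : square_integrable (fun=> 0).
Proof.
split; first exact: measurable_cst.
rewrite (_ : _ \o _ = cst 0%E); first exact: integrable0.
by apply/funext => x /=; rewrite expr0n.
Qed.

Lemma square_integrable_sip :
  semi_inner_product square_integrable (fun f g : T -> R => \int[mu]_x (f x * g x)).
Proof.
split.
- exact: square_integrable0.
- by move=> c x y Vx Vy; exact: square_integrable_lin.
- by move=> x y _ _; apply: eq_Rintegral => w _; rewrite mulrC.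
- move=> c x y z Vx Vy Vz.
  have xz := square_integrable_mul Vx Vz; have yz := square_integrable_mul Vy Vz.
  rewrite -RintegralZl// -RintegralD//.
    by apply: eq_Rintegral => w _ /=; rewrite mulrDl -mulrA.
  rewrite (_ : _ \o _ = (fun x0 => c%:E * (x x0 * z x0)%:E))%E//.
  exact: integrableZl.
- by move=> x _; apply: Rintegral_ge0 => w _; rewrite -expr2 sqr_ge0.
Qed.

Lemma Lfun_square_integrable (f : LfunType mu one_le_two) : square_integrable f.
Proof.
have /[dup] := LfunP f; rewrite {1}inE => /andP[/[!inE]/= mf _] lf; split => //.
exact: Lfun2_integrable_sqr.
Qed.

Lemma L2ip_sip : semi_inner_product setT (@L2ip R d T mu).
Proof.
have s := square_integrable_sip; have L := Lfun_square_integrable.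
split => //.
- by move=> x y _ _; exact: (sipC s).
- by move=> c x y z _ _ _; exact: (sipP s c (L x) (L y) (L z)).
- by move=> x _; exact: (sip_ge0 s (L x)).
Qed.

End square_integrable.

(** * Diagonal operators and the energy space *)

Lemma cvg_uniq {R : realType} {I : Type} {F : set_system I} {FF : ProperFilter F}
  (f : I -> R) (x y : R) : f @ F --> x -> f @ F --> y -> x = y.
Proof. exact: cvg_unique. Qed.

Section wave_space.
Context {R : realType} {H : lmodType R} {ip : H -> H -> R}.
Hypothesis sipH : semi_inner_product setT ip.
Variable e : nat -> H.

(** This and the next definitions repeat those of the theorem for an abstract [H]; instantiated at
    L^2(D) they agree by conversion, so the abstract results apply directly at the end. *)
Definition complete_orthonormal : Prop :=
  (forall i j, ip (e i) (e j) = (i == j)%:R) /\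
  forall x : H,
    snorm ip (x - \sum_(n < N) ip x (e n) *: e n) @[N --> \oo] --> (0 : R).

Definition diagonal_dom (al : nat -> R) : set H :=
  [set x | cvgn (series (fun n => al n * ip x (e n) ^+ 2))].

Definition diagonal_op (dom : set H) (c : nat -> R) (L : H -> H) : Prop :=
  forall x, dom x ->
    snorm ip (L x - \sum_(n < N) (c n * ip x (e n)) *: e n) @[N --> \oo]
      --> (0 : R).

Definition energy_space al : set (H * H)%type := [set x | diagonal_dom al x.1].

Definition graph_ip (A12 : H -> H) (x y : H) : R := ip (A12 x) (A12 y).

Definition energy_ip (A12 : H -> H) (x y : (H * H)%type) : R :=
  graph_ip A12 x.1 y.1 + ip x.2 y.2.

Definition wave_dom al : set (H * H)%type :=
  [set x | diagonal_dom (fun n => al n ^+ 2) x.1 /\ diagonal_dom al x.2].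

Hypothesis e_basis : complete_orthonormal.

Lemma ip_basis i j : ip (e i) (e j) = (i == j)%:R.
Proof. by case: e_basis. Qed.

Lemma ip_sum_basis N (c : nat -> R) k :
  ip (\sum_(n < N) c n *: e n) (e k) = if (k < N)%N then c k else 0.
Proof.
rewrite (sip_suml sipH)//.
under eq_bigr do rewrite (sipZl sipH)// ip_basis.
case: ifPn => kN.
  rewrite (bigD1 (Ordinal kN))//= eqxx mulr1 big1 ?addr0// => i ik.
  by rewrite (_ : (i == k :> nat) = false) ?mulr0//; apply/negbTE.
rewrite big1// => i _; rewrite (_ : (i == k :> nat) = false) ?mulr0//.
by apply/negbTE; apply: contraNN kN => /eqP <-.
Qed.

Lemma basis_cvg x :
  snorm ip (\sum_(n < N) ip x (e n) *: e n - x) @[N --> \oo] --> (0 : R).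
Proof.
have [_ h] := e_basis; rewrite (_ : (fun N => _) = (fun N =>
  snorm ip (x - \sum_(n < N) ip x (e n) *: e n))); first exact: h.
by apply/funext => N; rewrite (snorm_distC sipH).
Qed.

Lemma parseval x y :
  series (fun n => ip x (e n) * ip y (e n)) @ \oo --> ip x y.
Proof.
rewrite (_ : series _ = fun N => ip (\sum_(n < N) ip x (e n) *: e n) y).
  by apply: (cvg_ipl sipH) => //; exact: basis_cvg.
apply/funext => N; rewrite /series /= big_mkord (sip_suml sipH)//.
by apply: eq_bigr => i _; rewrite (sipZl sipH)// (sipC sipH (y := y)).
Qed.

Lemma ip_diagonal dom c L x k : diagonal_op dom c L -> dom x ->
  ip (L x) (e k) = c k * ip x (e k).
Proof.
move=> hL Dx; have := hL _ Dx.
have -> : (fun N => snorm ip (L x - \sum_(n < N) (c n * ip x (e n)) *: e n)) =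
  (fun N => snorm ip (\sum_(n < N) (c n * ip x (e n)) *: e n - L x)).
  by apply/funext => N; rewrite (snorm_distC sipH).
move=> /(cvg_ipl sipH (z := e k) (fun=> I) I I) h.
apply: (cvg_uniq h); apply: cvg_near_cst.
near=> N; apply/eqP; rewrite eq_sym (ip_sum_basis _ (fun n => c n * ip x (e n))) ifT//.
by near: N; exact: nbhs_infty_gt.
Unshelve. all: by end_near.
Qed.

Variable al : nat -> R.
Hypothesis al_gt0 : forall n, 0 < al n.
Variable A12 : H -> H.
Hypothesis hA12 : diagonal_op (diagonal_dom al) (fun n => Num.sqrt (al n)) A12.
Local Notation V := (energy_space al).
Local Notation ipv := (energy_ip A12).
Implicit Types x y z : (H * H)%type.

Lemma dom_A12_lin c (x y : H) : diagonal_dom al x -> diagonal_dom al y ->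
  diagonal_dom al (c *: x + y).
Proof.
rewrite /diagonal_dom /= => cx cy.
pose k := 2 * c ^+ 2; have k0 : 0 <= k by rewrite mulr_ge0 ?sqr_ge0.
have aq n (u : R) : 0 <= al n * u ^+ 2 by rewrite mulr_ge0 ?sqr_ge0// ltW.
apply: (@series_le_cvg _ _ (k *: (fun n => al n * ip x (e n) ^+ 2)
    + (2 : R) *: (fun n => al n * ip y (e n) ^+ 2))) => [n|n|n|].
- exact: aq.
- by rewrite addr_ge0// mulr_ge0.
- change (al n * ip (c *: x + y) (e n) ^+ 2 <=
    k * (al n * ip x (e n) ^+ 2) + 2 * (al n * ip y (e n) ^+ 2)).
  rewrite (sipP sipH)// /k.
  have a0 := al_gt0 n; set u := ip x _; set v := ip y _.
  have -> : 2 * c ^+ 2 * (al n * u ^+ 2) + 2 * (al n * v ^+ 2)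
    = al n * (2 * c ^+ 2 * u ^+ 2 + 2 * v ^+ 2) by ring.
  by rewrite ler_pM2l//; have := sqr_ge0 (c * u - v); nra.
- by apply: is_cvg_seriesD; apply: is_cvg_seriesZ.
Qed.

(** Parseval for [A12 x] and [A12 y]. [A12] is prescribed only on its domain and up to null vectors,
    so even the linearity of [graph_ip] is read off this series. *)
Lemma cvg_ipA12 (x y : H) : diagonal_dom al x -> diagonal_dom al y ->
  series (fun n => al n * ip x (e n) * ip y (e n)) @ \oo --> graph_ip A12 x y.
Proof.
move=> Dx Dy; rewrite /graph_ip.
have := @parseval (A12 x) (A12 y).
rewrite (_ : (fun n => ip (A12 x) (e n) * ip (A12 y) (e n)) =
  (fun n => al n * ip x (e n) * ip y (e n)))//.
apply/funext => n; rewrite !(ip_diagonal _ hA12)//.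
by rewrite mulrACA -expr2 sqr_sqrtr ?mulrA// ltW.
Qed.

Lemma cvg_ipV x y : V x -> V y ->
  series (fun n => al n * ip x.1 (e n) * ip y.1 (e n)
                   + ip x.2 (e n) * ip y.2 (e n)) @ \oo --> ipv x y.
Proof.
move=> Vx Vy.
rewrite (_ : series _ = series (fun n => al n * ip x.1 (e n) * ip y.1 (e n))
   \+ series (fun n => ip x.2 (e n) * ip y.2 (e n))).
  by apply: cvgD; [exact: cvg_ipA12|exact: parseval].
by apply/funext => n; rewrite /series /= big_split.
Qed.

Lemma dom_A12_0 : diagonal_dom al 0.
Proof.
rewrite /diagonal_dom /= (_ : (fun n => _) = (fun=> 0)).
  by rewrite (_ : series _ = cst 0); [exact: is_cvg_cst|apply/funext => n; rewrite /series /= big1].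
by apply/funext => n; rewrite (sip0l sipH)// expr0n mulr0.
Qed.

Lemma ipA12_lin c (x y z : H) : diagonal_dom al x -> diagonal_dom al y ->
  diagonal_dom al z -> graph_ip A12 (c *: x + y) z = c * graph_ip A12 x z + graph_ip A12 y z.
Proof.
move=> Dx Dy Dz; apply: (cvg_uniq (@cvg_ipA12 _ _ (@dom_A12_lin c _ _ Dx Dy) Dz)).
rewrite (_ : series _ = (fun n => c * series (fun n => al n * ip x (e n) * ip z (e n)) n
   + series (fun n => al n * ip y (e n) * ip z (e n)) n)).
  by apply: cvgD; [apply: cvgM; [exact: cvg_cst|exact: cvg_ipA12]|exact: cvg_ipA12].
apply/funext => n; rewrite /series /= mulr_sumr -big_split /=.
by apply: eq_bigr => i _; rewrite (sipP sipH)//; ring.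
Qed.

Lemma ipV_sip : semi_inner_product V ipv.
Proof.
split.
- exact: dom_A12_0.
- by move=> c x y Vx Vy; exact: dom_A12_lin.
- by move=> x y _ _; rewrite /energy_ip /graph_ip !(sipC sipH (y := A12 y.1), sipC sipH (y := y.2)).
- move=> c x y z Vx Vy Vz; rewrite /energy_ip ipA12_lin// (sipP sipH)//; ring.
- by move=> x _; rewrite addr_ge0//; apply: (sip_ge0 sipH).
Qed.

Lemma cvg_series_cst (u : nat -> R) N : (forall n, (N <= n)%N -> u n = 0) ->
  series u @ \oo --> \sum_(n < N) u n.
Proof.
move=> u0; apply: cvg_near_cst; near=> n.
have Nn : (N <= n)%N by near: n; exact: nbhs_infty_ge.
apply/eqP; rewrite /series /= -(subnKC Nn) big_mkord big_split_ord /= addrC big1 ?add0r//.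
by move=> i _; rewrite u0// leq_addr.
Unshelve. all: by end_near.
Qed.

Lemma dom_A12_basis N (c : nat -> R) : diagonal_dom al (\sum_(n < N) c n *: e n).
Proof.
apply/cvg_ex; exists (\sum_(n < N) al n * ip (\sum_(n < N) c n *: e n) (e n) ^+ 2).
apply: cvg_series_cst => n Nn.
by rewrite ip_sum_basis ltnNge Nn expr0n mulr0.
Qed.

Lemma dom_A_basis N (c : nat -> R) : diagonal_dom (fun n => al n ^+ 2) (\sum_(n < N) c n *: e n).
Proof.
apply/cvg_ex; exists (\sum_(n < N) al n ^+ 2 * ip (\sum_(n < N) c n *: e n) (e n) ^+ 2).
apply: cvg_series_cst => n Nn.
by rewrite ip_sum_basis ltnNge Nn expr0n mulr0.
Qed.

(** Truncations lie in the domain of the generator and converge in [V]. They extend the oscillator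
    equations beyond the domain, and later replace [z] in the noise. *)
Definition truncation N x : (H * H)%type :=
  (\sum_(n < N) ip x.1 (e n) *: e n, \sum_(n < N) ip x.2 (e n) *: e n).

Lemma truncationV N x : V (truncation N x).
Proof. exact: dom_A12_basis (fun n => ip x.1 (e n)). Qed.

Lemma dom_wave_truncation N x : wave_dom al (truncation N x).
Proof.
split; first exact: dom_A_basis (fun n => ip x.1 (e n)).
exact: dom_A12_basis (fun n => ip x.2 (e n)).
Qed.

Lemma truncation_coef N x k :
  (ip (truncation N x).1 (e k) = if (k < N)%N then ip x.1 (e k) else 0) *
  (ip (truncation N x).2 (e k) = if (k < N)%N then ip x.2 (e k) else 0).
Proof. by split; [rewrite (ip_sum_basis _ (fun n => ip x.1 (e n)))|
  rewrite (ip_sum_basis _ (fun n => ip x.2 (e n)))]. Qed.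

Lemma ipV_truncation N x y : V y -> ipv y (truncation N x) =
  \sum_(n < N) (al n * ip y.1 (e n) * ip x.1 (e n) + ip y.2 (e n) * ip x.2 (e n)).
Proof.
move=> Vy; apply: (cvg_uniq (@cvg_ipV _ _ Vy (@truncationV N x))).
rewrite (_ : \sum_(n < N) _ = \sum_(n < N) (fun n => al n * ip y.1 (e n) * ip (truncation N x).1 (e n) +
   ip y.2 (e n) * ip (truncation N x).2 (e n)) n).
  apply: cvg_series_cst => n Nn.
  by rewrite !truncation_coef ltnNge Nn !mulr0 addr0.
by apply: eq_bigr => i _; rewrite !truncation_coef ltn_ord.
Qed.

Lemma cvg_snorm0 (E : lmodType R) (W : set E) (ipE : E -> E -> R) (x : nat -> E) :
  semi_inner_product W ipE -> (forall n, W (x n)) ->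
  ipE (x n) (x n) @[n --> \oo] --> (0 : R) -> snorm ipE (x n) @[n --> \oo] --> (0 : R).
Proof.
move=> s Wx h; rewrite -[X in _ --> X]sqrtr0.
exact: (continuous_cvg _ (@sqrt_continuous R _)).
Qed.

Lemma truncation_cvg x : V x -> snorm ipv (truncation N x - x) @[N --> \oo] --> (0 : R).
Proof.
move=> Vx; apply: (cvg_snorm0 ipV_sip) => [n|].
  by apply: (sipVB ipV_sip) => //; exact: truncationV.
(* Pythagoras: pairing the truncation with itself or with [x] gives the same finite sum. *)
have E N : ipv (truncation N x - x) (truncation N x - x)
    = ipv x x - ipv x (truncation N x).
  have Vt := @truncationV N x.
  rewrite (sip_sqrB ipV_sip Vt Vx) (sipC ipV_sip Vt Vx) (ipV_truncation _ _ Vt).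
  rewrite (eq_bigr (fun n : 'I_N => al n * ip x.1 (e n) * ip x.1 (e n) + ip x.2 (e n) * ip x.2 (e n))).
    by rewrite -ipV_truncation//; ring.
  by move=> i _; rewrite !truncation_coef ltn_ord.
rewrite (funext E : (fun N => _) = _).
rewrite -[X in _ --> X](subrr (ipv x x)); apply: cvgB; first exact: cvg_cst.
rewrite (_ : (fun N => _) = series (fun n => al n * ip x.1 (e n) * ip x.1 (e n)
   + ip x.2 (e n) * ip x.2 (e n))); first exact: cvg_ipV.
by apply/funext => N; rewrite ipV_truncation// /series /= big_mkord.
Qed.

Lemma V_basis c1 c2 k : V (c1 *: e k, c2 *: e k).
Proof.
rewrite /energy_space /=.
have -> : c1 *: e k = \sum_(n < k.+1) (fun n => if n == k then c1 else 0) n *: e n.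
  rewrite (bigD1 ord_max)//= eqxx big1 ?addr0// => i ik.
  by rewrite ifN ?scale0r//; apply: contraNN ik => /eqP ?; apply/eqP/val_inj.
exact: (@dom_A12_basis k.+1 (fun n => if n == k then c1 else 0)).
Qed.

Lemma dom_wave_basis c1 c2 k : wave_dom al (c1 *: e k, c2 *: e k).
Proof.
have h (c : R) : c *: e k = \sum_(n < k.+1) (fun n => if n == k then c else 0) n *: e n.
  rewrite (bigD1 ord_max)//= eqxx big1 ?addr0// => i ik.
  by rewrite ifN ?scale0r//; apply: contraNN ik => /eqP ?; apply/eqP/val_inj.
by split => /=; rewrite h; [exact: (@dom_A_basis k.+1 (fun n => if n == k then c1 else 0))|
  exact: (@dom_A12_basis k.+1 (fun n => if n == k then c2 else 0))].
Qed.

Lemma ipV_basis x k c1 c2 : V x ->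
  ipv x (c1 *: e k, c2 *: e k) = c1 * al k * ip x.1 (e k) + c2 * ip x.2 (e k).
Proof.
move=> Vx; rewrite /energy_ip /=; congr +%R; last by rewrite (sipZr sipH).
apply: (cvg_uniq (@cvg_ipA12 _ _ Vx (@V_basis c1 c2 k))).
have -> : c1 * al k * ip x.1 (e k) = \sum_(n < k.+1) al n * ip x.1 (e n) * ip (c1 *: e k) (e n).
  rewrite big_ord_recr /= (sipZl sipH)// ip_basis eqxx big1 ?add0r ?mulr1; first by ring.
  move=> i _; rewrite (sipZl sipH)// ip_basis (_ : (k == i) = false) ?mulr0//.
  by apply/negbTE; rewrite neq_ltn ltn_ord orbT.
apply: cvg_series_cst => n kn.
rewrite (sipZl sipH)// ip_basis (_ : (k == n) = false) ?mulr0//.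
by apply/negbTE; rewrite neq_ltn kn.
Qed.

End wave_space.

(** * The damped oscillator *)

Section half_line_derivatives.
Context {R : realType}.
Implicit Types f g df dg : R -> R.

Lemma is_derive_continuous f (t l : R) : is_derive t 1 f l -> {for t, continuous f}.
Proof.
by case=> h _; apply: differentiable_continuous; apply/derivable1_diffP.
Qed.

(** Orbits are unconstrained at negative times, so differentiability is two-sided at [t > 0] and
    only right continuity remains at 0; this is the form in which the mean value theorem applies on
    [[0, t]]. *)
Definition has_derivative f df : Prop :=
  (forall t : R, 0 < t -> is_derive t 1 f (df t)) /\ f t @[t --> (0:R)^'+] --> f 0.

Lemma has_derivative_eq f df dg : has_derivative f df ->
  (forall t : R, 0 < t -> df t = dg t) -> has_derivative f dg.
Proof. by move=> [h c] E; split => // t t0; rewrite -E//; exact: h. Qed.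

Lemma has_derivativeD f df g dg : has_derivative f df -> has_derivative g dg ->
  has_derivative (fun t => f t + g t) (fun t => df t + dg t).
Proof.
move=> [hf cf] [hg cg]; split; last exact: cvgD.
by move=> t t0; apply: (is_deriveD (hf t t0) (hg t t0)).
Qed.

Lemma has_derivativeM f df g dg : has_derivative f df -> has_derivative g dg ->
  has_derivative (fun t => f t * g t) (fun t => df t * g t + f t * dg t).
Proof.
move=> [hf cf] [hg cg]; split; last exact: cvgM.
move=> t t0; apply: (is_derive_eq (is_deriveM (hf t t0) (hg t t0))).
by rewrite /GRing.scale /= addrC mulrC.
Qed.

Lemma has_derivative_cst (c : R) : has_derivative (fun=> c) (fun=> 0).
Proof. by split => [t _|]; [exact: is_derive_cst|exact: cvg_cst]. Qed.

Lemma has_derivativeZ (c : R) f df : has_derivative f df ->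
  has_derivative (fun t => c * f t) (fun t => c * df t).
Proof.
move=> h; apply: (has_derivative_eq (has_derivativeM (has_derivative_cst c) h)).
by move=> t _; rewrite mul0r add0r.
Qed.

Lemma has_derivative_expR (c : R) :
  has_derivative (fun t => expR (c * t)) (fun t => c * expR (c * t)).
Proof.
have h (t : R) : is_derive t 1 (fun t : R => expR (c * t)) (c * expR (c * t)).
  have h1 : is_derive t 1 (fun t : R => c * t) c.
    by apply: (is_derive_eq (is_deriveM (is_derive_cst c t 1) (is_derive_id t 1)));
      rewrite /GRing.scale /=; ring.
  have h2 : is_derive (c * t) 1 (expR : R -> R) (expR (c * t)) by exact: is_derive_expR.
  by apply: (is_derive_eq (is_derive1_comp h2 h1)); rewrite /GRing.scale /= mulrC.
by split=> [t _//|]; apply: cvg_at_right_filter; exact: is_derive_continuous (h 0).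
Qed.

Lemma has_derivative_cont f df : has_derivative f df ->
  forall t : R, 0 < t -> {for t, continuous f}.
Proof. by move=> [h _] t t0; exact: is_derive_continuous (h t t0). Qed.

Lemma has_derivative_LR f df t : has_derivative f df -> 0 < t ->
  derivable_oo_LRcontinuous f 0 t.
Proof.
move=> h t0; split; first by move=> s; rewrite in_itv /= => /andP[s0 _]; case: (h.1 s s0).
- by case: h.
- by apply: cvg_at_left_filter; exact: (has_derivative_cont h t0).
Qed.

Lemma has_derivative_within f df t : has_derivative f df -> 0 < t ->
  {within `[0, t], continuous f}.
Proof. by move=> h t0; apply: derivable_oo_LRcontinuous_within; exact: has_derivative_LR h t0. Qed.

Lemma has_derivative_nincr f df t : has_derivative f df ->
  (forall s : R, 0 < s -> df s <= 0) -> 0 <= t -> f t <= f 0.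
Proof.
move=> h df0; rewrite le_eqVlt => /orP[/eqP <-//|t0].
have [|c c0t E] := MVT t0 _ (has_derivative_within h t0) (df := df).
  by move=> s; rewrite in_itv /= => /andP[s0 _]; exact: h.1.
have c0 : 0 < c by move: c0t; rewrite in_itv /= => /andP[].
by rewrite -subr_le0 E mulr_le0_ge0 ?df0// subr0 ltW.
Qed.

(** The second hypothesis serves to make the integrand [df] continuous on [[0, t]]. *)
Lemma has_derivative_FTC f df ddf t : has_derivative f df -> has_derivative df ddf ->
  0 <= t -> (\int[lebesgue_measure]_(s in `[0%R, t]) (df s)%:E = (f t - f 0)%:E)%E.
Proof.
move=> h h'; rewrite le_eqVlt => /orP[/eqP <-|t0].
  by rewrite set_itv1 integral_set1 subrr.
rewrite (continuous_FTC2 t0 (has_derivative_within h' t0) (has_derivative_LR h t0)).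
  by rewrite EFinB.
move=> s; rewrite in_itv /= => /andP[s0 _].
by rewrite derive1E; case: (h.1 s s0).
Qed.

End half_line_derivatives.

Section damped_oscillator.
Context {R : realType}.
Variable a : R.
Hypothesis a0 : 0 < a.
Implicit Types x y : R -> R.

Definition oscillation (be : R) x y : Prop :=
  has_derivative x y /\ has_derivative y (fun t => - be * x t - 2 * a * y t).

Lemma oscillation_lin be x y x' y' (c : R) : oscillation be x y ->
  oscillation be x' y' ->
  oscillation be (fun t => c * x t + x' t) (fun t => c * y t + y' t).
Proof.
move=> [hx hy] [hx' hy']; split.
  exact: has_derivativeD (has_derivativeZ c hx) hx'.
apply: (has_derivative_eq (has_derivativeD (has_derivativeZ c hy) hy')) => t _; ring.
Qed.

(* The Lyapunov function is [be x^2 + a^2 x^2 + (y + a x)^2]; its derivative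
   is [-2 a (be x^2 + y^2)]. *)
Lemma oscillation_decay (be0 : R) : 0 < be0 -> exists K w : R,
  [/\ 0 < K, 0 < w & forall be x y, be0 <= be -> oscillation be x y ->
    forall t, 0 <= t -> be * x t ^+ 2 + y t ^+ 2 <=
      K * expR (- w * t) * (be * x 0 ^+ 2 + y 0 ^+ 2)].
Proof.
move=> be00; pose C := 2 + 3 * a ^+ 2 / be0.
have C0 : 0 < C by rewrite addr_gt0// divr_gt0// mulr_gt0// exprn_gt0.
(* From [E <= 2 * L] and [L <= C * E]: the derivative [- 2 a E] of [L] is at most [- (2 a / C) L].
   As [C] involves [be0] and not [be], the rate is common to all frequencies. *)
exists (2 * C), (2 * a / C); split; [by rewrite mulr_gt0|by rewrite divr_gt0// mulr_gt0|].
move=> be x y beb [hx hy] t t0.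
have be_gt0 : 0 < be by exact: lt_le_trans beb.
pose L s := (be + a ^+ 2) * (x s * x s) + (y s + a * x s) * (y s + a * x s).
pose E s := be * x s ^+ 2 + y s ^+ 2.
have LE s : E s <= 2 * L s.
  rewrite /E /L; have := sqr_ge0 (y s + 2 * a * x s); have := sqr_ge0 (a * x s).
  by have : 0 <= be * x s ^+ 2 by [rewrite mulr_ge0 ?sqr_ge0// ltW]; nra.
have LC s : L s <= C * E s.
  have h1 : a ^+ 2 <= a ^+ 2 / be0 * be.
    by rewrite mulrAC ler_pdivlMr// ler_pM2l// exprn_gt0.
  have h2 : a ^+ 2 * x s ^+ 2 <= a ^+ 2 / be0 * be * x s ^+ 2 by rewrite ler_wpM2r ?sqr_ge0.
  have h3 : 0 <= a ^+ 2 / be0 * y s ^+ 2 by rewrite mulr_ge0 ?sqr_ge0// divr_ge0 ?sqr_ge0// ltW.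
  have h4 : 0 <= be * x s ^+ 2 by rewrite mulr_ge0 ?sqr_ge0// ltW.
  have h5 := sqr_ge0 (y s - a * x s).
  rewrite /L /E /C.
  have -> : (2 + 3 * a ^+ 2 / be0) * (be * x s ^+ 2 + y s ^+ 2) =
    2 * (be * x s ^+ 2) + 2 * y s ^+ 2 + 3 * (a ^+ 2 / be0 * be * x s ^+ 2) +
    3 * (a ^+ 2 / be0 * y s ^+ 2) by ring.
  by nra.
have hL : has_derivative L (fun s => - (2 * a) * E s).
  have hz := has_derivativeD hy (has_derivativeZ a hx).
  apply: (has_derivative_eq (has_derivativeD
    (has_derivativeZ (be + a ^+ 2) (has_derivativeM hx hx)) (has_derivativeM hz hz))).
  by move=> s _; rewrite /E; ring.
(* Gronwall: [L] times the growing exponential is nonincreasing. *)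
have hF := has_derivativeM (has_derivative_expR (2 * a / C)) hL.
have := has_derivative_nincr hF _ t0; rewrite mulr0 expR0 mul1r => hh.
have {}hh : expR (2 * a / C * t) * L t <= L 0.
  apply: hh => s s0; rewrite -subr_ge0 sub0r.
  have -> : - (2 * a / C * expR (2 * a / C * s) * L s +
    expR (2 * a / C * s) * (- (2 * a) * E s)) =
    (2 * a / C) * expR (2 * a / C * s) * (C * E s - L s) by field; lra.
  by rewrite mulr_ge0 ?subr_ge0// mulr_ge0 ?expR_ge0// divr_ge0 ?mulr_ge0// ltW.
rewrite -/(E t) -/(E 0) (le_trans (LE t))//.
have -> : 2 * C * expR (- (2 * a / C) * t) * E 0 = 2 * (C * E 0 / expR (2 * a / C * t)).
  by rewrite mulNr expRN; ring.
by rewrite ler_pM2l// ler_pdivlMr ?expR_gt0// mulrC (le_trans hh).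
Qed.

(** The difference is an oscillation with zero initial energy, and the decay bound keeps its energy
    at zero. *)
Lemma oscillation_unique be x y x' y' : 0 < be -> oscillation be x y ->
  oscillation be x' y' -> x 0 = x' 0 -> y 0 = y' 0 ->
  forall t, 0 <= t -> x t = x' t /\ y t = y' t.
Proof.
move=> be_gt0 h h' x0 y0 t t0.
have [K [w [_ _ H]]] := oscillation_decay be_gt0.
have := H _ _ _ (lexx be) (oscillation_lin (-1) h h') _ t0.
rewrite x0 y0 !mulN1r !addNr !expr0n !mulr0 addr0 mulr0.
have b1 : 0 <= be * (- x t + x' t) ^+ 2 by rewrite mulr_ge0 ?sqr_ge0// ltW.
have b2 := sqr_ge0 (- y t + y' t) => b3.
have /eqP : be * (- x t + x' t) ^+ 2 = 0 by apply/eqP; rewrite eq_le b1 andbT; nra.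
have /eqP : (- y t + y' t) ^+ 2 = 0 by apply/eqP; rewrite eq_le b2 andbT; nra.
rewrite sqrf_eq0 addrC subr_eq0 => /eqP ->.
by rewrite mulf_eq0 gt_eqF//= sqrf_eq0 addrC subr_eq0 => /eqP ->.
Qed.

(* A quadratic form in [(x, y)] whose derivative along an oscillation is
   [-(c1 x + c2 y)^2]. *)
Definition response_form (be c1 c2 u v : R) : R :=
  let q := c1 ^+ 2 / (2 * be) in
  let r := (c2 ^+ 2 + 2 * q) / (4 * a) in
  (2 * a * q + r * be - c1 * c2) * u ^+ 2 + 2 * q * (u * v) + r * v ^+ 2.

(** Along an oscillation, the derivative of a form [p u^2 + 2 q u v + r v^2] is again quadratic, and
    its coefficients must match those of [- (c1 x + c2 y)^2]. The system is triangular: [x^2] fixes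
    [q], then [y^2] fixes [r], then [x y] fixes [p]. Integration is then exact. *)
Lemma integral_response be x y c1 c2 t : 0 < be -> oscillation be x y -> 0 <= t ->
  (\int[lebesgue_measure]_(s in `[0%R, t]) ((c1 * x s + c2 * y s) ^+ 2)%:E =
   (response_form be c1 c2 (x 0) (y 0) - response_form be c1 c2 (x t) (y t))%:E)%E.
Proof.
move=> be_gt0 [hx hy] t0.
pose q := c1 ^+ 2 / (2 * be); pose r := (c2 ^+ 2 + 2 * q) / (4 * a).
pose p := 2 * a * q + r * be - c1 * c2.
have hf : has_derivative (fun s => - response_form be c1 c2 (x s) (y s))
    (fun s => (c1 * x s + c2 * y s) ^+ 2).
  have h := has_derivativeD (has_derivativeZ (- p) (has_derivativeM hx hx))
   (has_derivativeD (has_derivativeZ (- (2 * q)) (has_derivativeM hx hy))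
    (has_derivativeZ (- r) (has_derivativeM hy hy))).
  have E : (fun s => - response_form be c1 c2 (x s) (y s)) =
    (fun s => - p * (x s * x s) + (- (2 * q) * (x s * y s) + - r * (y s * y s))).
    by apply/funext => s; rewrite /response_form -/q -/r -/p; ring.
  rewrite E; apply: (has_derivative_eq h) => s _.
  by rewrite /p /r /q; field; rewrite !gt_eqF.
have hd := has_derivativeD (has_derivativeZ c1 hx) (has_derivativeZ c2 hy).
have := has_derivative_FTC hf (has_derivativeM hd hd) t0.
by rewrite opprK addrC => <-.
Qed.

(** The state (0, 1) is a unit impulse on the velocity. With [c1 = al z1] and [be = b al], the
    quotient [c1^2 / be] becomes [al z1^2 / b], whence the two terms of the limit variance. *)
Lemma response_form01 be c1 c2 : response_form be c1 c2 0 1 =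
  (c2 ^+ 2 + c1 ^+ 2 / be) / (4 * a).
Proof.
rewrite /response_form expr0n !mul0r mulr0 mulr0 add0r add0r expr1n mulr1 /=.
by congr (_ / _); congr (_ + _); rewrite invfM mulrCA [X in _ * X]mulrA divff// mul1r.
Qed.

End damped_oscillator.

(** * Strongly continuous semigroups *)

Lemma cvg_norm_le {R : realType} {I : Type} {F : set_system I} {FF : Filter F}
    (f g : I -> R) (l : R) : (\forall i \near F, `|f i - l| <= g i) ->
  g i @[i --> F] --> (0 : R) -> f i @[i --> F] --> l.
Proof.
move=> fg g0; apply/cvgrPdist_le => eps eps0; near=> i.
rewrite distrC (@le_trans _ _ (g i))//; first by near: i.
rewrite (le_trans (ler_norm _))// -[g i]subr0 distrC.
by near: i; move/cvgrPdist_le: g0; apply.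
Unshelve. all: by end_near.
Qed.

Section cvg_to_zero.
Context {R : realType} {I : Type} {F : set_system I} {FF : Filter F}.
Implicit Types f g : I -> R.

Lemma cvg0_mull (c : R) f : f i @[i --> F] --> (0 : R) -> c * f i @[i --> F] --> (0 : R).
Proof. by move=> h; rewrite -(mulr0 c); apply: cvgM => //; exact: cvg_cst. Qed.

Lemma cvg0_mulr (c : R) f : f i @[i --> F] --> (0 : R) -> f i * c @[i --> F] --> (0 : R).
Proof. by move=> h; rewrite -(mul0r c); apply: cvgM => //; exact: cvg_cst. Qed.

Lemma cvg0_add f g : f i @[i --> F] --> (0 : R) -> g i @[i --> F] --> (0 : R) ->
  f i + g i @[i --> F] --> (0 : R).
Proof. by move=> hf hg; rewrite -(addr0 0); exact: cvgD. Qed.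

End cvg_to_zero.

Section semigroups.
Context {R : realType} {E : lmodType R} {V : set E} {ip : E -> E -> R}.
Hypothesis sip : semi_inner_product V ip.
Local Notation sn := (snorm ip).

Lemma seqv_snorm x y : V x -> V y -> seqv ip x y -> sn x = sn y.
Proof.
move=> Vx Vy xy; apply/eqP; rewrite -subr_eq0 -normr_le0.
by rewrite (le_trans (dist_snorm sip Vx Vy))// [sn _]xy.
Qed.

Lemma seqv_refl x : seqv ip x x.
Proof. by rewrite /seqv subrr (snorm0 sip). Qed.

Lemma seqvB x x' y y' : V x -> V x' -> V y -> V y' ->
  seqv ip x x' -> seqv ip y y' -> seqv ip (x - y) (x' - y').
Proof.
move=> Vx Vx' Vy Vy' hx hy; apply/eqP; rewrite eq_le snorm_ge0 andbT.
have -> : x - y - (x' - y') = (x - x') - (y - y') by rewrite !opprB [y' - x']addrC addrACA [- y + y']addrC.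
have V1 := sipVB sip Vx Vx'; have V2 := sipVB sip Vy Vy'.
have V3 : V (- (y - y')) by rewrite -scaleN1r; exact: (sipVZ sip).
by rewrite (le_trans (snormD sip V1 V3))// (snormN sip V2) hx hy addr0.
Qed.

Lemma seqvZ (c : R) x x' : V x -> V x' -> seqv ip x x' -> seqv ip (c *: x) (c *: x').
Proof.
move=> Vx Vx' h; rewrite /seqv -scalerBr (snormZ sip); last exact: (sipVB sip).
by rewrite [sn _]h mulr0.
Qed.

Section operator.
Variable L : E -> E.
Hypothesis bL : bounded_linear_op V ip L.

Lemma bounded_linear_V x : V x -> V (L x). Proof. by case: bL => h _ _; exact: h. Qed.

Lemma bounded_linear_ge0 : exists2 C : R, 0 <= C & forall x, V x -> sn (L x) <= C * sn x.
Proof.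
case: bL => _ _ [C hC]; exists (Num.max C 0); first by rewrite le_max lexx orbT.
by move=> x Vx; rewrite (le_trans (hC _ Vx))// ler_wpM2r ?snorm_ge0// le_max lexx.
Qed.

Lemma bounded_linearB x y : V x -> V y -> seqv ip (L (x - y)) (L x - L y).
Proof.
move=> Vx Vy; case: bL => hV hL _; have := hL (-1) y x Vy Vx.
by rewrite !scaleN1r addrC [- L y + _]addrC.
Qed.

Lemma bounded_linear0 : seqv ip (L 0) 0.
Proof.
have [C C0 h] := bounded_linear_ge0; rewrite /seqv subr0; apply/eqP.
by rewrite eq_le snorm_ge0 andbT (le_trans (h _ (sip0 sip)))// (snorm0 sip) mulr0.
Qed.

Lemma bounded_linearZ c x : V x -> seqv ip (L (c *: x)) (c *: L x).
Proof.
move=> Vx; have V0 := sip0 sip; case: (bL) => hV hL _; have := hL c x 0 Vx V0.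
rewrite addr0 => h; apply: (seqv_trans sip _ _ _ h).
- by apply: hV; exact: (sipVZ sip).
- by apply: (sipVD sip); [apply: (sipVZ sip)|]; exact: hV.
- by apply: (sipVZ sip); exact: hV.
- by rewrite /seqv addrAC subrr add0r; have := bounded_linear0; rewrite /seqv subr0.
Qed.

Lemma bounded_linear_quot c x y g : V x -> V y -> V g ->
  seqv ip (L (c *: (x - y) - g)) (c *: (L x - L y) - L g).
Proof.
move=> Vx Vy Vg; have VL := bounded_linear_V.
have Vxy : V (x - y) by exact: (sipVB sip).
have Vc := sipVZ sip c Vxy.
have VLc : V (L (c *: (x - y)) - L g) by apply: (sipVB sip); exact: VL.
have VLL : V (L x - L y) by apply: (sipVB sip); exact: VL.
apply: (seqv_trans sip _ VLc _ (bounded_linearB Vc Vg)).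
- by apply: VL; exact: (sipVB sip).
- by apply: (sipVB sip); [exact: (sipVZ sip)|exact: VL].
apply: seqvB; [exact: VL|exact: (sipVZ sip)|exact: VL|exact: VL| |exact: seqv_refl].
apply: (seqv_trans sip _ _ _ (bounded_linearZ c Vxy)).
- exact: VL.
- by apply: (sipVZ sip); exact: VL.
- exact: (sipVZ sip).
by apply: seqvZ => //; [exact: VL|exact: bounded_linearB].
Qed.

End operator.

Variable S : R -> E -> E.
Hypothesis semiS : C0_semigroup V ip S.

Lemma semigroup_op t : 0 <= t -> bounded_linear_op V ip (S t).
Proof. by case: semiS => h _ _ _; exact: h. Qed.

Lemma semigroupV t x : 0 <= t -> V x -> V (S t x).
Proof. by move=> t0; exact: (bounded_linear_V (semigroup_op t0)). Qed.

Lemma semigroupD s t x : 0 <= s -> 0 <= t -> V x -> seqv ip (S (s + t) x) (S s (S t x)).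
Proof. by case: semiS => _ _ h _; exact: h. Qed.

Lemma semigroup_cvg0 x : V x -> sn (S t x - x) @[t --> 0^'+] --> (0 : R).
Proof. by case: semiS => _ _ _; exact. Qed.

Lemma semigroup_cvgDr t x : 0 <= t -> V x ->
  sn (S (t + h) x - S t x) @[h --> 0^'+] --> (0 : R).
Proof.
move=> t0 Vx; have Vt := semigroupV t0 Vx; have c := semigroup_cvg0 Vt.
apply: cvg_trans c; apply: near_eq_cvg; near=> h.
have h0 : 0 <= h by near: h; exact: nbhs_right_ge.
have Vh := semigroupV h0 Vt.
have Vth : V (S (t + h) x) by apply: semigroupV => //; exact: addr_ge0.
apply: seqv_snorm; [exact: (sipVB sip)|exact: (sipVB sip)|].
apply: seqvB => //; last exact: seqv_refl.
by apply: (seqv_sym sip) => //; rewrite addrC; exact: semigroupD.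
Unshelve. all: by end_near.
Qed.

Definition bounded_by (n : R) (t : R) : Prop := forall x, V x -> sn (S t x) <= n * sn x.

(** A vector that violates the bound at [t] still violates it slightly later, since its orbit is
    continuous from the right. *)
Lemma unbounded_right_open n t : 0 <= t -> ~ bounded_by n t ->
  exists2 d : R, 0 < d & forall s, t <= s <= t + d -> ~ bounded_by n s.
Proof.
move=> t0 /existsNP[x /not_implyP[Vx /negP]]; rewrite -ltNge => ltx.
have Vt := semigroupV t0 Vx.
have /cvgrPdist_lt/(_ (sn (S t x) - n * sn x)) := semigroup_cvgDr t0 Vx.
rewrite subr_gt0 => /(_ ltx)[d /= d0 dP]; exists (d / 2); first by rewrite divr_gt0.
move=> s /andP[]; rewrite le_eqVlt => /orP[/eqP <- _|ts sd] bn.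
  by have := bn _ Vx; rewrite leNgt ltx.
have s0 : 0 <= s by rewrite (le_trans t0)// ltW.
have := bn _ Vx; apply/negP; rewrite -ltNge.
have := dP (s - t); rewrite /ball_ /= !sub0r !normrN subrKC subr_gt0 => /(_ _ ts).
rewrite !ger0_norm ?snorm_ge0 ?subr_ge0 ?(ltW ts)//.
have sdd : s - t < d by lra.
move=> /(_ sdd); have := snorm_le_dist sip Vt (semigroupV s0 Vx).
by rewrite (snorm_distC sip Vt (semigroupV s0 Vx)); lra.
Qed.

(* Baire's theorem for the topology of right neighbourhoods: the sets
   [bounded_by n] are closed under limits from the right and cover [0, +oo[. *)
Lemma semigroup_bounded_itv c : 0 < c -> exists p q n : R,
  [/\ 0 < p, p < q, q < c & forall t, p <= t <= q -> bounded_by n t].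
Proof.
move=> c0; apply: contrapT => no.
pose T := {pq : R * R | [&& 0 < pq.1, pq.1 < pq.2 & pq.2 < c]}.
have step (n : nat) (I : T) : exists J : T, [/\ (sval I).1 <= (sval J).1,
    (sval J).2 <= (sval I).2 &
    forall t, (sval J).1 <= t <= (sval J).2 -> ~ bounded_by n%:R t].
  case: I => -[p q] /= /and3P[p0 pq qc].
  (* Searching only up to the midpoint keeps [t < q], so the next interval, starting at [t], has
     positive length. *)
  pose q' := (p + q) / 2.
  have [t tpq nb] : exists2 t, p <= t <= q' & ~ bounded_by n%:R t.
    apply: contrapT => h; apply: no; exists p, q', n%:R; split => //; rewrite ?/q'; try lra.
    by move=> t tpq; apply: contrapT => nb; apply: h; exists t.
  have [p_t tq] := andP tpq.
  have t0 : 0 <= t by rewrite (le_trans _ p_t)// ltW.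
  have [d d0 dP] := unbounded_right_open t0 nb.
  have H : [&& 0 < t, t < Num.min (t + d) q & Num.min (t + d) q < c].
    by rewrite (lt_le_trans p0 p_t) lt_min gt_min qc orbT andbT ltrDl d0/= /q' in tq *; lra.
  exists (exist _ (t, Num.min (t + d) q) H) => /=; split => //.
    by rewrite ge_min lexx orbT.
  by move=> s /andP[ts]; rewrite le_min => /andP[sd _]; apply: dP; rewrite ts.
have Tc : [&& 0 < c / 3, c / 3 < c / 2 & c / 2 < c] by apply/and3P; split; lra.
have [F FP] := choice (fun nI : nat * T => step nI.1 nI.2).
pose I := fix I n := if n is m.+1 then F (m, I m) else exist _ (c / 3, c / 2) Tc : T.
pose l n := (sval (I n)).1; pose r n := (sval (I n)).2.
have lr n : l n < r n by rewrite /l /r; case: (I n) => -[p q] /= /and3P[].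
have lS n : l n <= l n.+1 by have [] := FP (n, I n).
have rS n : r n.+1 <= r n by have [] := FP (n, I n).
have lm : {homo l : n m / (n <= m)%N >-> n <= m} by exact/nondecreasing_seqP.
have rm : {homo r : n m / (n <= m)%N >-> m <= n} by exact/nonincreasing_seqP.
have lrm n m : l n <= r m.
  by rewrite (le_trans (lm _ _ (leq_maxl n m)))// (le_trans (ltW (lr _)))// rm// leq_maxr.
have hs : has_sup (range l).
  by split; [exists (l 0), 0|exists (r 0) => _ [n _ <-]].
pose t := sup (range l).
have lt n : l n <= t by apply: ub_le_sup; [case: hs|exists n].
have tr n : t <= r n by apply: ge_sup; [case: hs|move=> _ [m _ <-]].
have t0 : 0 <= t by rewrite (le_trans _ (lt 0))// /l /=; lra.
have [C C0 hC] := bounded_linear_ge0 (semigroup_op t0).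
(* The common point [t] lies in the interval number [n + 1], chosen to violate [bounded_by n],
   although [n] exceeds the operator bound [C] of [S t]. *)
pose n := (Num.truncn C).+1.
have [_ _ /(_ t)] := FP (n, I n); apply; first by rewrite (lt n.+1) (tr n.+1).
by move=> x Vx; rewrite (le_trans (hC _ Vx))// ler_wpM2r ?snorm_ge0// ltW// truncnS_gt.
Qed.

(** Baire gives one interval [[p, q]] inside []0, c[]. Composing with the single operator
    [S (q - p)] moves the bound to the right by [q - p] at the price of a factor [C], and finitely
    many moves reach [T]. *)
Lemma semigroup_locally_bounded c T : 0 < c ->
  exists2 M : R, 0 <= M & forall t, c <= t <= T -> bounded_by M t.
Proof.
move=> c0; have [p [q [n [p0 pq qc npq]]]] := semigroup_bounded_itv c0.
have l0 : 0 < q - p by rewrite subr_gt0.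
have [C C0 hC] := bounded_linear_ge0 (semigroup_op (ltW l0)).
have H (k : nat) : exists2 M : R, 0 <= M & forall t, p <= t <= p + k.+1%:R * (q - p) -> bounded_by M t.
  elim: k => [|k [M M0 hM]].
    exists (Num.max n 0); first by rewrite le_max lexx orbT.
    move=> t; rewrite mul1r subrKC => /npq h x /h hx.
    by rewrite (le_trans hx)// ler_wpM2r ?snorm_ge0// le_max lexx.
  exists (Num.max M (C * M)); first by rewrite le_max M0.
  move=> t /andP[pt tk] x Vx.
  have [tk1|tk1] := leP t (p + k.+1%:R * (q - p)).
    by rewrite (le_trans (hM _ _ _ Vx)) ?pt// ler_wpM2r ?snorm_ge0// le_max lexx.
  have h1 : p <= t - (q - p) <= p + k.+1%:R * (q - p).
    have h : q - p <= k.+1%:R * (q - p) by rewrite ler_peMl ?ler1n// ltW.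
    by move: tk; rewrite -[k.+2%:R]natr1 mulrDl mul1r; lra.
  have tq0 : 0 <= t - (q - p) by case/andP: h1 => + _; apply: le_trans; exact: ltW.
  have := semigroupD (ltW l0) tq0 Vx; rewrite subrKC => h.
  have Vs := semigroupV tq0 Vx.
  have t0 : 0 <= t by rewrite (le_trans (ltW p0)).
  rewrite (seqv_snorm _ _ h); [|exact: semigroupV|by apply: semigroupV => //; exact: ltW].
  rewrite (le_trans (hC _ Vs))// (@le_trans _ _ (C * (M * sn x)))//.
    by rewrite ler_wpM2l// hM.
  by rewrite mulrA ler_wpM2r ?snorm_ge0// le_max lexx orbT.
have [M M0 hM] := H (Num.truncn ((T - p) / (q - p))).
exists M => // t /andP[ct tT]; apply: hM.
rewrite (le_trans _ ct) ?(le_trans (ltW pq) (ltW qc))//= (le_trans tT)//.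
by rewrite -lerBlDl -ler_pdivrMr// ltW// truncnS_gt.
Qed.

(** [S (t - h) x - S t x] is [S (t - h)] applied to [x - S h x], and for [h <= t / 2] these
    operators are uniformly bounded. *)
Lemma semigroup_cvgBr t x : 0 < t -> V x ->
  sn (S (t - h) x - S t x) @[h --> 0^'+] --> (0 : R).
Proof.
move=> t0 Vx; have [M M0 hM] := semigroup_locally_bounded t (divr_gt0 t0 (ltr0Sn R 1)).
apply: (@squeeze_cvgr _ _ _ _ (fun=> 0) (fun h => M * sn (S h x - x))); last 2 first.
- exact: cvg_cst.
- by apply: cvg0_mull; exact: semigroup_cvg0.
near=> h; rewrite snorm_ge0 /=.
have h0 : 0 <= h by near: h; exact: nbhs_right_ge.
have ht : h <= t / 2 by near: h; apply: nbhs_right_le; rewrite divr_gt0.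
have th0 : 0 <= t - h by lra.
have Vh := semigroupV h0 Vx; have Vth := semigroupV th0 Vx.
have Vt := semigroupV (ltW t0) Vx; have Vthh := semigroupV th0 Vh.
have opth := semigroup_op th0.
have e1 : seqv ip (S t x) (S (t - h) (S h x)) by have := semigroupD th0 h0 Vx; rewrite subrK.
have e2 := bounded_linearB opth Vh Vx.
have VB : V (S h x - x) by exact: (sipVB sip).
rewrite (snorm_distC sip)// (_ : sn (S t x - S (t - h) x) = sn (S (t - h) (S h x - x))).
  by apply: hM => //; lra.
rewrite (seqv_snorm (semigroupV th0 VB) _ e2); last exact: (sipVB sip).
by apply: seqv_snorm; [exact: (sipVB sip)|exact: (sipVB sip)|apply: seqvB => //; exact: seqv_refl].
Unshelve. all: by end_near.
Qed.

Variables (dom : set E) (G : E -> E).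
Hypothesis genS : generated_by V ip S dom G.
Hypothesis domV : forall x, dom x -> V x.
Hypothesis GV : forall x, dom x -> V (G x).

Lemma generator_cvg x : dom x ->
  sn (t^-1 *: (S t x - x) - G x) @[t --> 0^'+] --> (0 : R).
Proof. by move=> Dx; apply/(genS (domV Dx) (GV Dx)); split => //; exact: seqv_refl. Qed.

(** [S h] and [S t] commute, so the difference quotient of [S t x] is the image under [S t] of the
    quotient of [x]. As [generated_by] is an equivalence, convergence also yields membership in the
    domain. *)
Lemma generator_semigroup t x : 0 <= t -> dom x ->
  dom (S t x) /\ seqv ip (S t (G x)) (G (S t x)).
Proof.
move=> t0 Dx; have Vx := domV Dx; have VG := GV Dx.
have op := semigroup_op t0.
apply/(genS (semigroupV t0 Vx) (semigroupV t0 VG)).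
have [C C0 hC] := bounded_linear_ge0 op.
apply: (@squeeze_cvgr _ _ _ _ (fun=> 0) (fun h => C * sn (h^-1 *: (S h x - x) - G x))); last 2 first.
- exact: cvg_cst.
- by apply: cvg0_mull; exact: generator_cvg.
near=> h; rewrite snorm_ge0 /=.
have h0 : 0 <= h by near: h; exact: nbhs_right_ge.
have Vh := semigroupV h0 Vx; have Vt := semigroupV t0 Vx.
have Vht := semigroupV h0 Vt; have Vth := semigroupV t0 Vh.
have Vq : V (h^-1 *: (S h x - x) - G x).
  by apply: (sipVB sip) => //; apply: (sipVZ sip); exact: (sipVB sip).
have := hC _ Vq; apply: le_trans; rewrite le_eqVlt; apply/orP; left; apply/eqP.
have VSG := semigroupV t0 VG.
have V1 : V (S h (S t x) - S t x) by exact: (sipVB sip).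
have V2 : V (S t (S h x) - S t x) by exact: (sipVB sip).
have V3 := sipVB sip (sipVZ sip h^-1 V1) VSG.
have V4 := sipVB sip (sipVZ sip h^-1 V2) VSG.
rewrite (seqv_snorm (semigroupV t0 Vq) V4 (bounded_linear_quot op h^-1 Vh Vx VG)).
apply: seqv_snorm => //; apply: seqvB => //; [exact: (sipVZ sip)|exact: (sipVZ sip)| |exact: seqv_refl].
apply: seqvZ => //; apply: seqvB => //; last exact: seqv_refl.
have Vth' := semigroupV (addr_ge0 t0 h0) Vx.
apply: (seqv_trans sip Vht Vth' Vth); last exact: semigroupD.
by apply: (seqv_sym sip) => //; rewrite addrC; exact: semigroupD.
Unshelve. all: by end_near.
Qed.

Lemma is_derive_LR (f : R -> R) (t l : R) :
  h^-1 * (f (t + h) - f t) @[h --> 0^'+] --> l ->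
  h^-1 * (f t - f (t - h)) @[h --> 0^'+] --> l -> is_derive t 1 f l.
Proof.
move=> hr hl.
have h : h^-1 * (f (h * 1 + t) - f t) @[h --> (0 : R)^'] --> l.
  apply: (@cvg_at_right_left_dnbhs _ R^o).
    apply: cvg_trans hr; apply: near_eq_cvg; near=> h.
    by rewrite mulr1 [h + t]addrC.
  apply/cvg_at_leftNP; rewrite oppr0.
  apply: cvg_trans hl; apply: near_eq_cvg; near=> h.
  by rewrite /= mulr1 [- h + t]addrC invrN mulNr -mulrN opprB.
by apply: DeriveDef; [apply/cvg_ex; exists l|exact: cvg_lim h].
Unshelve. all: by end_near.
Qed.

Lemma is_derive_semigroup (t : R) x z : 0 < t -> dom x -> V z ->
  is_derive t 1 (fun s => ip (S s x) z) (ip (S t (G x)) z).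
Proof.
move=> t0 Dx Vz; have Vx := domV Dx; have VG := GV Dx.
have VSG := semigroupV (ltW t0) VG.
have Vt := semigroupV (ltW t0) Vx.
(* One identity for both sides: [s = t] gives the right quotient, [s = t - h] the left one, with a
   last term that vanishes or tends to 0. *)
have quot h s : 0 <= h -> 0 <= s -> let q := h^-1 *: (S h x - x) - G x in
    h^-1 * (ip (S (s + h) x) z - ip (S s x) z) - ip (S t (G x)) z =
    ip (S s q) z + ip (S s (G x) - S t (G x)) z.
  move=> h0 s0 q; have op := semigroup_op s0; have Vh := semigroupV h0 Vx.
  have Vs := semigroupV s0 Vx; have Vsh := semigroupV s0 Vh.
  have VsG := semigroupV s0 VG.
  have Vq : V q by apply: (sipVB sip) => //; apply: (sipVZ sip); exact: (sipVB sip).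
  have V4 := sipVB sip Vsh Vs.
  have V5 := sipVZ sip h^-1 V4.
  rewrite (seqv_ipl sip (semigroupV s0 Vq) (sipVB sip V5 VsG) Vz (bounded_linear_quot op h^-1 Vh Vx VG)).
  rewrite !(sipBl sip)// (sipZl sip)// (sipBl sip)//.
  rewrite (seqv_ipl sip (semigroupV (addr_ge0 s0 h0) Vx) Vsh Vz (semigroupD s0 h0 Vx)).
  by rewrite addrA subrK.
have Vq h : 0 <= h -> V (h^-1 *: (S h x - x) - G x).
  move=> h0; apply: (sipVB sip) => //; apply: (sipVZ sip); apply: (sipVB sip) => //.
  exact: semigroupV.
apply: is_derive_LR.
  have [C C0 hC] := bounded_linear_ge0 (semigroup_op (ltW t0)).
  apply: (@cvg_norm_le _ _ _ _ _ (fun h => C * sn (h^-1 *: (S h x - x) - G x) * sn z)).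
    near=> h; have h0 : 0 <= h by near: h; exact: nbhs_right_ge.
    have Vqh := Vq _ h0.
    rewrite quot// ?(ltW t0)// subrr (sip0l sip)// addr0.
    rewrite (le_trans (sip_le_snorm sip (semigroupV (ltW t0) Vqh) Vz))//.
    by rewrite ler_wpM2r ?snorm_ge0// hC.
  by apply: cvg0_mulr; apply: cvg0_mull; exact: generator_cvg.
have [M M0 hM] := semigroup_locally_bounded t (divr_gt0 t0 (ltr0Sn R 1)).
apply: (@cvg_norm_le _ _ _ _ _ (fun h => M * sn (h^-1 *: (S h x - x) - G x) * sn z
   + sn (S (t - h) (G x) - S t (G x)) * sn z)).
  near=> h; have h0 : 0 <= h by near: h; exact: nbhs_right_ge.
  have ht : h <= t / 2 by near: h; apply: nbhs_right_le; rewrite divr_gt0.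
  have th0 : 0 <= t - h by lra.
  have Vqh := Vq _ h0; have VthG := semigroupV th0 VG.
  have := quot h (t - h) h0 th0; rewrite subrK => ->.
  rewrite (le_trans (ler_normD _ _))// lerD//.
    rewrite (le_trans (sip_le_snorm sip (semigroupV th0 Vqh) Vz))//.
    by rewrite ler_wpM2r ?snorm_ge0// hM//; lra.
  exact: (sip_le_snorm sip (sipVB sip VthG VSG) Vz).
apply: cvg0_add; apply: cvg0_mulr; last exact: semigroup_cvgBr.
by apply: cvg0_mull; exact: generator_cvg.
Unshelve. all: by end_near.
Qed.

Lemma has_derivative_semigroup x z : dom x -> V z ->
  has_derivative (fun s => ip (S s x) z) (fun t => ip (S t (G x)) z).
Proof.
move=> Dx Vz; have Vx := domV Dx; split=> [t t0|]; first exact: is_derive_semigroup.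
have V0 := semigroupV (lexx 0) Vx.
have S0 : seqv ip (S 0 x) x by case: semiS => _ h _ _; exact: h.
rewrite (seqv_ipl sip V0 Vx Vz S0).
apply: (@cvg_norm_le _ _ _ _ _ (fun t => sn (S t x - x) * sn z)).
  near=> h; have h0 : 0 <= h by near: h; exact: nbhs_right_ge.
  rewrite -(sipBl sip)//; last exact: semigroupV.
  by apply: (sip_le_snorm sip) => //; apply: (sipVB sip) => //; exact: semigroupV.
by apply: cvg0_mulr; exact: semigroup_cvg0.
Unshelve. all: by end_near.
Qed.

End semigroups.

(** * Modes of the wave equation *)

Section oscillation_extensionality.
Context {R : realType}.

Lemma has_derivative_ext (f g df : R -> R) : (forall t, 0 <= t -> f t = g t) ->
  has_derivative f df -> has_derivative g df.
Proof.
move=> fg [h c]; split=> [t t0|].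
  apply: near_eq_is_derive (h t t0); near=> s; apply: fg; apply: ltW.
  by near: s; exact: lt_nbhsr.
rewrite -fg//; apply: cvg_trans c; apply: near_eq_cvg; near=> s.
by rewrite fg//; near: s; exact: nbhs_right_ge.
Unshelve. all: by end_near.
Qed.

Lemma oscillation_ext (a be : R) (x x' y y' : R -> R) :
  (forall t, 0 <= t -> x' t = x t) -> (forall t, 0 <= t -> y' t = y t) ->
  oscillation a be x' y' -> oscillation a be x y.
Proof.
move=> hx hy [h1 h2]; split.
  by apply: (has_derivative_ext hx (has_derivative_eq h1 _)) => t /ltW; exact: hy.
apply: (has_derivative_ext hy (has_derivative_eq h2 _)) => t /ltW t0.
by rewrite hx// hy.
Qed.

Lemma oscillation0 (a be : R) : oscillation a be (fun=> 0) (fun=> 0).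
Proof.
by split; apply: (has_derivative_eq (has_derivative_cst 0)) => t _; rewrite ?mulr0 ?subr0.
Qed.

End oscillation_extensionality.

Section wave_modes.
Context {R : realType} {H : lmodType R} {ip : H -> H -> R}.
Hypothesis sipH : semi_inner_product setT ip.
Variable e : nat -> H.
Hypothesis e_basis : complete_orthonormal (ip := ip) e.
Variables (al : nat -> R) (al0 : R).
Hypotheses (al0_gt0 : 0 < al0) (al_ge : forall n, al0 <= al n).
Variables A A12 : H -> H.
Local Notation dom_A12 := (diagonal_dom (ip := ip) e al).
Local Notation dom_A := (diagonal_dom (ip := ip) e (fun n => al n ^+ 2)).
Hypothesis hA : diagonal_op (ip := ip) e dom_A (fun n => - al n) A.
Hypothesis hA12 : diagonal_op (ip := ip) e dom_A12 (fun n => Num.sqrt (al n)) A12.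
Local Notation V := (energy_space (ip := ip) e al).
Local Notation ipv := (energy_ip (ip := ip) A12).
Variables a b : R.
Hypotheses (a_gt0 : 0 < a) (b_gt0 : 0 < b).

Definition wave_generator (x : (H * H)%type) : (H * H)%type :=
  (x.2, b *: A x.1 - (2 * a) *: x.2).

Variable S : R -> (H * H)%type -> (H * H)%type.
Hypothesis semiS : C0_semigroup V ipv S.
Hypothesis genS : generated_by V ipv S (wave_dom (ip := ip) e al) wave_generator.
Implicit Types x y z : (H * H)%type.

Let al_gt0 n : 0 < al n. Proof. exact: lt_le_trans (al_ge n). Qed.
Let sipV : semi_inner_product V ipv := ipV_sip sipH e_basis al_gt0 hA12.
Local Notation cf x k := (ip x (e k)).

Lemma wave_domV x : wave_dom (ip := ip) e al x -> V x.
Proof.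
case=> h _; apply: (@series_le_cvg _ _ (al0^-1 *: (fun n => al n ^+ 2 * cf x.1 n ^+ 2))).
- by move=> n; rewrite mulr_ge0 ?sqr_ge0// ltW.
- move=> n; rewrite [leRHS]/(al0^-1 * (al n ^+ 2 * cf x.1 n ^+ 2)).
  by rewrite mulr_ge0 ?invr_ge0 ?(ltW al0_gt0)// mulr_ge0 ?sqr_ge0.
- move=> n; change (al n * cf x.1 n ^+ 2 <= al0^-1 * (al n ^+ 2 * cf x.1 n ^+ 2)).
  rewrite [leRHS]mulrA ler_wpM2r ?sqr_ge0// ler_pdivlMl//.
  by rewrite expr2 ler_wpM2r// ltW.
- exact: is_cvg_seriesZ.
Qed.

Lemma wave_generatorV x : wave_dom (ip := ip) e al x -> V (wave_generator x).
Proof. by case. Qed.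

(** Coefficients are pairings in [V] with multiples of basis vectors; thus derivatives, limits and
    measurability, all stated for pairings, pass to them. *)
Lemma coef1E x k : V x -> cf x.1 k = ipv x ((al k)^-1 *: e k, 0 *: e k).
Proof.
move=> Vx; rewrite (ipV_basis sipH e_basis al_gt0 hA12)// mul0r addr0 mulVf ?mul1r//.
by rewrite gt_eqF.
Qed.

Lemma coef2E x k : V x -> cf x.2 k = ipv x (0 *: e k, 1 *: e k).
Proof. by move=> Vx; rewrite (ipV_basis sipH e_basis al_gt0 hA12)// !mul0r add0r mul1r. Qed.

Let VZ c1 c2 k : V (c1 *: e k, c2 *: e k).
Proof. exact: V_basis. Qed.

Lemma seqv_coef x y k : V x -> V y -> seqv ipv x y ->
  (cf x.1 k = cf y.1 k) * (cf x.2 k = cf y.2 k).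
Proof.
move=> Vx Vy xy; rewrite !coef1E// !coef2E//.
by split; exact: (seqv_ipl sipV Vx Vy (@VZ _ _ k)).
Qed.

Lemma oscillation_dom x k : wave_dom (ip := ip) e al x ->
  oscillation a (b * al k) (fun t => ip (S t x).1 (e k)) (fun t => ip (S t x).2 (e k)).
Proof.
move=> Dx; have Vx := wave_domV Dx.
have h1 := has_derivative_semigroup sipV semiS genS wave_domV wave_generatorV Dx
  (@VZ (al k)^-1 0 k).
have h2 := has_derivative_semigroup sipV semiS genS wave_domV wave_generatorV Dx
  (@VZ 0 1 k).
have VS t : 0 <= t -> V (S t x) by move=> t0; exact: (semigroupV semiS t0 Vx).
split.
  apply: (has_derivative_ext _ (has_derivative_eq h1 _)) => [t t0|t t0].
    by rewrite -coef1E//; exact: VS.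
  have [Dt Gt] := generator_semigroup sipV semiS genS wave_domV wave_generatorV (ltW t0) Dx.
  have VSG : V (S t (wave_generator x)).
    by apply: (semigroupV semiS (ltW t0)); exact: wave_generatorV.
  by rewrite -coef1E// (seqv_coef k VSG (wave_generatorV Dt) Gt).
apply: (has_derivative_ext _ (has_derivative_eq h2 _)) => [t t0|t t0].
  by rewrite -coef2E//; exact: VS.
have [Dt Gt] := generator_semigroup sipV semiS genS wave_domV wave_generatorV (ltW t0) Dx.
have VSG : V (S t (wave_generator x)).
  by apply: (semigroupV semiS (ltW t0)); exact: wave_generatorV.
rewrite -coef2E// (seqv_coef k VSG (wave_generatorV Dt) Gt) /=.
rewrite (sipBl sipH)// !(sipZl sipH)// (ip_diagonal sipH e_basis _ hA); last by case: Dt.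
by ring.
Qed.

(** [mode1] and [mode2] are the displacement and velocity of the impulse response of mode [k]: the
    noise acts on the velocity alone. *)
Definition mode1 k (t : R) : R := cf (S t (0 *: e k, 1 *: e k)).1 k.
Definition mode2 k (t : R) : R := cf (S t (0 *: e k, 1 *: e k)).2 k.

Let be_gt0 k : 0 < b * al k. Proof. by rewrite mulr_gt0. Qed.

Let wave_basis c1 c2 k : wave_dom (ip := ip) e al (c1 *: e k, c2 *: e k).
Proof. exact: dom_wave_basis. Qed.

Let S0 x : V x -> seqv ipv (S 0 x) x.
Proof. by case: semiS => _ h _ _; exact: h. Qed.

Let coef_init x k : V x -> (cf (S 0 x).1 k = cf x.1 k) * (cf (S 0 x).2 k = cf x.2 k).
Proof. by move=> Vx; apply: seqv_coef (S0 Vx) => //; exact: (semigroupV semiS (lexx 0) Vx). Qed.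

Lemma oscillation_mode k : oscillation a (b * al k) (mode1 k) (mode2 k).
Proof. exact: oscillation_dom (wave_basis 0 1 k). Qed.

Lemma mode_init k : mode1 k 0 = 0 /\ mode2 k 0 = 1.
Proof.
rewrite /mode1 /mode2 !(coef_init _ (@VZ 0 1 k)) /= !(sipZl sipH)//.
by rewrite (ip_basis e_basis) eqxx mul0r mul1r.
Qed.

(** An orbit that starts outside the domain need not be differentiable in [V], but its coefficients
    are: those of the truncated orbits do not depend on [N] once [k < N], and continuity of [S t]
    carries them to [x]. *)
Lemma oscillation_semigroup x k : V x ->
  oscillation a (b * al k) (fun t => cf (S t x).1 k) (fun t => cf (S t x).2 k).
Proof.
move=> Vx.
have o1 := oscillation_dom k (wave_basis 1 0 k).
have o2 := oscillation_mode k.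
(* The combination of the two fundamental solutions with the initial data of [x] in mode [k];
   [oscillation0] closes the nested sums of the form [c x + x']. *)
have o := oscillation_lin (cf x.1 k) o1 (oscillation_lin (cf x.2 k) o2 (oscillation0 a (b * al k))).
have E t : 0 <= t -> forall N, (k < N)%N ->
  (cf (S t (truncation (ip := ip) e N x)).1 k = cf x.1 k * cf (S t (1 *: e k, 0 *: e k)).1 k
     + (cf x.2 k * mode1 k t + 0)) /\
  (cf (S t (truncation (ip := ip) e N x)).2 k = cf x.1 k * cf (S t (1 *: e k, 0 *: e k)).2 k
     + (cf x.2 k * mode2 k t + 0)).
  move=> t0 N kN; have DN := dom_wave_truncation sipH e_basis al N x.
  have [m10 m20] := mode_init k.
  apply: (oscillation_unique a_gt0 (be_gt0 k) (oscillation_dom k DN) o _ _ t0).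
    rewrite m10 !(coef_init _ (@VZ 1 0 k)) (coef_init k (wave_domV DN)) /=.
    rewrite (truncation_coef sipH e_basis) kN (sipZl sipH)// (ip_basis e_basis) eqxx.
    by rewrite mulr0 !addr0 !mulr1.
  rewrite m20 !(coef_init _ (@VZ 1 0 k)) (coef_init k (wave_domV DN)) /=.
  rewrite (truncation_coef sipH e_basis) kN (sipZl sipH)// (ip_basis e_basis) eqxx.
  by rewrite mul0r mulr0 !addr0 add0r mulr1.
have cv t z : 0 <= t -> V z ->
    ipv (S t (truncation (ip := ip) e N x)) z @[N --> \oo] --> ipv (S t x) z.
  move=> t0 Vz; have op := semigroup_op semiS t0.
  have VN N : V (truncation (ip := ip) e N x) by exact: truncationV.
  have [C C0 hC] := bounded_linear_ge0 op.
  apply: (cvg_ipl sipV _ (semigroupV semiS t0 Vx) Vz) => [N|].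
    exact: (semigroupV semiS t0 (VN N)).
  apply: (@squeeze_cvgr _ _ _ _ (fun=> 0) (fun N => C * snorm ipv (truncation (ip := ip) e N x - x))).
  - near=> N; rewrite snorm_ge0 /=.
    have VB := sipVB sipV (VN N) Vx.
    rewrite -(seqv_snorm sipV (semigroupV semiS t0 VB) _ (bounded_linearB op (VN N) Vx)).
      exact: hC.
    by apply: (sipVB sipV); apply: (semigroupV semiS t0).
  - exact: cvg_cst.
  - apply: cvg0_mull; exact: (truncation_cvg sipH e_basis al_gt0 hA12).
have VN N : V (truncation (ip := ip) e N x) by exact: truncationV.
have EE t : 0 <= t ->
  (cf (S t x).1 k = cf x.1 k * cf (S t (1 *: e k, 0 *: e k)).1 k
     + (cf x.2 k * mode1 k t + 0)) /\
  (cf (S t x).2 k = cf x.1 k * cf (S t (1 *: e k, 0 *: e k)).2 k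
     + (cf x.2 k * mode2 k t + 0)).
  move=> t0; have VSx := semigroupV semiS t0 Vx; split.
    rewrite coef1E//; apply: (cvg_uniq (cv t _ t0 (@VZ (al k)^-1 0 k))).
    apply: cvg_near_cst; near=> N; rewrite -coef1E; last exact: (semigroupV semiS t0 (VN N)).
    have kN : (k < N)%N by near: N; exact: nbhs_infty_gt.
    by rewrite (E t t0 N kN).1.
  rewrite coef2E//; apply: (cvg_uniq (cv t _ t0 (@VZ 0 1 k))).
  apply: cvg_near_cst; near=> N; rewrite -coef2E; last exact: (semigroupV semiS t0 (VN N)).
  have kN : (k < N)%N by near: N; exact: nbhs_infty_gt.
  by rewrite (E t t0 N kN).2.
apply: (oscillation_ext _ _ o) => t t0; first by rewrite (EE t t0).1.
by rewrite (EE t t0).2.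
Unshelve. all: by end_near.
Qed.

Lemma coef_noise h k t : 0 <= t ->
  cf (S t (0, h)).1 k = cf h k * mode1 k t /\ cf (S t (0, h)).2 k = cf h k * mode2 k t.
Proof.
move=> t0; have V0 : V (0, h) by exact: dom_A12_0.
have [m10 m20] := mode_init k.
have o := oscillation_lin (cf h k) (oscillation_mode k) (oscillation0 a (b * al k)).
have [||-> ->] := oscillation_unique a_gt0 (be_gt0 k) (oscillation_semigroup k V0) o _ _ t0.
- by rewrite (coef_init k V0) m10 mulr0 addr0 (sip0l sipH).
- by rewrite (coef_init k V0) m20 mulr1 addr0.
- by rewrite !addr0.
Qed.

(** The pairing in [V] of [z] with the orbit of the impulse [(0, e k)]. *)
Definition response z k (t : R) : R :=
  al k * cf z.1 k * mode1 k t + cf z.2 k * mode2 k t.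

Lemma ipV_noise h z N t : 0 <= t ->
  ipv (S t (0, h)) (truncation (ip := ip) e N z) = \sum_(k < N) cf h k * response z k t.
Proof.
move=> t0; have V0 : V (0, h) by exact: dom_A12_0.
rewrite (ipV_truncation sipH e_basis al_gt0 hA12); last exact: (semigroupV semiS t0 V0).
apply: eq_bigr => k _; have [-> ->] := coef_noise h k t0.
by rewrite /response; ring.
Qed.

Definition mode_energy z k : R := al k * cf z.1 k ^+ 2 + cf z.2 k ^+ 2.

Lemma mode_energy_ge0 z k : 0 <= mode_energy z k.
Proof. by rewrite addr_ge0 ?sqr_ge0// mulr_ge0 ?sqr_ge0// ltW. Qed.

Lemma cvg_mode_energy z : V z -> series (mode_energy z) @ \oo --> ipv z z.
Proof.
move=> Vz; have := cvg_ipV sipH e_basis al_gt0 hA12 Vz Vz.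
rewrite (_ : (fun n => _) = mode_energy z)//.
by apply/funext => n; rewrite /mode_energy; ring.
Qed.

Lemma mode_energy_decay : exists K w : R, [/\ 0 < K, 0 < w &
  forall x k t, V x -> 0 <= t ->
    mode_energy (S t x) k <= K * expR (- w * t) * mode_energy x k].
Proof.
have [K [w [K0 w0 dk]]] := oscillation_decay a_gt0 (mulr_gt0 b_gt0 al0_gt0).
(* The oscillator energy weighs the displacement by [b al k], the norm of [V] by [al k]; the factors
   [1 + b^-1] and [1 + b] convert one into the other. *)
exists ((1 + b^-1) * K * (1 + b)), w; split => //.
  by rewrite !mulr_gt0// addr_gt0// invr_gt0.
move=> x k t Vx t0.
have := dk (b * al k) _ _ _ (oscillation_semigroup k Vx) t t0.
rewrite ler_pM2l// => /(_ (al_ge k)).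
rewrite !(coef_init k Vx) /mode_energy.
set X := ip (S t x).1 _; set Y := ip (S t x).2 _; set x1 := ip x.1 _; set x2 := ip x.2 _.
have u1 : 0 <= al k * X ^+ 2 by rewrite mulr_ge0 ?sqr_ge0// ltW.
have u2 : 0 <= al k * x1 ^+ 2 by rewrite mulr_ge0 ?sqr_ge0// ltW.
have v1 := sqr_ge0 Y; have v2 := sqr_ge0 x2.
have h1 : al k * X ^+ 2 + Y ^+ 2 <= (1 + b^-1) * (b * al k * X ^+ 2 + Y ^+ 2).
  have -> : (1 + b^-1) * (b * al k * X ^+ 2 + Y ^+ 2) = al k * X ^+ 2 + Y ^+ 2 +
    (b * (al k * X ^+ 2) + b^-1 * Y ^+ 2) by field; rewrite gt_eqF.
  by rewrite lerDl addr_ge0// mulr_ge0// ?invr_ge0 ltW.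
have h2 : b * al k * x1 ^+ 2 + x2 ^+ 2 <= (1 + b) * (al k * x1 ^+ 2 + x2 ^+ 2).
  have := mulr_ge0 (ltW b_gt0) v2; lra.
move=> h; apply: (le_trans h1).
have -> : (1 + b^-1) * K * (1 + b) * expR (- w * t) * (al k * x1 ^+ 2 + x2 ^+ 2) =
  (1 + b^-1) * (K * expR (- w * t) * ((1 + b) * (al k * x1 ^+ 2 + x2 ^+ 2))) by ring.
rewrite ler_pM2l ?addr_gt0 ?invr_gt0//; apply: (le_trans h).
by rewrite ler_pM2l// mulr_gt0// expR_gt0.
Qed.

Lemma semigroup_stable : exists K w : R, [/\ 0 < K, 0 < w &
  forall x t, V x -> 0 <= t ->
    ipv (S t x) (S t x) <= K * expR (- w * t) * ipv x x].
Proof.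
have [K [w [K0 w0 dk]]] := mode_energy_decay; exists K, w; split => // x t Vx t0.
have c1 := cvg_mode_energy (semigroupV semiS t0 Vx).
have c2 : (fun n => K * expR (- w * t) * series (mode_energy x) n) @ \oo -->
    K * expR (- w * t) * ipv x x.
  by apply: cvgM; [exact: cvg_cst|exact: cvg_mode_energy].
apply: (ler_cvg_to c1 c2); near=> n.
rewrite /series /= mulr_sumr; apply: ler_sum => i _; exact: dk.
Unshelve. all: by end_near.
Qed.

(** Cauchy-Schwarz inside mode [k] between [z] and the impulse response, whose initial energy is
    1. *)
Lemma response_decay : exists K w : R, [/\ 0 < K, 0 < w &
  forall z k t, 0 <= t -> response z k t ^+ 2 <= K * expR (- w * t) * mode_energy z k].
Proof.
have [K [w [K0 w0 dk]]] := mode_energy_decay; exists K, w; split => // z k t t0.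
have := dk _ k t (@VZ 0 1 k) t0.
have -> : mode_energy (0 *: e k, 1 *: e k) k = 1.
  by rewrite /mode_energy /= !(sipZl sipH)// (ip_basis e_basis) eqxx mul0r expr0n mulr0 add0r mul1r expr1n.
rewrite mulr1 => h; apply: (@le_trans _ _ (mode_energy (S t (0 *: e k, 1 *: e k)) k * mode_energy z k)).
  rewrite /mode_energy /response -/(mode1 k t) -/(mode2 k t).
  have a0 := al_gt0 k; set u := mode1 _ _; set v := mode2 _ _.
  set z1 := ip z.1 _; set z2 := ip z.2 _.
  have := mulr_ge0 (ltW a0) (sqr_ge0 (z1 * v - z2 * u)); nra.
by rewrite ler_wpM2r// mode_energy_ge0.
Qed.

Lemma continuous_response z k t : 0 < t -> {within `[0, t], continuous (response z k)}.
Proof.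
move=> t0; have [h1 h2] := oscillation_mode k.
exact: has_derivative_within (has_derivativeD (has_derivativeZ (al k * cf z.1 k) h1)
  (has_derivativeZ (cf z.2 k) h2)) t0.
Qed.

Definition initial_response z k (t : R) : R :=
  al k * cf z.1 k * cf (S t (1 *: e k, 0 *: e k)).1 k +
  cf z.2 k * cf (S t (1 *: e k, 0 *: e k)).2 k.

Lemma continuous_initial_response z k t : 0 < t ->
  {within `[0, t], continuous (initial_response z k)}.
Proof.
move=> t0; have [h1 h2] := oscillation_semigroup k (@VZ 1 0 k).
exact: has_derivative_within (has_derivativeD (has_derivativeZ (al k * cf z.1 k) h1)
  (has_derivativeZ (cf z.2 k) h2)) t0.
Qed.

(** Each term of the series for the pairing of [S t x] with [z] splits into products of a function
    of [x] and a function of [t]; applied to [x0], this makes the mean part jointly measurable. *)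
Lemma coef_semigroup x z k t : V x -> 0 <= t ->
  al k * cf (S t x).1 k * cf z.1 k + cf (S t x).2 k * cf z.2 k =
  cf x.1 k * initial_response z k t + cf x.2 k * response z k t.
Proof.
move=> Vx t0; have [m10 m20] := mode_init k.
have o1 := oscillation_semigroup k (@VZ 1 0 k).
have o := oscillation_lin (cf x.1 k) o1 (oscillation_lin (cf x.2 k) (oscillation_mode k)
  (oscillation0 a (b * al k))).
have [||-> ->] := oscillation_unique a_gt0 (be_gt0 k) (oscillation_semigroup k Vx) o _ _ t0.
- rewrite m10 !(coef_init _ (@VZ 1 0 k)) (coef_init k Vx) /= !(sipZl sipH)//.
  by rewrite (ip_basis e_basis) eqxx mulr1n; ring.
- rewrite m20 !(coef_init _ (@VZ 1 0 k)) (coef_init k Vx) /= !(sipZl sipH)//.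
  by rewrite (ip_basis e_basis) eqxx mulr1n; ring.
by rewrite /initial_response /response; ring.
Qed.

(* The integral of [response z k ^+ 2] over [0, +oo[. *)
Definition mode_variance z k : R := (cf z.2 k ^+ 2 + al k * cf z.1 k ^+ 2 / b) / (4 * a).

(** By the exact primitive, the error is, up to sign, the value of [response_form] at the state
    reached at time [t], hence controlled by the energy left in the impulse response. *)
Lemma integral_response_sqr : exists K w : R, [/\ 0 < K, 0 < w &
  forall z k t, 0 <= t -> exists2 r : R,
   (\int[lebesgue_measure]_(s in `[0%R, t]) (response z k s ^+ 2)%:E = r%:E)%E &
   `|r - mode_variance z k| <= K * expR (- w * t) * mode_energy z k].
Proof.
have [K [w [K0 w0 dk]]] := mode_energy_decay.
(* The four summands bound, in this order, the four terms of the form in [E] below, as shown in [n1]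
   to [n4]. *)
pose C := a / (b * al0) + (1 + b^-1) / (4 * a) * (b + 1) + (al0^-1 + 1) / 2
  + (al0^-1 + 1) / (2 * b).
have C0 : 0 < C.
  have i1 : 0 < al0^-1 by rewrite invr_gt0.
  have i2 : 0 < b^-1 by rewrite invr_gt0.
  have c1 : 0 < a / (b * al0) by rewrite divr_gt0// mulr_gt0.
  have c2 : 0 < (1 + b^-1) / (4 * a) * (b + 1).
    by rewrite mulr_gt0 ?addr_gt0// divr_gt0 ?addr_gt0// mulr_gt0.
  have c3 : 0 < (al0^-1 + 1) / (2 * b) by rewrite divr_gt0 ?addr_gt0// mulr_gt0.
  by rewrite /C; lra.
exists (C * K), w; split => //; first by rewrite mulr_gt0.
move=> z k t t0; have [m10 m20] := mode_init k.
pose form u v := response_form a (b * al k) (al k * cf z.1 k) (cf z.2 k) u v.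
exists (form 0 1 - form (mode1 k t) (mode2 k t)).
  have := integral_response a_gt0 (al k * cf z.1 k) (cf z.2 k) (be_gt0 k) (oscillation_mode k) t0.
  by rewrite m10 m20.
have -> : form 0 1 = mode_variance z k.
  rewrite /form response_form01 /mode_variance; congr ((_ + _) / _).
  by field; rewrite !gt_eqF.
have -> : mode_variance z k - form (mode1 k t) (mode2 k t) - mode_variance z k =
  - form (mode1 k t) (mode2 k t) by ring.
rewrite normrN.
have dkt : mode_energy (S t (0 *: e k, 1 *: e k)) k <= K * expR (- w * t).
  have := dk _ k t (@VZ 0 1 k) t0.
  have -> : mode_energy (0 *: e k, 1 *: e k) k = 1.
    by rewrite /mode_energy /= !(sipZl sipH)// (ip_basis e_basis) eqxx mul0r expr0n mulr0 add0r mul1r expr1n.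
  by rewrite mulr1.
rewrite -[C * K * _]mulrA -mulrA; apply: (@le_trans _ _
  (C * (mode_energy (S t (0 *: e k, 1 *: e k)) k * mode_energy z k))); last first.
  by rewrite ler_pM2l// ler_wpM2r// mode_energy_ge0.
rewrite /mode_energy /form -/(mode1 k t) -/(mode2 k t).
set u := mode1 k t; set v := mode2 k t; set z1 := cf z.1 k; set z2 := cf z.2 k.
pose ak := al k; have ak0 : 0 < ak by exact: al_gt0.
rewrite -/ak; pose P := ak * z1 ^+ 2; pose U := ak * u ^+ 2.
have P0 : 0 <= P by rewrite mulr_ge0 ?sqr_ge0// ltW.
have U0 : 0 <= U by rewrite mulr_ge0 ?sqr_ge0// ltW.
have z20 := sqr_ge0 z2; have v0 := sqr_ge0 v.
have sq_le (s : R) : s ^+ 2 <= al0^-1 * (ak * s ^+ 2).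
  by rewrite ler_pdivlMl// ler_wpM2r ?sqr_ge0//; exact: al_ge.
pose r := (z2 ^+ 2 + P / b) / (4 * a).
(* In terms of [P] and [U] no explicit power of [al k] remains, and [u^2], [z1^2] cost at most a
   factor [al0^-1]; this makes the bound uniform in [k]. *)
have E : response_form a (b * ak) (ak * z1) z2 u v =
  a / b * (P * u ^+ 2) + r * (b * U + v ^+ 2) - z1 * z2 * U + P / b * (u * v).
  by rewrite /response_form /r /P /U; field; rewrite !gt_eqF.
rewrite E -/P -/U.
have W0 : 0 <= P + z2 ^+ 2 by rewrite addr_ge0.
have E0 : 0 <= U + v ^+ 2 by rewrite addr_ge0.
have i1 : 0 <= al0^-1 by rewrite invr_ge0 ltW.
have i2 : 0 <= b^-1 by rewrite invr_ge0 ltW.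
have i4 : 0 <= (4 * a)^-1 by rewrite invr_ge0 mulr_ge0// ltW.
have PU : u ^+ 2 <= al0^-1 * (U + v ^+ 2).
  by rewrite (le_trans (sq_le u))// ler_wpM2l// lerDl.
have n1 : `|a / b * (P * u ^+ 2)| <= a / (b * al0) * ((U + v ^+ 2) * (P + z2 ^+ 2)).
  have c0 : 0 <= a / b by rewrite divr_ge0 ?ltW.
  rewrite ger0_norm; last by apply: mulr_ge0 => //; apply: mulr_ge0 => //; exact: sqr_ge0.
  have -> : a / (b * al0) * ((U + v ^+ 2) * (P + z2 ^+ 2)) =
    a / b * ((P + z2 ^+ 2) * (al0^-1 * (U + v ^+ 2))) by field; rewrite !gt_eqF.
  by rewrite ler_wpM2l// ler_pM ?sqr_ge0// lerDl.
have n2 : `|r * (b * U + v ^+ 2)| <=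
    (1 + b^-1) / (4 * a) * (b + 1) * ((U + v ^+ 2) * (P + z2 ^+ 2)).
  have r0 : 0 <= r by rewrite divr_ge0 ?mulr_ge0 ?addr_ge0 ?divr_ge0// ltW.
  have bU : 0 <= b * U by rewrite mulr_ge0// ltW.
  have bv : 0 <= b * v ^+ 2 by rewrite mulr_ge0// ltW.
  rewrite ger0_norm; last by rewrite mulr_ge0// addr_ge0.
  have rW : r <= (1 + b^-1) / (4 * a) * (P + z2 ^+ 2).
    rewrite [leRHS]mulrAC ler_wpM2r//.
    have := mulr_ge0 z20 i2; have := mulr_ge0 P0 i2; lra.
  have -> : (1 + b^-1) / (4 * a) * (b + 1) * ((U + v ^+ 2) * (P + z2 ^+ 2)) =
    ((1 + b^-1) / (4 * a) * (P + z2 ^+ 2)) * ((b + 1) * (U + v ^+ 2)) by ring.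
  by rewrite ler_pM ?addr_ge0//; lra.
have n3 : `|z1 * z2 * U| <= (al0^-1 + 1) / 2 * ((U + v ^+ 2) * (P + z2 ^+ 2)).
  rewrite normrM [`|U|]ger0_norm//.
  have -> : (al0^-1 + 1) / 2 * ((U + v ^+ 2) * (P + z2 ^+ 2)) =
    ((al0^-1 + 1) / 2 * (P + z2 ^+ 2)) * (U + v ^+ 2) by ring.
  rewrite ler_pM// ?normr_ge0 ?lerDl//.
  have z1P : z1 ^+ 2 <= al0^-1 * P by exact: sq_le.
  have s1 := sqr_ge0 (z1 - z2); have s2 := sqr_ge0 (z1 + z2).
  have s3 := mulr_ge0 i1 z20.
  have s4 : `|z1 * z2| <= (z1 ^+ 2 + z2 ^+ 2) / 2 by rewrite ler_norml; apply/andP; split; nra.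
  apply: (le_trans s4); nra.
have n4 : `|P / b * (u * v)| <= (al0^-1 + 1) / (2 * b) * ((U + v ^+ 2) * (P + z2 ^+ 2)).
  have Pb0 : 0 <= P / b by rewrite mulr_ge0.
  rewrite normrM [`|P / b|]ger0_norm//.
  have -> : (al0^-1 + 1) / (2 * b) * ((U + v ^+ 2) * (P + z2 ^+ 2)) =
    ((P + z2 ^+ 2) / b) * ((al0^-1 + 1) / 2 * (U + v ^+ 2)) by field; rewrite !gt_eqF.
  rewrite ler_pM// ?normr_ge0//; first by rewrite ler_wpM2r// lerDl.
  have s1 := sqr_ge0 (u - v); have s2 := sqr_ge0 (u + v).
  have s4 : `|u * v| <= (u ^+ 2 + v ^+ 2) / 2 by rewrite ler_norml; apply/andP; split; nra.
  apply: (le_trans s4); nra.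
rewrite (le_trans (ler_normD _ _))// (le_trans (lerD (ler_normB _ _) (lexx _)))//.
rewrite (le_trans (lerD (lerD (ler_normD _ _) (lexx _)) (lexx _)))//.
rewrite /C; lra.
Qed.

End wave_modes.

(** * Gaussian moments *)

Section integral_against_density.
Import HBNNSimple.
Context {R : realType} {d : measure_display} {T : measurableType d}.
Variables (mu nu : {measure set T -> \bar R}) (p : T -> R).
Hypotheses (mp : measurable_fun setT p) (p0 : forall x, 0 <= p x).
Hypothesis nuE : forall A, measurable A -> nu A = (\int[mu]_(x in A) (p x)%:E)%E.

(** [nuE] concerns measures of sets only; simple functions and monotone convergence extend it to
    nonnegative functions. *)
Lemma ge0_integral_density (f : T -> R) : measurable_fun setT f ->
  (forall x, 0 <= f x) -> (\int[nu]_x (f x)%:E = \int[mu]_x (f x * p x)%:E)%E.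
Proof.
move=> mf f0; have mEf : measurable_fun setT (EFin \o f) by exact/measurable_EFinP.
pose f_ := nnsfun_approx measurableT mEf.
have cvf (x : T) : (f_ n x)%:E @[n --> \oo] --> (f x)%:E.
  by apply: (@cvg_nnsfun_approx _ _ _ setT measurableT _ mEf) => // y _; rewrite lee_fin.
have ndf (x : T) : nondecreasing_seq (fun n => f_ n x).
  by move=> m n mn; exact/lefP/nd_nnsfun_approx.
transitivity (limn (fun n => (\int[nu]_x (f_ n x)%:E)%E)).
  rewrite -monotone_convergence//.
  - by apply: eq_integral => y _; apply/esym/cvg_lim.
  - by move=> n; exact/measurable_EFinP/measurable_funP.
  - by move=> n y _; rewrite lee_fin.
  - by move=> y _ m n mn; rewrite lee_fin; exact: ndf.
rewrite [X in limn X](_ : _ = (fun n => (\int[mu]_x (f_ n x * p x)%:E)%E)).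
  rewrite -monotone_convergence//; last 3 first.
  - by move=> n; apply/measurable_EFinP/measurable_funM => //; exact/measurable_funP.
  - by move=> n x _ /=; rewrite lee_fin mulr_ge0.
  - by move=> x _ m n mn; rewrite lee_fin ler_wpM2r//; exact: ndf.
  apply: eq_integral => x _ /=; apply/cvg_lim => //.
  exact: (cvgeZr (y := (p x)%:E) isT (cvf x)).
apply/funext => n.
have mpre k : measurable (f_ n @^-1` [set k]) by exact: measurable_sfunP.
rewrite integral_nnsfun// patch_setT sintegralE.
transitivity (\sum_(k \in range (f_ n))
    \int[mu]_x (k * \1_(f_ n @^-1` [set k]) x * p x)%:E)%E.
  apply: eq_fsbigr => k _; rewrite nuE//.
  under [RHS]eq_integral do rewrite -mulrA EFinM.
  have [k0|k0] := leP 0 k.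
    rewrite ge0_integralZl//; last 2 first.
    - by apply/measurable_EFinP/measurable_funM.
    - by move=> x _; rewrite lee_fin mulr_ge0.
    congr (_ * _)%E; rewrite integral_mkcond; apply: eq_integral => x _.
    by rewrite patchE indicE; case: ifPn => _; rewrite ?mul1r ?mul0r.
  rewrite preimage_nnfun0// integral_set0 mule0.
  by apply/esym/integral0_eq => x _; rewrite indic0 mul0r mule0.
rewrite -ge0_integral_fsum//; last 2 first.
- by move=> y; apply/measurable_EFinP/measurable_funM => //; exact: measurable_funM.
- by move=> y x _; rewrite EFinM mule_ge0 ?lee_fin//; have := nnfun_muleindic_ge0 (f_ n) y x.
apply: eq_integral => x _; rewrite fsumEFin//; congr EFin.
by rewrite [in RHS](fimfunE (f_ n)) mulr_fsuml.
Qed.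
End integral_against_density.

Section normal_moments.
Context {R : realType}.
Variable s : R.
Hypothesis s0 : 0 < s.
Local Notation mu := (@lebesgue_measure R).
Local Notation pdf := (normal_pdf 0 s).

Let pdfE x : pdf x = normal_peak s * expR (- x ^+ 2 / (s ^+ 2 *+ 2)).
Proof. by rewrite normal_pdfE ?gt_eqF//= /normal_fun subr0. Qed.

Lemma is_derive_normal_pdf (x : R) : is_derive x 1 pdf (- x / s ^+ 2 * pdf x).
Proof.
pose c : R := - (s ^+ 2 *+ 2)^-1; pose g (y : R) : R := c * (y * y).
have -> : pdf = (fun y => normal_peak s * expR (g y)).
  apply/funext => y; rewrite pdfE /g /c; congr (_ * expR _).
  by rewrite -expr2 mulrC mulrN mulNr.
have h1 : is_derive x 1 g (- x / s ^+ 2).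
  apply: (is_derive_eq (is_deriveM (is_derive_cst c x 1)
    (is_deriveM (is_derive_id x 1) (is_derive_id x 1)))).
  rewrite /GRing.scale /= !mulr1 mulr0 addr0 /c -mulr_natr.
  by field; rewrite gt_eqF.
have h2 : is_derive (g x) 1 (expR : R -> R) (expR (g x)) by exact: is_derive_expR.
have h3 : is_derive x 1 (fun y => expR (g y)) (expR (g x) * (- x / s ^+ 2)) := is_derive1_comp h2 h1.
apply: (is_derive_eq (is_deriveM (is_derive_cst (normal_peak s) x 1) h3)).
by rewrite /GRing.scale /=; ring.
Qed.

Let I (k n : nat) : \bar R := (\int[mu]_(x in `[(- n%:R)%R, n%:R]) (x ^+ k * pdf x)%:E)%E.

Let cont_mom k : continuous (fun x : R => x ^+ k * pdf x).
Proof.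
move=> x; apply: cvgM; first exact: exprn_continuous.
by apply: continuous_normal_pdf; rewrite gt_eqF.
Qed.

Let int_mom k n : mu.-integrable `[(- n%:R)%R, n%:R] (fun x => (x ^+ k * pdf x)%:E).
Proof.
apply: continuous_compact_integrable; first exact: segment_compact.
by apply: continuous_subspaceT; exact: cont_mom.
Qed.

Let bnd (k n : nat) : R := - s ^+ 2 * (n%:R ^+ k.+1 * pdf n%:R) + s ^+ 2 * ((- n%:R) ^+ k.+1 * pdf (- n%:R)).

(** Integration by parts on [[-n, n]]: [- s^2 x^(k+1) pdf] has derivative
    [x^(k+2) pdf - s^2 (k+1) x^k pdf], and [bnd] collects its boundary values. *)
Let mom_rec k n : (0 < n)%N -> I k.+2 n = ((s ^+ 2 * k.+1%:R)%:E * I k n + (bnd k n)%:E)%E.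
Proof.
move=> n0; pose F x := - s ^+ 2 * (x ^+ k.+1 * pdf x).
have hF (x : R) : is_derive x 1 F (x ^+ k.+2 * pdf x - s ^+ 2 * k.+1%:R * (x ^+ k * pdf x)).
  have hX : is_derive x 1 (fun y : R => y ^+ k.+1) (k.+1%:R * x ^+ k).
    have := is_deriveX k.+1 (is_derive_id x (1 : R)); rewrite exprfctE => hX.
    by apply: (is_derive_eq hX); rewrite /GRing.scale /= mulr1.
  have h : is_derive x 1 (fun y => y ^+ k.+1 * pdf y) _ := is_deriveM hX (is_derive_normal_pdf x).
  pose c := - s ^+ 2.
  apply: (is_derive_eq (is_deriveM (is_derive_cst c x 1) h)).
  rewrite /GRing.scale /= mulr0 addr0 /c !exprS.
  by field; rewrite gt_eqF.
have E : (\int[mu]_(x in `[(- n%:R)%R, n%:R]) (x ^+ k.+2 * pdf x - s ^+ 2 * k.+1%:R * (x ^+ k * pdf x))%:E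
   = (F n%:R)%:E - (F (- n%:R))%:E)%E.
  have cF (x : R) : {for x, continuous F} by exact: is_derive_continuous (hF x).
  apply: continuous_FTC2.
  - by rewrite (@lt_trans _ _ 0)// ?oppr_lt0 ltr0n.
  - apply: continuous_subspaceT => x; apply: cvgB; first exact: cont_mom.
    by apply: cvgM; [exact: cvg_cst|exact: cont_mom].
  - split; first by move=> x _; case: (hF x).
      by apply: cvg_at_right_filter; exact: cF.
    by apply: cvg_at_left_filter; exact: cF.
  - by move=> x _; rewrite derive1E; case: (hF x).
have -> : bnd k n = F n%:R - F (- n%:R) by rewrite /bnd /F; ring.
rewrite EFinB -E /I.
under [X in (_ = _ + X)%E]eq_integral do rewrite EFinB (EFinM (s ^+ 2 * _)).
rewrite integralB//; last by apply: integrableZl.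
rewrite integralZl//.
by rewrite [RHS]addeC subeK// fin_numM// integrable_fin_num//; exact: int_mom.
Qed.

Let bnd_cvg k : (k <= 2)%N -> bnd k n @[n --> \oo] --> (0 : R).
Proof.
move=> k2; pose c := normal_peak s; pose C := 32 * s ^+ 6 * c.
have c0 : 0 <= c by exact: normal_peak_ge0.
have C0 : 0 <= C by rewrite /C mulr_ge0// mulr_ge0// exprn_ge0// ltW.
apply: (@cvg_norm_le _ _ _ _ _ (fun n => (2 * C) * harmonic n)); last first.
  by apply: cvg0_mull; exact: cvg_harmonic.
near=> n; have n0 : (0 < n)%N by near: n; exact: nbhs_infty_gt.
have n1 : 1 <= n%:R :> R by rewrite ler1n.
have npos : 0 < n%:R :> R by rewrite ltr0n.
have pN : pdf (- n%:R) = pdf n%:R by rewrite !pdfE sqrrN.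
(* With [y = n^2 / (2 s^2)], the bound [expR y >= (1 + y / 2)^2 >= y^2 / 4] makes [n^4 pdf n]
   bounded; since [k.+1 <= 3], a factor [1 / n] is left over. *)
have hp : n%:R ^+ 4 * pdf n%:R <= 16 * s ^+ 4 * c.
  rewrite pdfE -/c; pose y : R := n%:R ^+ 2 / (s ^+ 2 *+ 2).
  have y0 : 0 <= y by rewrite divr_ge0 ?sqr_ge0// mulrn_wge0// sqr_ge0.
  have e2 : y ^+ 2 / 4 <= expR y.
    have -> : y = y / 2 + y / 2 by lra.
    rewrite expRD -expr2; have h := expR_ge1Dx (y / 2).
    have h2 : 0 <= y / 2 by lra.
    have -> : (y / 2 + y / 2) ^+ 2 / 4 = (y / 2) ^+ 2 by field.
    by rewrite ler_pXn2r ?nnegrE ?expR_ge0//; lra.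
  rewrite mulNr -/y expRN.
  have -> : n%:R ^+ 4 * (c * (expR y)^-1) = c * (n%:R ^+ 4 / expR y) by ring.
  rewrite [leRHS]mulrC ler_wpM2l// ler_pdivrMr ?expR_gt0//.
  have -> : n%:R ^+ 4 = 16 * s ^+ 4 * (y ^+ 2 / 4) by rewrite /y -mulr_natr; field; rewrite gt_eqF.
  by rewrite ler_wpM2l// mulr_ge0// exprn_ge0// ltW.
have p0 : 0 <= pdf n%:R by exact: normal_pdf_ge0.
have hk : n%:R ^+ k.+1 * pdf n%:R <= 16 * s ^+ 4 * c * n%:R^-1.
  rewrite ler_pdivlMr// (le_trans _ hp)// mulrAC ler_wpM2r// -exprSr.
  by rewrite ler_weXn2l.
have hN : `|(- n%:R) ^+ k.+1 * pdf (- n%:R)| <= 16 * s ^+ 4 * c * n%:R^-1.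
  by rewrite pN normrM normrX normrN ger0_norm ?(ltW npos)// ger0_norm.
have hP : `|n%:R ^+ k.+1 * pdf n%:R| <= 16 * s ^+ 4 * c * n%:R^-1.
  by rewrite ger0_norm// mulr_ge0// exprn_ge0// ltW.
have h1 : n%:R^-1 <= 2 * harmonic n :> R.
  rewrite /harmonic /= -ler_pdivrMl// -invfM lef_pV2 ?posrE ?mulr_gt0//.
  by rewrite -natr1 mulrDl mul1r; lra.
have s20 : 0 <= s ^+ 2 by rewrite sqr_ge0.
have hb : bnd k n = s ^+ 2 * ((- n%:R) ^+ k.+1 * pdf (- n%:R) - n%:R ^+ k.+1 * pdf n%:R).
  by rewrite /bnd; ring.
rewrite subr0 hb normrM (ger0_norm s20) (@le_trans _ _ (C * n%:R^-1))//; last first.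
  by rewrite -[leRHS]mulrA mulrCA ler_wpM2l.
have -> : C * n%:R^-1 = s ^+ 2 * (16 * s ^+ 4 * c * n%:R^-1 + 16 * s ^+ 4 * c * n%:R^-1) by rewrite /C; ring.
by rewrite ler_wpM2l// (le_trans (ler_normB _ _))// lerD.
Unshelve. all: by end_near.
Qed.

Let even_mom_ge0 k x : 0 <= x ^+ k.*2 * pdf x.
Proof. by rewrite mulr_ge0 ?normal_pdf_ge0// -muln2 exprM sqr_ge0. Qed.

Let mom_cvg k : I k.*2 n @[n --> \oo] --> (\int[mu]_x (x ^+ k.*2 * pdf x)%:E)%E.
Proof.
have -> : [set: R] = \bigcup_n `[(- n%:R)%R, (n%:R : R)]%classic.
  apply/seteqP; split=> // x _; exists (Num.truncn `|x|).+1 => //=.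
  by rewrite in_itv /= -ler_norml ltW// truncnS_gt.
apply: ge0_nondecreasing_set_cvg_integral => //.
- apply/nondecreasing_seqP => n; rewrite subsetEset => x /=; rewrite !in_itv /= -!ler_norml.
  by move=> h; rewrite (le_trans h)// ler_nat.
- move=> i; apply: measurable_funTS; apply/measurable_EFinP.
  apply: measurable_funM; last exact: measurable_normal_pdf.
  by apply: measurable_funX.
- by move=> i x _; rewrite lee_fin even_mom_ge0.
Qed.

(** The recursion passes to the limit along even powers, where the integrals over [[-n, n]] increase
    to the full one. Two applications give the variance and the fourth moment. *)
Lemma normal_moment k (m : R) : (k <= 1)%N ->
  (\int[mu]_x (x ^+ k.*2 * pdf x)%:E = m%:E)%E ->
  (\int[mu]_x (x ^+ k.+1.*2 * pdf x)%:E = (s ^+ 2 * k.*2.+1%:R * m)%:E)%E.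
Proof.
move=> k1 hm; have c1 := @mom_cvg k.+1; have := @mom_cvg k; rewrite hm => c0.
apply: (cvg_unique _ c1) => //.
have c2 : ((s ^+ 2 * k.*2.+1%:R)%:E * I k.*2 n + (bnd k.*2 n)%:E)%E @[n --> \oo] -->
   ((s ^+ 2 * k.*2.+1%:R)%:E * m%:E + 0%:E)%E.
  apply: cvgeD => //; first by apply: cvgeZl.
  by apply: cvg_EFin; [exact: nearW|apply: bnd_cvg; case: k k1 {hm c0 c1} => [|[]]].
rewrite EFinM; rewrite adde0 in c2; apply: cvg_trans c2; apply: near_eq_cvg; near=> n.
by rewrite mom_rec//; near: n; exact: nbhs_infty_gt.
Unshelve. all: by end_near.
Qed.

End normal_moments.

(** * Expectations of products of independent variables *)

Section independent_variables.
Context {R : realType} {d : measure_display} {Om : measurableType d}.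
Variable P : probability Om R.
Local Notation MR := (measurableTypeR R).
Variables X Y : Om -> MR.
Hypotheses (mX : measurable_fun setT X) (mY : measurable_fun setT Y).
Hypothesis indep : forall A C : set MR, measurable A -> measurable C ->
  P (X @^-1` A `&` Y @^-1` C) = (P (X @^-1` A) * P (Y @^-1` C))%E.

Let X' : {mfun Om >-> MR} := mfun_Sub (mem_set mX).
Let Y' : {mfun Om >-> MR} := mfun_Sub (mem_set mY).
Let mZ : measurable_fun setT (fun w => (X w, Y w)) := measurable_fun_pair mX mY.
Let Z' : {mfun Om >-> (MR * MR)%type} := mfun_Sub (mem_set mZ).
Let PX := distribution P X'.
Let PY := distribution P Y'.
Let PZ := distribution P Z'.

(** Independence on rectangles determines the law of the pair by uniqueness of the product measure;
    what follows is then Fubini's theorem. *)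
Let PZE (A : set (MR * MR)) : measurable A -> (PX \x PY)%E A = PZ A.
Proof.
by move=> mA; exact: product_measure_unique.
Qed.

Variables f g : MR -> R.
Hypotheses (mf : measurable_fun setT f) (mg : measurable_fun setT g).
Hypotheses (iX : P.-integrable setT (EFin \o (f \o X)))
  (iY : P.-integrable setT (EFin \o (g \o Y))).

Let h (p : MR * MR) : \bar R := (f p.1 * g p.2)%:E.

Let mh : measurable_fun setT h.
Proof.
apply/measurable_EFinP/measurable_funM.
  exact: measurableT_comp mf measurable_fst.
exact: measurableT_comp mg measurable_snd.
Qed.

Let iPX : PX.-integrable setT (EFin \o f).
Proof.
have mEf : measurable_fun setT (EFin \o f) by exact/measurable_EFinP.
apply/integrableP; split => //.
rewrite ge0_integral_distribution//; last exact: measurableT_comp.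
by case/integrableP : iX.
Qed.

Let iPY : PY.-integrable setT (EFin \o g).
Proof.
have mEg : measurable_fun setT (EFin \o g) by exact/measurable_EFinP.
apply/integrableP; split => //.
rewrite ge0_integral_distribution//; last exact: measurableT_comp.
by case/integrableP : iY.
Qed.

Let ih : (PX \x PY)%E.-integrable setT h.
Proof.
apply/integrable12ltyP => //.
under eq_integral => x _.
  under eq_integral => y _ do rewrite /h /= normrM EFinM.
  rewrite ge0_integralZl//; last first.
    by apply/measurable_EFinP; exact: measurableT_comp.
  over.
have [mX1 fX] := integrableP _ _ _ iPX; have [mY1 gY] := integrableP _ _ _ iPY.
rewrite ge0_integralZr//; last 2 first.
- by apply/measurable_EFinP; exact: measurableT_comp.
- by apply: integral_ge0.
by rewrite lte_mul_pinfty//; [exact: integral_ge0|rewrite ge0_fin_numE//; exact: integral_ge0].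
Qed.

Lemma independent_integrable :
  P.-integrable setT (EFin \o (fun w => f (X w) * g (Y w))).
Proof.
have [m1 fin] := integrableP _ _ _ ih.
apply/integrableP; split.
  by apply/measurable_EFinP/measurable_funM; exact: measurableT_comp.
apply: le_lt_trans fin; rewrite le_eqVlt; apply/orP; left; apply/eqP.
rewrite (eq_measure_integral PZ) => [|A mA _]; last exact: PZE.
rewrite ge0_integral_distribution//; exact: measurableT_comp.
Qed.

Lemma independent_expectation :
  \int[P]_w (f (X w) * g (Y w)) = (\int[P]_w f (X w)) * (\int[P]_w g (Y w)).
Proof.
rewrite /Rintegral -fineM; last 2 first.
- exact: integrable_fin_num iX.
- exact: integrable_fin_num iY.
congr fine.
transitivity (\int[PZ]_p h p)%E.
  by rewrite integral_distribution//; exact: independent_integrable.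
have <- : (\int[(PX \x PY)%E]_p h p = \int[PZ]_p h p)%E.
  by apply: eq_measure_integral => A mA _; exact: PZE.
rewrite -(integral12_prod_meas1 ih) /fubini_F /h /=.
transitivity (\int[PX]_x ((f x)%:E * \int[PY]_y (g y)%:E))%E.
  apply: eq_integral => x _; under eq_integral do rewrite EFinM.
  by rewrite integralZl.
have fY : (\int[PY]_y (g y)%:E)%E \is a fin_num by exact: integrable_fin_num iPY.
rewrite -(fineK fY) integralZr// fineK//.
by congr (_ * _)%E; rewrite integral_distribution//; exact/measurable_EFinP.
Qed.

End independent_variables.

Section moments.
Context {R : realType} {d : measure_display} {Om : measurableType d}.
Variable P : probability Om R.
Local Notation MR := (measurableTypeR R).
Implicit Types X Y : Om -> R.

(** The trace of a centered normal law that is propagated instead of the law itself. It survives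
    sums of independent increments and is all that polarisation needs for Isserlis' formula. *)
Definition gaussian_moments X (v : R) : Prop :=
  [/\ measurable_fun setT X, (\int[P]_w (X w ^+ 2)%:E = v%:E)%E &
      (\int[P]_w (X w ^+ 4)%:E = (3 * v ^+ 2)%:E)%E].

Lemma ge0_integral_law (X : Om -> MR) (nu : {measure set MR -> \bar R}) (f : MR -> R) :
  measurable_fun setT X ->
  (forall C : set MR, measurable C -> P (X @^-1` C) = nu C) ->
  measurable_fun setT f -> (forall x, 0 <= f x) ->
  (\int[P]_w (f (X w))%:E = \int[nu]_x (f x)%:E)%E.
Proof.
move=> mX lawX mf f0; pose X' : {mfun Om >-> MR} := mfun_Sub (mem_set mX).
transitivity (\int[distribution P X']_x (f x)%:E)%E.
  by rewrite ge0_integral_distribution//; exact/measurable_EFinP.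
by apply: eq_measure_integral => A mA _; rewrite -lawX.
Qed.

Lemma integral_law_eq (X Y : Om -> MR) (f : MR -> R) :
  measurable_fun setT X -> measurable_fun setT Y -> measurable_fun setT f ->
  (forall C : set MR, measurable C -> P (X @^-1` C) = P (Y @^-1` C)) ->
  P.-integrable setT (EFin \o (f \o X)) -> P.-integrable setT (EFin \o (f \o Y)) ->
  \int[P]_w f (X w) = \int[P]_w f (Y w).
Proof.
move=> mX mY mf law iX iY.
pose X' : {mfun Om >-> MR} := mfun_Sub (mem_set mX).
pose Y' : {mfun Om >-> MR} := mfun_Sub (mem_set mY).
have mEf : measurable_fun setT (EFin \o f) by exact/measurable_EFinP.
congr fine; transitivity (\int[distribution P X']_x (f x)%:E)%E.
  by rewrite integral_distribution.
transitivity (\int[distribution P Y']_x (f x)%:E)%E; last by rewrite integral_distribution.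
by apply: eq_measure_integral => A mA _; exact: law.
Qed.

Lemma centered_gaussian_moments X v : measurable_fun setT X -> 0 <= v ->
  centered_gaussian P X v -> gaussian_moments X v.
Proof.
move=> mX v0; rewrite /centered_gaussian; case: ifPn => [/eqP ->|vn0] law.
  have z k : (\int[P]_w (X w ^+ k.+1)%:E = 0)%E.
    rewrite (ae_eq_integral (cst 0%E))//; first by rewrite integral0.
      by apply/measurable_EFinP; exact: measurable_funX.
    by apply: filterS law => w /= -> _; rewrite expr0n.
  by split => //; rewrite z// expr0n mulr0.
have vgt0 : 0 < v by rewrite lt_def vn0.
pose s := Num.sqrt v; have s0 : 0 < s by rewrite sqrtr_gt0.
have s2 : s ^+ 2 = v by rewrite sqr_sqrtr.
have E k : (\int[P]_w (X w ^+ k.*2)%:E =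
            \int[lebesgue_measure]_x (x ^+ k.*2 * normal_pdf 0 s x)%:E)%E.
  have mk : measurable_fun setT (fun x : MR => x ^+ k.*2 : R) by exact: measurable_funX.
  have k0 (x : R) : 0 <= x ^+ k.*2 by rewrite -muln2 exprM sqr_ge0.
  rewrite (ge0_integral_law (nu := normal_prob 0 s) mX law mk k0).
  apply: ge0_integral_density => //; first exact: measurable_normal_pdf.
  by move=> x; exact: normal_pdf_ge0.
have m0 : (\int[lebesgue_measure]_x (x ^+ 0.*2 * normal_pdf 0 s x)%:E = 1%:E)%E.
  by under eq_integral do rewrite expr0 mul1r; rewrite integral_normal_pdf.
have m1 := normal_moment s0 (isT : (0 <= 1)%N) m0.
have m2 := normal_moment s0 (isT : (1 <= 1)%N) m1.
split => //.
  by rewrite (E 1%N) m1 !mulr1 s2.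
by rewrite (E 2%N) m2 s2 (_ : 1.*2.+1 = 3)%N// (_ : 0.*2.+1 = 1)%N//; congr EFin; ring.
Qed.

Lemma integrable_pow X k : measurable_fun setT X ->
  (\int[P]_w (X w ^+ 4)%:E < +oo)%E -> (k <= 4)%N ->
  P.-integrable setT (fun w => (X w ^+ k)%:E).
Proof.
move=> mX X4 k4.
have i4 : P.-integrable setT (fun w => (1 + X w ^+ 4)%:E).
  have i1 : P.-integrable setT (cst 1%E).
    by apply: finite_measure_integrable_cst.
  apply: (integrableD measurableT i1 (g := fun w => (X w ^+ 4)%:E)).
  apply/integrableP; split; first by apply/measurable_EFinP; exact: measurable_funX.
  rewrite (eq_integral (fun w => (X w ^+ 4)%:E))// => w _ /=.
  by rewrite ger0_norm// (exprM _ 2 2) sqr_ge0.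
apply: (le_integrable measurableT _ _ i4).
  by apply/measurable_EFinP; exact: measurable_funX.
move=> w _ /=; rewrite lee_fin normrX; set x := X w.
have x40 : 0 <= x ^+ 4 by rewrite (exprM _ 2 2) sqr_ge0.
rewrite [leRHS]ger0_norm ?addr_ge0//.
have [x1|x1] := leP `|x| 1.
  by rewrite (@le_trans _ _ 1)// ?exprn_ile1// lerDl.
rewrite (@le_trans _ _ (`|x| ^+ 4))//; first by rewrite ler_weXn2l// ltW.
by rewrite -normrX ger0_norm// lerDr.
Qed.

Lemma gaussian_moments_integrable X v k : gaussian_moments X v -> (k <= 4)%N ->
  P.-integrable setT (fun w => (X w ^+ k)%:E).
Proof. by case=> mX _ m4 k4; apply: integrable_pow => //; rewrite m4 ltry. Qed.

(** In the binomial expansions each odd power of [X] comes with an odd power of [Y], so the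
    vanishing of the first and third moments of [Y] removes all mixed terms but [6 X^2 Y^2]; then
    [3 u^2 + 6 u v + 3 v^2 = 3 (u + v)^2]. *)
Lemma gaussian_momentsD X Y u v : gaussian_moments X u -> gaussian_moments Y v ->
  (forall A C : set MR, measurable A -> measurable C ->
     P (X @^-1` A `&` Y @^-1` C) = (P (X @^-1` A) * P (Y @^-1` C))%E) ->
  \int[P]_w Y w = 0 -> \int[P]_w (Y w ^+ 3) = 0 ->
  gaussian_moments (fun w => X w + Y w) (u + v).
Proof.
move=> gX gY ind Y1 Y3.
have [mX X2 X4] := gX; have [mY Y2 Y4] := gY.
have iX k : (k <= 4)%N -> P.-integrable setT (EFin \o (fun w => X w ^+ k)).
  exact: gaussian_moments_integrable gX.
have iY k : (k <= 4)%N -> P.-integrable setT (EFin \o (fun w => Y w ^+ k)).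
  exact: gaussian_moments_integrable gY.
have mk k : measurable_fun setT (fun x : MR => x ^+ k : R) by exact: measurable_funX.
have iXY j k : (j <= 4)%N -> (k <= 4)%N ->
    P.-integrable setT (EFin \o (fun w => X w ^+ j * Y w ^+ k)).
  by move=> j4 k4; exact: (independent_integrable mX mY ind (mk j) (mk k) (iX _ j4) (iY _ k4)).
have eXY j k : (j <= 4)%N -> (k <= 4)%N -> \int[P]_w (X w ^+ j * Y w ^+ k) =
    (\int[P]_w (X w ^+ j)) * (\int[P]_w (Y w ^+ k)).
  by move=> j4 k4; exact: (independent_expectation mX mY ind (mk j) (mk k) (iX _ j4) (iY _ k4)).
have rX2 : \int[P]_w (X w ^+ 2) = u by rewrite /Rintegral X2.
have rY2 : \int[P]_w (Y w ^+ 2) = v by rewrite /Rintegral Y2.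
have rX4 : \int[P]_w (X w ^+ 4) = 3 * u ^+ 2 by rewrite /Rintegral X4.
have rY4 : \int[P]_w (Y w ^+ 4) = 3 * v ^+ 2 by rewrite /Rintegral Y4.
have rY1 : \int[P]_w (Y w ^+ 1) = 0 by under eq_Rintegral do rewrite expr1.
pose t j k (c : R) := fun w => c * (X w ^+ j * Y w ^+ k).
have it j k c : (j <= 4)%N -> (k <= 4)%N -> P.-integrable setT (EFin \o t j k c).
  by move=> j4 k4; exact: (integrableZl measurableT c (iXY _ _ j4 k4)).
have et j k c : (j <= 4)%N -> (k <= 4)%N ->
    \int[P]_w t j k c w = c * ((\int[P]_w (X w ^+ j)) * (\int[P]_w (Y w ^+ k))).
  by move=> j4 k4; rewrite -eXY// -RintegralZl//; exact: iXY.
have rX0 : \int[P]_w (X w ^+ 0) = 1.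
  by under eq_Rintegral do rewrite expr0; rewrite /Rintegral integral_cst//= probability_setT mule1.
have rY0 : \int[P]_w (Y w ^+ 0) = 1.
  by under eq_Rintegral do rewrite expr0; rewrite /Rintegral integral_cst//= probability_setT mule1.
have iD (f g : Om -> R) : P.-integrable setT (EFin \o f) -> P.-integrable setT (EFin \o g) ->
    P.-integrable setT (EFin \o (fun w => f w + g w)) by exact: integrableD.
have mXY : measurable_fun setT (fun w => X w + Y w) by exact: measurable_funD.
split => //.
- have E w : (X w + Y w) ^+ 2 = t 2 0 1 w + (t 1 1 2 w + t 0 2 1 w).
    by rewrite /t; ring.
  have i12 := iD _ _ (it 1 1 2 isT isT) (it 0 2 1 isT isT).
  have i := iD _ _ (it 2 0 1 isT isT) i12.
  under eq_integral do rewrite E.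
  rewrite -[LHS]fineK; last exact: (integrable_fin_num measurableT i).
  congr EFin; rewrite -[LHS]/(\int[P]_w (t 2 0 1 w + (t 1 1 2 w + t 0 2 1 w))).
  rewrite RintegralD//; last exact: it.
  rewrite RintegralD//; [|exact: it|exact: it].
  by rewrite !et// rX2 rY0 ?rX0 rY2 rY1; ring.
- have E w : (X w + Y w) ^+ 4 = t 4 0 1 w + (t 3 1 4 w + (t 2 2 6 w + (t 1 3 4 w + t 0 4 1 w))).
    by rewrite /t; ring.
  have i1 := iD _ _ (it 1 3 4 isT isT) (it 0 4 1 isT isT).
  have i2 := iD _ _ (it 2 2 6 isT isT) i1.
  have i3 := iD _ _ (it 3 1 4 isT isT) i2.
  have i := iD _ _ (it 4 0 1 isT isT) i3.
  under eq_integral do rewrite E.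
  rewrite -[LHS]fineK; last exact: (integrable_fin_num measurableT i).
  congr EFin; rewrite -[LHS]/(\int[P]_w (t 4 0 1 w + (t 3 1 4 w + (t 2 2 6 w + (t 1 3 4 w + t 0 4 1 w))))).
  rewrite RintegralD//; last exact: it.
  rewrite RintegralD//; last exact: it.
  rewrite RintegralD//; last exact: it.
  rewrite RintegralD//; [|exact: it|exact: it].
  by rewrite !et// rX2 rY0 ?rX0 rY2 rY1 rX4 rY4 Y3; ring.
Qed.

(** Symmetry: [- X] has the law of [X], so an odd moment equals its own opposite. *)
Lemma centered_gaussian_odd X Y v k : measurable_fun setT X -> measurable_fun setT Y ->
  0 <= v -> centered_gaussian P X v -> centered_gaussian P Y v ->
  {ae P, forall w, Y w = - X w} -> (k <= 4)%N -> odd k -> \int[P]_w (X w ^+ k) = 0.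
Proof.
move=> mX mY v0 gX gY YX k4 ok.
have iX := gaussian_moments_integrable (centered_gaussian_moments mX v0 gX) k4.
have iY := gaussian_moments_integrable (centered_gaussian_moments mY v0 gY) k4.
have YN : \int[P]_w (Y w ^+ k) = - \int[P]_w (X w ^+ k).
  rewrite -mulN1r -RintegralZl//; congr fine; apply: ae_eq_integral => //.
  - by apply/measurable_EFinP; exact: measurable_funX.
  - by apply/measurable_EFinP/measurable_funM => //; exact: measurable_funX.
  - apply: filterS YX => w /= -> _.
    by rewrite exprNn -signr_odd ok expr1.
have YE : \int[P]_w (Y w ^+ k) = \int[P]_w (X w ^+ k).
  move: gX gY; rewrite /centered_gaussian; case: ifPn => [_ X0 Y0|vn0 lX lY].
    congr fine; apply: ae_eq_integral => //.
    - by apply/measurable_EFinP; exact: measurable_funX.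
    - by apply/measurable_EFinP; exact: measurable_funX.
    - by apply: filterS2 X0 Y0 => w -> ->.
  apply: (integral_law_eq (f := fun x => x ^+ k) mY mX) => // C mC.
  by rewrite lX// lY.
by move: YN; rewrite YE; lra.
Qed.

End moments.

(** * Brownian increments *)

Section brownian_increments.
Context {R : realType} {d : measure_display} {Om : measurableType d}.
Variable P : probability Om R.
Context {H : lmodType R} {ip : H -> H -> R}.
Hypothesis sipH : semi_inner_product setT ip.
Variable W : R -> H -> Om -> R.
Hypothesis cbm : cylindrical_BM P ip W.
Local Notation MR := (measurableTypeR R).

Lemma cbm_linear0 t : 0 <= t -> {ae P, forall w, W t 0 w = 0}.
Proof.
move=> t0; apply: filterS (cbm_linear cbm 1 0 0 t0) => w.
by rewrite scaler0 addr0 mul1r => h; lra.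
Qed.

Lemma cbm_sum t (I : Type) (r : seq I) (c : I -> R) (h : I -> H) : 0 <= t ->
  {ae P, forall w, W t (\sum_(i <- r) c i *: h i) w = \sum_(i <- r) c i * W t (h i) w}.
Proof.
move=> t0; elim: r => [|i r IH].
  by apply: filterS (cbm_linear0 t0) => w; rewrite !big_nil.
apply: filterS2 IH (cbm_linear cbm (c i) (h i) (\sum_(i <- r) c i *: h i) t0) => w.
by rewrite !big_cons => -> ->.
Qed.

Lemma measurable_increment s t h : 0 <= s -> 0 <= t ->
  measurable_fun setT (fun w => W t h w - W s h w).
Proof. by move=> s0 t0; apply: measurable_funB; exact: (cbm_measurable cbm). Qed.

Lemma increment_moments s t h : 0 <= s -> s <= t ->
  gaussian_moments P (fun w => W t h w - W s h w) ((t - s) * ip h h).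
Proof.
move=> s0 st; apply: centered_gaussian_moments.
- by apply: measurable_increment => //; exact: le_trans st.
- by rewrite mulr_ge0 ?subr_ge0//; exact: (sip_ge0 sipH).
- exact: (cbm_gaussian cbm).
Qed.

(** The opposite of an increment along [h] is almost surely the increment along [- h], which is
    Gaussian with the same variance. The vector is written [-1 *: h + 0] to fit [cbm_linear]. *)
Lemma increment_odd s t h k : 0 <= s -> s <= t -> (k <= 4)%N -> odd k ->
  \int[P]_w ((W t h w - W s h w) ^+ k) = 0.
Proof.
move=> s0 st k4 ok; have t0 : 0 <= t by exact: le_trans st.
have g := cbm_gaussian cbm h s0 st.
have ipN : ip (-1 *: h + 0) (-1 *: h + 0) = ip h h.
  by rewrite addr0 (sipZl sipH)// (sipZr sipH)//; ring.
have g' := cbm_gaussian cbm (-1 *: h + 0) s0 st; rewrite ipN in g'.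
apply: (centered_gaussian_odd _ _ _ g g' _ k4 ok).
- exact: measurable_increment.
- exact: measurable_increment.
- by rewrite mulr_ge0 ?subr_ge0//; exact: (sip_ge0 sipH).
- apply: filterS3 (cbm_linear cbm (-1) h 0 t0) (cbm_linear cbm (-1) h 0 s0)
    (filterI (cbm_linear0 t0) (cbm_linear0 s0)) => w hh1 hh2 [z1 z2].
  by rewrite hh1 hh2 z1 z2; ring.
Qed.

Section sums_of_increments.
Variables (tau : nat -> R) (h : nat -> H).
Hypotheses (tau0 : 0 <= tau 0) (tauS : forall i, tau i <= tau i.+1).

Definition increments m (w : Om) : R :=
  \sum_(i < m) (W (tau i.+1) (h i) w - W (tau i) (h i) w).

Let tau_mono i j : (i <= j)%N -> tau i <= tau j.
Proof. by move=> ij; have /nondecreasing_seqP : forall n, tau n <= tau n.+1 by []; apply. Qed.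

Let tau_ge0 i : 0 <= tau i.
Proof. by rewrite (le_trans tau0)// tau_mono. Qed.

Let G m : set (set Om) := [set A | exists r h (C : set MR),
        [/\ 0 <= r <= tau m, measurable C & A = W r h @^-1` C]].

(** Adaptedness of the partial sums, which makes the next increment independent of them. *)
Lemma sigma_until_increments m (C : set MR) : measurable C ->
  sigma_until W (tau m) (increments m @^-1` C).
Proof.
have mW r k : 0 <= r <= tau m ->
    measurable_fun setT (W r k : g_sigma_algebraType (G m) -> MR).
  move=> rm _ B mB; rewrite setTI; apply: sub_sigma_algebra.
  by exists r, k, B.
have : measurable_fun setT (increments m : g_sigma_algebraType (G m) -> MR).
  apply: measurable_sum => i; apply: measurable_funB.
    by apply: mW; rewrite tau_ge0 tau_mono.
  by apply: mW; rewrite tau_ge0 tau_mono// ltnW.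
by move=> mi mC; have := mi measurableT _ mC; rewrite setTI.
Qed.

Lemma increments_moments m : gaussian_moments P (increments m)
  (\sum_(i < m) (tau i.+1 - tau i) * ip (h i) (h i)).
Proof.
elim: m => [|m IH].
  have -> : increments 0 = fun=> 0 by apply/funext => w; rewrite /increments big_ord0.
  rewrite big_ord0; split; first exact: measurable_cst.
    by rewrite expr0n /= integral0.
  by rewrite !expr0n /= mulr0 integral0.
have -> : increments m.+1 = fun w => increments m w + (W (tau m.+1) (h m) w - W (tau m) (h m) w).
  by apply/funext => w; rewrite /increments big_ord_recr.
rewrite big_ord_recr /=; apply: gaussian_momentsD => //.
- exact: increment_moments.
- move=> A C mA mC; have := @cbm_independent _ _ _ _ _ _ _ cbm _ _ (h m) (tau_ge0 m) (tauS m).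
  apply; first exact: sigma_until_increments.
  by exists C.
- by rewrite -[RHS](increment_odd (h m) (tau_ge0 m) (tauS m) (isT : (1 <= 4)%N) isT).
- by rewrite increment_odd.
Qed.

End sums_of_increments.
End brownian_increments.

(** * Wiener integrals of step functions *)

Section time_functions.
Context {R : realType} {H : lmodType R} {ip : H -> H -> R}.
Hypothesis sipH : semi_inner_product setT ip.
Variable e : nat -> H.
Hypothesis e_basis : complete_orthonormal (ip := ip) e.
Variable M : R.
Local Notation mu := (@lebesgue_measure R).
Local Notation D := `[0%R, M]%classic.

(** A substitute for L^2(0, M; H). Measurability is asked of coefficients only, and Parseval
    transfers it to pairings; boundedness on [[0, M]] makes these integrable. *)
Definition time_space : set (R -> H) :=
  [set f | (exists C : R, forall u, 0 <= u <= M -> ip (f u) (f u) <= C) /\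
    forall n, measurable_fun D (fun u => ip (f u) (e n))].

Definition time_ip (f g : R -> H) : R := \int[mu]_(u in D) ip (f u) (g u).

Lemma time_space_integrable f g : time_space f -> time_space g ->
  mu.-integrable D (EFin \o (fun u => ip (f u) (g u))).
Proof.
move=> [[C fC] mf] [[C' gC] mg].
have mfg : measurable_fun D (fun u => ip (f u) (g u)).
  apply: (@measurable_fun_cvg _ _ _ D
    (fun N u => series (fun n => ip (f u) (e n) * ip (g u) (e n)) N)) => [N|u _].
    by rewrite /series /=; apply: measurable_sum => i; exact: measurable_funM.
  exact: (parseval sipH e_basis).
apply: measurable_bounded_integrable => //.
  by rewrite /= lebesgue_measure_itv /=; case: ifP => _; rewrite ?ltry.
exists (Num.sqrt C * Num.sqrt C'); split; first exact: num_real.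
move=> x xC u /=; rewrite in_itv /= => uM.
rewrite (le_trans (sip_le_snorm sipH I I))// (le_trans _ (ltW xC))//.
by rewrite ler_pM ?snorm_ge0// ler_wsqrtr//; [exact: fC|exact: gC].
Qed.

Lemma time_sip : semi_inner_product time_space time_ip.
Proof.
split.
- split; first by exists 0 => u _; rewrite (sip0l sipH).
  move=> n; apply: (eq_measurable_fun (cst (0 : R))); last exact: measurable_cst.
  by move=> u _; rewrite (sip0l sipH).
- move=> c f g [[C fC] mf] [[C' gC] mg]; split.
    exists (2 * c ^+ 2 * C + 2 * C') => u uM.
    have h := sip_ge0 sipH (I : setT (c *: f u - g u)).
    have hf := fC _ uM; have hg := gC _ uM.
    change (ip (c *: f u + g u) (c *: f u + g u) <= 2 * c ^+ 2 * C + 2 * C').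
    move: h; rewrite (sip_sqrB sipH)// (sip_sqrD sipH)// !(sipZl sipH)// !(sipZr sipH)//.
    have := ler_wpM2l (sqr_ge0 c) hf; nra.
  move=> n; apply: (eq_measurable_fun (fun u => c * ip (f u) (e n) + ip (g u) (e n))).
    by move=> u _; rewrite -(sipP sipH).
  by apply: measurable_funD => //; exact: measurable_funM.
- by move=> f g _ _; apply: eq_Rintegral => u _; rewrite (sipC sipH).
- move=> c f g k Vf Vg Vk.
  have ifk := time_space_integrable Vf Vk; have igk := time_space_integrable Vg Vk.
  rewrite /time_ip -RintegralZl// -RintegralD//; last exact: (integrableZl _ c ifk).
  by apply: eq_Rintegral => u _; rewrite -(sipP sipH).
- by move=> f _; apply: Rintegral_ge0 => u _; exact: (sip_ge0 sipH).
Qed.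

Lemma time_spaceZ (phi : R -> R) (h : H) : measurable_fun D phi ->
  (exists C : R, forall u, 0 <= u <= M -> `|phi u| <= C) ->
  time_space (fun u => phi u *: h).
Proof.
move=> mphi [C phiC]; split.
  exists (C ^+ 2 * ip h h) => u uM; rewrite (sipZl sipH)// (sipZr sipH)// mulrA -expr2.
  rewrite ler_wpM2r//; first exact: (sip_ge0 sipH).
  rewrite -real_normK ?num_real// ler_pXn2r// ?nnegrE//; first exact: phiC.
  by rewrite (le_trans _ (phiC _ uM)).
move=> n; apply: (eq_measurable_fun (fun u => phi u * ip h (e n))).
  by move=> u _; rewrite (sipZl sipH).
exact: measurable_funM.
Qed.

Lemma time_ipZ (phi psi : R -> R) (h k : H) :
  time_ip (fun u => phi u *: h) (fun u => psi u *: k) =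
  \int[mu]_(u in D) (phi u * psi u * ip h k).
Proof.
by apply: eq_Rintegral => u _; rewrite (sipZl sipH)// (sipZr sipH)// mulrA.
Qed.

End time_functions.

Section step_functions.
Context {R : realType} {d : measure_display} {Om : measurableType d}.
Variable P : probability Om R.
Context {H : lmodType R} {ip : H -> H -> R}.
Hypothesis sipH : semi_inner_product setT ip.
Variable e : nat -> H.
Hypothesis e_basis : complete_orthonormal (ip := ip) e.
Variable W : R -> H -> Om -> R.
Hypothesis cbm : cylindrical_BM P ip W.
Variable M : R.
Local Notation mu := (@lebesgue_measure R).
Local Notation D := `[0%R, M]%classic.

(* (s, t, h, c) encodes the function u |-> 1_{]s, t]}(u) c h *)
Local Notation step := (R * R * H * R)%type.

Definition step_within (q : step) : Prop :=
  [/\ 0 <= q.1.1.1, q.1.1.1 <= q.1.1.2 & q.1.1.2 <= M].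

Definition step_term (q : step) (u : R) : H :=
  ((q.1.1.1 < u <= q.1.1.2)%R%:R * q.2) *: q.1.2.

Definition step_kernel (F : seq step) (u : R) : H := \sum_(q <- F) step_term q u.

Definition step_sum (F : seq step) (w : Om) : R :=
  \sum_(q <- F) q.2 * (W q.1.1.2 q.1.2 w - W q.1.1.1 q.1.2 w).

Lemma measurable_step_indicator (s t : R) :
  measurable_fun D (fun u => (s < u <= t)%R%:R : R).
Proof.
rewrite (_ : (fun u => _) = \1_(`]s, t]%classic)); first exact: measurable_indic.
by apply/funext => u; rewrite indicE mem_setE in_itv.
Qed.

Lemma step_term_space q : time_space (ip := ip) e M (step_term q).
Proof.
apply: (time_spaceZ sipH); first by apply: measurable_funM => //; exact: measurable_step_indicator.
exists `|q.2| => u _; rewrite normrM ler_piMl//.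
by case: (_ && _); rewrite ?normr1 ?normr0.
Qed.

Lemma step_kernelE F : step_kernel F = \sum_(q <- F) step_term q.
Proof. by apply/funext => u; rewrite /step_kernel fct_sumE. Qed.

Lemma step_kernel_space F : time_space (ip := ip) e M (step_kernel F).
Proof. by rewrite step_kernelE; apply: (sipV_sum (time_sip sipH e_basis M)) => q _; exact: step_term_space. Qed.

Lemma measurable_step_sum F : (forall q, q \in F -> step_within q) ->
  measurable_fun setT (step_sum F).
Proof.
elim: F => [_|q F IH FM].
  by rewrite (_ : step_sum _ = cst 0)//; apply/funext => w; rewrite /step_sum big_nil.
have -> : step_sum (q :: F) = fun w => q.2 * (W q.1.1.2 q.1.2 w - W q.1.1.1 q.1.2 w) + step_sum F w.
  by apply/funext => w; rewrite /step_sum big_cons.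
have [q0 q1 q2] := FM q (mem_head _ _).
apply: measurable_funD; last by apply: IH => p pF; apply: FM; rewrite inE pF orbT.
apply: measurable_funM => //.
by apply: (measurable_increment cbm) => //; exact: le_trans q1.
Qed.

Section partition.
Variables (tau : nat -> R) (m : nat).
Hypotheses (tau0 : 0 <= tau 0) (tauS : forall i, tau i <= tau i.+1).

Let tau_mono i j : (i <= j)%N -> tau i <= tau j.
Proof. by move=> ij; have /nondecreasing_seqP : forall n, tau n <= tau n.+1 by []; apply. Qed.

Let tau_ge0 i : 0 <= tau i.
Proof. by rewrite (le_trans tau0)// tau_mono. Qed.

(** The indicator compares times while the sum telescopes over indices. Since [tau] may repeat
    values the two can disagree, but only where [tau k.+1 = tau k], and there the increment is 0. *)
Lemma telescope_partition (f : R -> R) i j : (i <= j <= m)%N ->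
  \sum_(k < m) (tau i < tau k.+1 <= tau j)%R%:R * (f (tau k.+1) - f (tau k)) =
  f (tau j) - f (tau i).
Proof.
(* Clamping the index to the range from [i] to [j] gives a sum that telescopes over the whole
   partition. *)
move=> /andP[ij jm]; pose g k := f (tau (maxn i (minn j k))).
transitivity (\sum_(0 <= k < m) (g k.+1 - g k)).
  rewrite big_mkord; apply: eq_bigr => k _; rewrite /g.
  have [ki|ik] := ltnP k i.
    have -> : maxn i (minn j k.+1) = i by rewrite (minn_idPr _) ?(leq_trans ki)//; apply/maxn_idPl.
    have -> : maxn i (minn j k) = i.
      by rewrite (minn_idPr _) ?(leq_trans (ltnW ki))//; apply/maxn_idPl; exact: ltnW.
    by rewrite ltNge (tau_mono ki) /= mulr0n mul0r subrr.
  have [kj|] := boolP (k < j)%N.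
    have -> : maxn i (minn j k.+1) = k.+1 by rewrite (minn_idPr kj); apply/maxn_idPr; exact: leqW.
    have -> : maxn i (minn j k) = k by rewrite (minn_idPr (ltnW kj)); apply/maxn_idPr.
    rewrite (tau_mono kj) andbT; have [_|h] := ltP; first by rewrite mulr1n mul1r.
    have -> : tau k.+1 = tau k by apply/le_anti; rewrite tauS andbT (le_trans h)// tau_mono.
    by rewrite subrr mulr0.
  rewrite -leqNgt => jk.
  have -> : maxn i (minn j k.+1) = j by rewrite (minn_idPl (leqW jk)); apply/maxn_idPr.
  have -> : maxn i (minn j k) = j by rewrite (minn_idPl jk); apply/maxn_idPr.
  rewrite subrr; have [h|] := leP (tau k.+1) (tau j); last by rewrite andbF mulr0n mul0r.
  have -> : tau k.+1 = tau k by apply/le_anti; rewrite tauS andbT (le_trans h)// tau_mono.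
  by rewrite subrr mulr0.
rewrite telescope_sumr// /g (minn_idPl jm) (maxn_idPr ij).
by rewrite minn0 maxn0.
Qed.

Variable F : seq step.
Hypothesis partF : forall q, q \in F -> exists i j, [/\ (i <= j <= m)%N,
  q.1.1.1 = tau i & q.1.1.2 = tau j].
Hypothesis FM : forall q, q \in F -> step_within q.

(** The kernel is constant on each cell []tau i, tau i.+1]], so its value at the right end
    represents it there. [W] is linear only almost surely, hence an equality outside a null set. *)
Lemma step_sum_increments :
  {ae P, forall w, step_sum F w = increments W tau (fun i => step_kernel F (tau i.+1)) m w}.
Proof.
have h i : {ae P, forall w, forall t, (t == tau i.+1) || (t == tau i) ->
    W t (step_kernel F (tau i.+1)) w =
    \sum_(q <- F) ((q.1.1.1 < tau i.+1 <= q.1.1.2)%R%:R * q.2) * W t q.1.2 w}.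
  apply: filterS2 (cbm_sum cbm F (fun q => (q.1.1.1 < tau i.+1 <= q.1.1.2)%R%:R * q.2)
    (fun q => q.1.2) (tau_ge0 i.+1)) (cbm_sum cbm F
    (fun q => (q.1.1.1 < tau i.+1 <= q.1.1.2)%R%:R * q.2)
    (fun q => q.1.2) (tau_ge0 i)) => w h1 h2 t /orP[] /eqP ->; [exact: h1|exact: h2].
apply: filterS (ae_foralln h) => w {}h; rewrite /increments.
under eq_bigr => i _.
  rewrite !h ?eqxx ?orbT// -sumrB.
  under eq_bigr do rewrite -mulrBr.
  over.
rewrite exchange_big /step_sum /= big_seq [RHS]big_seq; apply: eq_bigr => q qF.
have [i [j [ijm -> ->]]] := partF qF.
rewrite -(telescope_partition (fun r => W r q.1.2 w) ijm) mulr_sumr.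
by apply: eq_bigr => k _; ring.
Qed.

(** Two half-open intervals of the partition meet in the interval from [tau (maxn i i')] to
    [tau (minn j j')], possibly empty; both sides compute its length. *)
Lemma sum_step_indicators i j i' j' : (i <= j <= m)%N -> (i' <= j' <= m)%N -> tau m <= M ->
  \sum_(k < m) (tau k.+1 - tau k) *
    ((tau i < tau k.+1 <= tau j)%R%:R * (tau i' < tau k.+1 <= tau j')%R%:R) =
  \int[mu]_(u in D) ((tau i < u <= tau j)%R%:R * (tau i' < u <= tau j')%R%:R).
Proof.
move=> ijm ijm' mM; pose p := maxn i i'; pose q := minn j j'.
have pE : tau p = Num.max (tau i) (tau i').
  rewrite /p; have [h|/ltnW h] := leqP i i'; [rewrite max_r|rewrite max_l] => //;
  exact: tau_mono.
have qE : tau q = Num.min (tau j) (tau j').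
  rewrite /q; have [h|/ltnW h] := leqP j j'; [rewrite min_l|rewrite min_r] => //;
  exact: tau_mono.
have E (u : R) : (tau i < u <= tau j)%R%:R * (tau i' < u <= tau j')%R%:R = (tau p < u <= tau q)%R%:R :> R.
  rewrite pE qE gt_max le_min; move: (tau i < u) (tau i' < u) (u <= tau j) (u <= tau j') => [] [] [] [];
  by rewrite ?mulr0 ?mul0r ?mulr1.
under eq_bigr do rewrite E mulrC.
under eq_Rintegral do rewrite E.
have qm : (q <= m)%N by case/andP: ijm => _ jm; rewrite (leq_trans _ jm)// geq_minl.
have -> : \int[mu]_(u in D) (tau p < u <= tau q)%R%:R = Num.max 0 (tau q - tau p).
  have -> : \int[mu]_(u in D) ((tau p < u <= tau q)%R%:R : R) = \int[mu]_(u in D) (\1_(`]tau p, tau q]%classic) u).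
    by apply: eq_Rintegral => u _; rewrite indicE mem_setE in_itv.
  rewrite /Rintegral integral_indic//.
  rewrite setIidl; last first.
    move=> u /=; rewrite !in_itv /= => /andP[pu uq]; rewrite (le_trans (tau_ge0 p) (ltW pu)) /=.
    by rewrite (le_trans uq)// (le_trans _ mM)// tau_mono.
  rewrite /= lebesgue_measure_itv /= lte_fin; case: ltP => pq.
    by rewrite /= max_r// subr_ge0 ltW.
  by rewrite max_l// subr_le0.
have [pq|qp] := leqP p q.
  rewrite (telescope_partition (fun r => r)) ?pq ?qm// max_r// subr_ge0; exact: tau_mono.
rewrite max_l ?subr_le0 ?tau_mono//; last exact: ltnW.
apply: big1 => k _; have [h|] := leP (tau k.+1) (tau q); last by rewrite andbF mulr0n mul0r.
by rewrite ltNge (le_trans h)/= ?mulr0n ?mul0r// tau_mono// ltnW.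
Qed.

Lemma step_sum_moments_partition : tau m <= M -> gaussian_moments P (step_sum F)
  (time_ip (ip := ip) M (step_kernel F) (step_kernel F)).
Proof.
move=> mM; have tsip := time_sip sipH e_basis M.
have -> : time_ip (ip := ip) M (step_kernel F) (step_kernel F) = \sum_(i < m)
    (tau i.+1 - tau i) * ip (step_kernel F (tau i.+1)) (step_kernel F (tau i.+1)).
  have -> : time_ip (ip := ip) M (step_kernel F) (step_kernel F) =
      \sum_(q <- F) \sum_(q' <- F) time_ip (ip := ip) M (step_term q) (step_term q').
    rewrite step_kernelE (sip_suml tsip).
    - apply: eq_bigr => q _; rewrite (sip_sumr tsip)//; last exact: step_term_space.
      by move=> q' _; exact: step_term_space.
    - by move=> q _; exact: step_term_space.
    - by rewrite -step_kernelE; exact: step_kernel_space.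
  have kE (u : R) : ip (step_kernel F u) (step_kernel F u) =
      \sum_(q <- F) \sum_(q' <- F) ip (step_term q u) (step_term q' u).
    by rewrite (sip_suml sipH)//; apply: eq_bigr => q _; rewrite (sip_sumr sipH).
  under [RHS]eq_bigr => i _.
    rewrite kE mulr_sumr.
    under eq_bigr do rewrite mulr_sumr.
    over.
  rewrite [RHS]exchange_big /= big_seq [RHS]big_seq; apply: eq_bigr => q qF.
  rewrite [RHS]exchange_big /= big_seq [RHS]big_seq; apply: eq_bigr => q' qF'.
  have [i [j [ijm si tj]]] := partF qF; have [i' [j' [ijm' si' tj']]] := partF qF'.
  rewrite time_ipZ// si tj si' tj'.
  transitivity (\int[mu]_(u in D) ((q.2 * q'.2 * ip q.1.2 q'.1.2) *
      ((tau i < u <= tau j)%R%:R * (tau i' < u <= tau j')%R%:R))).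
    by apply: eq_Rintegral => u _; ring.
  rewrite RintegralZl//; last first.
    apply: measurable_bounded_integrable => //.
    - by rewrite /= lebesgue_measure_itv /=; case: ifP => _; rewrite ?ltry.
    - by apply: measurable_funM; exact: measurable_step_indicator.
    - exists 1; split => // x x1 u _ /=; rewrite (le_trans _ (ltW x1))//.
      by case: (_ && _); case: (_ && _); rewrite ?mulr0 ?mulr1 ?normr0 ?normr1.
  rewrite -sum_step_indicators// mulr_sumr; apply: eq_bigr => k _.
  by rewrite /step_term si tj si' tj' (sipZl sipH)// (sipZr sipH)//; ring.
have [mI I2 I4] := increments_moments sipH cbm (fun i => step_kernel F (tau i.+1)) tau0 tauS m.
have mS := measurable_step_sum FM.
have E k : (\int[P]_w (step_sum F w ^+ k)%:E =
   \int[P]_w (increments W tau (fun i => step_kernel F (tau i.+1)) m w ^+ k)%:E)%E.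
  apply: ae_eq_integral => //.
  - by apply/measurable_EFinP; exact: measurable_funX.
  - by apply/measurable_EFinP; exact: measurable_funX.
  - by apply: filterS step_sum_increments => w /= ->.
by split => //; rewrite E.
Qed.

End partition.

(** Sorting all end points gives a common partition, after which the sum becomes one of independent
    increments with a deterministic vector on each cell. *)
Lemma step_sum_moments F : (forall q, q \in F -> step_within q) ->
  gaussian_moments P (step_sum F) (time_ip (ip := ip) M (step_kernel F) (step_kernel F)).
Proof.
move=> FM; have [M0|M0] := leP 0 M; last first.
  have F0 : F = [::].
    case: F FM => // q F' /(_ q (mem_head _ _)) [h1 h2 h3].
    by have := le_trans (le_trans h1 h2) h3; rewrite leNgt M0.
  rewrite F0; have -> : step_sum [::] = fun=> 0 by apply/funext => w; rewrite /step_sum big_nil.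
  have -> : time_ip (ip := ip) M (step_kernel [::]) (step_kernel [::]) = 0.
    by rewrite (step_kernelE [::]) big_nil (sip0l (time_sip sipH e_basis M))//; exact: (sip0 (time_sip sipH e_basis M)).
  by split; [exact: measurable_cst|rewrite expr0n integral0|rewrite !expr0n /= mulr0 integral0].
pose L := sort <=%R (flatten [seq [:: q.1.1.1; q.1.1.2] | q <- F]).
have Lin x : x \in L -> 0 <= x <= M.
  rewrite mem_sort => /flattenP[_ /mapP[q qF ->]].
  have [h1 h2 h3] := FM _ qF; rewrite !inE => /orP[] /eqP ->.
    by rewrite h1 (le_trans h2).
  by rewrite h3 (le_trans h1).
have sL : sorted <=%R L by apply: sort_sorted; exact: le_total.
(* The default [M] extends the sorted list monotonically, and [tau (size L) = M]. *)
pose tau := nth M L.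
have tauS i : tau i <= tau i.+1.
  rewrite /tau; have [iL|iL] := ltnP i.+1 (size L).
    by have /sortedP := sL; apply.
  rewrite [leRHS]nth_default//; have [iL'|iL'] := ltnP i (size L); last by rewrite nth_default.
  by have /andP[] := Lin _ (mem_nth M iL').
have tau0 : 0 <= tau 0.
  rewrite /tau; have [iL'|iL'] := ltnP 0 (size L); last by rewrite nth_default.
  by have /andP[] := Lin _ (mem_nth M iL').
apply: (step_sum_moments_partition tau0 tauS (m := size L)) => //; last by rewrite /tau nth_default.
move=> q qF; have [h1 h2 h3] := FM _ qF.
have sq : q.1.1.1 \in L.
  by rewrite mem_sort; apply/flattenP; exists [:: q.1.1.1; q.1.1.2]; rewrite ?mem_head//; apply/mapP; exists q.
have tq : q.1.1.2 \in L.
  by rewrite mem_sort; apply/flattenP; exists [:: q.1.1.1; q.1.1.2]; rewrite ?inE ?eqxx ?orbT//; apply/mapP; exists q.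
have [ij|ji] := leqP (index q.1.1.1 L) (index q.1.1.2 L).
  exists (index q.1.1.1 L), (index q.1.1.2 L); split; rewrite /tau ?nth_index//.
  by rewrite ij index_size.
have : tau (index q.1.1.2 L) <= tau (index q.1.1.1 L).
  by have /nondecreasing_seqP : forall n, tau n <= tau n.+1 by []; apply; exact: ltnW.
rewrite /tau !nth_index// => h; have E : q.1.1.1 = q.1.1.2 by apply/le_anti; rewrite h2 h.
by move: ji; rewrite E ltnn.
Qed.

End step_functions.

(** * Covariance and Isserlis' formula for step integrals *)

Section step_pairs.
Context {R : realType} {d : measure_display} {Om : measurableType d}.
Variable P : probability Om R.
Context {H : lmodType R} {ip : H -> H -> R}.
Hypothesis sipH : semi_inner_product setT ip.
Variable e : nat -> H.
Hypothesis e_basis : complete_orthonormal (ip := ip) e.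
Variable W : R -> H -> Om -> R.
Hypothesis cbm : cylindrical_BM P ip W.
Variable M : R.
Local Notation step := (R * R * H * R)%type.
Local Notation E2 X Y := (\int[P]_w (X w * Y w)).
Local Notation kip := (time_ip (ip := ip) M).

Implicit Types F G : seq step.

Definition scale_steps (c : R) (F : seq step) : seq step :=
  [seq (q.1, c * q.2) | q <- F].

Definition steps_within (F : seq step) : Prop := forall q, q \in F -> step_within M q.

Lemma step_sum_cat F G w : step_sum W (F ++ G) w = step_sum W F w + step_sum W G w.
Proof. by rewrite /step_sum big_cat. Qed.

Lemma step_sum_scale (c : R) F w : step_sum W (scale_steps c F) w = c * step_sum W F w.
Proof. by rewrite /step_sum big_map mulr_sumr; apply: eq_bigr => q _ /=; rewrite mulrA. Qed.

Lemma step_kernel_cat F G : step_kernel (F ++ G) = step_kernel F + step_kernel G.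
Proof. by apply/funext => u; rewrite /step_kernel big_cat. Qed.

Lemma step_kernel_scale (c : R) F : step_kernel (scale_steps c F) = c *: step_kernel F.
Proof.
apply/funext => u; rewrite /step_kernel big_map.
transitivity (c *: \sum_(q <- F) step_term q u); last by [].
rewrite scaler_sumr; apply: eq_bigr => q _.
by rewrite /step_term /= scalerA mulrCA.
Qed.

Lemma steps_within_comb (c : R) F G : steps_within F -> steps_within G ->
  steps_within (F ++ scale_steps c G).
Proof.
move=> hF hG q; rewrite mem_cat => /orP[/hF//|/mapP[p /hG hp ->]].
by case: hp.
Qed.

Lemma step_sum_square_integrable F : steps_within F -> square_integrable P (step_sum W F).
Proof.
move=> hF; have g := step_sum_moments sipH e_basis cbm hF.
by split; [case: g|exact: (gaussian_moments_integrable g)].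
Qed.

Let ksip := time_sip sipH e_basis M.

(** The integral of [F] plus [c] times that of [G] is again a step integral, so its moments are
    known; [c = 1] and [c = -1] are the cases used for polarisation. *)
Let comb_moments (c : R) F G : steps_within F -> steps_within G ->
  gaussian_moments P (fun w => step_sum W F w + c * step_sum W G w)
   (kip (step_kernel F) (step_kernel F) + 2 * c * kip (step_kernel F) (step_kernel G) +
    c ^+ 2 * kip (step_kernel G) (step_kernel G)).
Proof.
move=> hF hG; have := step_sum_moments sipH e_basis cbm (@steps_within_comb c _ _ hF hG).
have KF := step_kernel_space sipH e_basis M F.
have KG := step_kernel_space sipH e_basis M G.
have -> : step_sum W (F ++ scale_steps c G) = fun w => step_sum W F w + c * step_sum W G w.
  by apply/funext => w; rewrite step_sum_cat step_sum_scale.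
rewrite step_kernel_cat step_kernel_scale (sip_sqrD ksip)//; last exact: (sipVZ ksip).
rewrite (sipZr ksip)// (sipZl ksip)//; last exact: (sipVZ ksip).
by rewrite (sipZr ksip)// !mulrA -expr2.
Qed.

Lemma step_sum_covariance F G : steps_within F -> steps_within G ->
  E2 (step_sum W F) (step_sum W G) = kip (step_kernel F) (step_kernel G).
Proof.
move=> hF hG; have VF := step_sum_square_integrable hF.
have VG := step_sum_square_integrable hG; have s := square_integrable_sip P.
have E X v : gaussian_moments P X v -> E2 X X = v.
  by case=> _ h _; rewrite /Rintegral; under eq_integral do rewrite -expr2; rewrite h.
have e1 := E _ _ (comb_moments 1 hF hG).
have e2 := E _ _ (step_sum_moments sipH e_basis cbm hF).
have e3 := E _ _ (step_sum_moments sipH e_basis cbm hG).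
have := sip_sqrD s VF VG; rewrite e2 e3.
have -> : E2 (step_sum W F + step_sum W G) (step_sum W F + step_sum W G) =
  \int[P]_w ((step_sum W F w + 1 * step_sum W G w) * (step_sum W F w + 1 * step_sum W G w)).
  by apply: eq_Rintegral => w _; rewrite mul1r.
rewrite e1 expr1n !mul1r mulr1; lra.
Qed.

(** Polarisation in degree four: [12 x^2 y^2 = (x + y)^4 + (x - y)^4 - 2 x^4 - 2 y^4], where each
    fourth moment on the right is three times a squared variance. *)
Lemma step_sum_isserlis F G : steps_within F -> steps_within G ->
  (\int[P]_w ((step_sum W F w ^+ 2) * (step_sum W G w ^+ 2))%:E =
   (E2 (step_sum W F) (step_sum W F) * E2 (step_sum W G) (step_sum W G) +
    2 * E2 (step_sum W F) (step_sum W G) ^+ 2)%:E)%E.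
Proof.
move=> hF hG; rewrite !step_sum_covariance//.
have gp := comb_moments 1 hF hG; have gm := comb_moments (-1) hF hG.
have gF := step_sum_moments sipH e_basis cbm hF.
have gG := step_sum_moments sipH e_basis cbm hG.
move: gp gm gF gG; set x := step_sum W F; set y := step_sum W G.
set A := kip _ _; set C := kip _ _; set B := kip _ _ => gp gm gF gG.
have i4 X v : gaussian_moments P X v -> P.-integrable setT (EFin \o (fun w => X w ^+ 4)).
  by move=> g; exact: (gaussian_moments_integrable g).
have r4 X v : gaussian_moments P X v -> \int[P]_w (X w ^+ 4) = 3 * v ^+ 2.
  by case=> _ _ h; rewrite /Rintegral h.
pose f w := (x w + 1 * y w) ^+ 4; pose g w := (x w + -1 * y w) ^+ 4.
have E w : x w ^+ 2 * y w ^+ 2 = 12^-1 * f w + (12^-1 * g w +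
    ((- 6^-1) * x w ^+ 4 + (- 6^-1) * y w ^+ 4)) by rewrite /f /g; field.
have iZ (c : R) (u : Om -> R) : P.-integrable setT (EFin \o u) ->
    P.-integrable setT (EFin \o (fun w => c * u w)) by move=> iu; exact: (integrableZl measurableT c iu).
have iD (u v : Om -> R) : P.-integrable setT (EFin \o u) -> P.-integrable setT (EFin \o v) ->
    P.-integrable setT (EFin \o (fun w => u w + v w)) by exact: integrableD.
have if_ := i4 _ _ gp; have ig := i4 _ _ gm; have ix := i4 _ _ gF; have iy := i4 _ _ gG.
have i1 := iD _ _ (iZ (- 6^-1) _ ix) (iZ (- 6^-1) _ iy).
have i2 := iD _ _ (iZ 12^-1 _ ig) i1.
have i3 := iD _ _ (iZ 12^-1 _ if_) i2.
under eq_integral do rewrite E.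
rewrite -[LHS]fineK; last exact: (integrable_fin_num measurableT i3).
congr EFin; rewrite -[LHS]/(\int[P]_w (12^-1 * f w + (12^-1 * g w +
    ((- 6^-1) * x w ^+ 4 + (- 6^-1) * y w ^+ 4)))).
rewrite RintegralD//; last exact: iZ.
rewrite RintegralD//; last exact: iZ.
rewrite RintegralD//; [|exact: iZ|exact: iZ].
rewrite !RintegralZl// (r4 _ _ gp) (r4 _ _ gm) (r4 _ _ gF) (r4 _ _ gG).
by field.
Qed.

End step_pairs.

(** * Almost sure and mean-square limits of step integrals *)

Section almost_everywhere.
Context {R : realType} {d : measure_display} {T : measurableType d}.
Variable mu : {measure set T -> \bar R}.

(** The sum of the [f n] has a finite integral, hence is finite almost everywhere, and the terms of
    a convergent series tend to 0. It plays the part of the Borel-Cantelli lemma here and in the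
    strong law. *)
Lemma ae_cvg0_summable (f : nat -> T -> R) :
  (forall n, measurable_fun setT (f n)) -> (forall n x, 0 <= f n x) ->
  (\sum_(n <oo) \int[mu]_x (f n x)%:E < +oo)%E ->
  {ae mu, forall x, f n x @[n --> \oo] --> (0 : R)}.
Proof.
move=> mf f0 fin.
have mEf n : measurable_fun setT (EFin \o f n) by exact/measurable_EFinP.
have E := integral_nneseries mu measurableT mEf (fun n x _ => f0 n x : (0 <= (f n x)%:E)%E).
have mS : measurable_fun setT (fun x => \sum_(n <oo) (f n x)%:E)%E.
  by apply: ge0_emeasurable_sum => [k x _ _|k _]; [rewrite lee_fin|exact: mEf].
have iS : mu.-integrable setT (fun x => \sum_(n <oo) (f n x)%:E)%E.
  apply/integrableP; split => //.
  rewrite (eq_integral (fun x => \sum_(n <oo) (f n x)%:E)%E) ?E// => x _.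
  by rewrite gee0_abs// nneseries_ge0// => n _ _; exact: f0.
apply: filterS (integrable_ae measurableT iS) => x /(_ I) xfin.
apply: cvg_series_cvg_0; apply: nnseries_is_cvg => //.
by rewrite ltey_eq xfin.
Qed.

Lemma half_series_lty : (\sum_(n <oo) (1 / (2 ^ (n + 1))%:R)%:E < +oo :> \bar R)%E.
Proof.
have := @cvg_geometric_eseries_half R 1 0; move/cvg_lim => -> //.
by rewrite ltry.
Qed.

End almost_everywhere.

Section wiener_limits.
Context {R : realType} {d : measure_display} {Om : measurableType d}.
Variable P : probability Om R.
Context {H : lmodType R} {ip : H -> H -> R}.
Hypothesis sipH : semi_inner_product setT ip.
Variable e : nat -> H.
Hypothesis e_basis : complete_orthonormal (ip := ip) e.
Variable W : R -> H -> Om -> R.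
Hypothesis cbm : cylindrical_BM P ip W.
Variable M : R.
Local Notation step := (R * R * H * R)%type.
Local Notation ipP := (fun X Y : Om -> R => \int[P]_w (X w * Y w)).
Local Notation kip := (time_ip (ip := ip) M).
Implicit Types (X Y : Om -> R) (F G : nat -> seq step).

(** Convergence of the kernels is kept apart: for the noise it is established along truncations of
    [z], while this mean-square convergence is also used for [z] itself. *)
Definition step_limit F X : Prop :=
  [/\ forall k, steps_within M (F k), square_integrable P X &
      snorm ipP (step_sum W (F k) - X) @[k --> \oo] --> (0 : R)].

Let psip := square_integrable_sip P.

Let FL2 F X k : step_limit F X -> square_integrable P (step_sum W (F k)).
Proof. by case=> FM _ _; exact: (step_sum_square_integrable sipH e_basis cbm (FM k)). Qed.

(** The isometry for step integrals passes to the limit because both inner products are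
    continuous. *)
Lemma step_limit_covariance F G X Y p q : step_limit F X -> step_limit G Y ->
  time_space (ip := ip) e M p -> time_space (ip := ip) e M q ->
  snorm kip (step_kernel (F k) - p) @[k --> \oo] --> (0 : R) ->
  snorm kip (step_kernel (G k) - q) @[k --> \oo] --> (0 : R) ->
  \int[P]_w (X w * Y w) = kip p q.
Proof.
move=> hF hG Vp Vq Fp Gq; have [FM VX FX] := hF; have [GM VY GY] := hG.
have c1 := cvg_ip psip (fun k => FL2 k hF) (fun k => FL2 k hG) VX VY FX GY.
have c2 := cvg_ip (time_sip sipH e_basis M) (fun k => step_kernel_space sipH e_basis M (F k))
  (fun k => step_kernel_space sipH e_basis M (G k)) Vp Vq Fp Gq.
rewrite (_ : (fun k => _) = fun k => kip (step_kernel (F k)) (step_kernel (G k))) in c1.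
  exact: (cvg_uniq (c1 _) (c2 _)).
by apply/funext => k; exact: (step_sum_covariance sipH e_basis cbm (FM k) (GM k)).
Qed.

Lemma step_limit_subsequence F G X Y : step_limit F X -> step_limit G Y ->
  exists F' G', [/\ step_limit F' X, step_limit G' Y &
   {ae P, forall w, (step_sum W (F' k) w @[k --> \oo] --> X w) /\
                    (step_sum W (G' k) w @[k --> \oo] --> Y w)}].
Proof.
move=> hF hG; have [FM VX FX] := hF; have [GM VY GY] := hG.
(* Adding both squared distances yields one subsequence that serves [X] and [Y]; keeping the sum at
   most [2^-(j+1)] makes both summable. *)
pose u k := snorm ipP (step_sum W (F k) - X) ^+ 2 + snorm ipP (step_sum W (G k) - Y) ^+ 2.
have u0 : u k @[k --> \oo] --> (0 : R).
  apply: cvg0_add; rewrite -(mulr0 0); apply: cvgM => //.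
have half_gt0 j : 0 < 1 / (2 ^ (j + 1))%:R :> R by rewrite divr_gt0// ltr0n expn_gt0.
have /choice[phi phiP] : forall j, exists k, u k <= 1 / (2 ^ (j + 1))%:R.
  move=> j; have [N _ hN] := (cvgrPdist_le _ _).1 u0 _ (half_gt0 j).
  exists N; have := hN N (leqnn N); rewrite sub0r normrN; apply: le_trans; exact: ler_norm.
have half0 : 1 / (2 ^ (j + 1))%:R @[j --> \oo] --> (0 : R).
  have := nnseries_is_cvg (fun j => ltW (half_gt0 j)) half_series_lty.
  exact: cvg_series_cvg_0.
have sn0 (V : nat -> Om -> R) : (forall j, snorm ipP (V j) ^+ 2 <= 1 / (2 ^ (j + 1))%:R) ->
    snorm ipP (V j) @[j --> \oo] --> (0 : R).
  move=> hV; have -> : (fun j => snorm ipP (V j)) = (fun j => Num.sqrt (snorm ipP (V j) ^+ 2)).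
    by apply/funext => j; rewrite sqrtr_sqr ger0_norm// snorm_ge0.
  rewrite -sqrtr0; apply: continuous_cvg; first exact: sqrt_continuous.
  apply: (@squeeze_cvgr _ _ _ _ (fun=> 0) (fun j => 1 / (2 ^ (j + 1))%:R)) => //.
    by near=> j; rewrite sqr_ge0 hV.
  exact: cvg_cst.
have hu1 j : snorm ipP (step_sum W (F (phi j)) - X) ^+ 2 <= 1 / (2 ^ (j + 1))%:R.
  by rewrite (le_trans _ (phiP j))// lerDl sqr_ge0.
have hu2 j : snorm ipP (step_sum W (G (phi j)) - Y) ^+ 2 <= 1 / (2 ^ (j + 1))%:R.
  by rewrite (le_trans _ (phiP j))// lerDr sqr_ge0.
exists (F \o phi), (G \o phi); split.
- by split => //; [move=> k; exact: FM|exact: sn0].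
- by split => //; [move=> k; exact: GM|exact: sn0].
have ae (F0 : nat -> seq step) Z : step_limit F0 Z ->
    (forall j, snorm ipP (step_sum W (F0 (phi j)) - Z) ^+ 2 <= 1 / (2 ^ (j + 1))%:R) ->
    {ae P, forall w, step_sum W (F0 (phi k)) w @[k --> \oo] --> Z w}.
  move=> h0 hu; have [_ VZ _] := h0.
  have VD j := sipVB psip (FL2 (phi j) h0) VZ.
  have fin : (\sum_(j <oo) \int[P]_w (((step_sum W (F0 (phi j)) - Z) w) ^+ 2)%:E < +oo)%E.
    apply: le_lt_trans half_series_lty; apply: lee_nneseries => [j _ _|j _].
      by apply: integral_ge0 => w _; rewrite lee_fin sqr_ge0.
    rewrite -[leLHS]fineK; last by apply: (integrable_fin_num measurableT); case: (VD j).
    rewrite lee_fin (le_trans _ (hu j))// (sqr_snorm psip (VD j)).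
    by rewrite le_eqVlt; apply/orP; left; apply/eqP/eq_Rintegral => w _; rewrite expr2.
  have := ae_cvg0_summable (fun j => measurable_funX 2 (proj1 (VD j))) (fun j w => sqr_ge0 _) fin.
  apply: filterS => w cw; apply: (@cvg_norm_le _ _ _ _ _ (fun j => `|(step_sum W (F0 (phi j)) - Z) w|)).
    by near=> j.
  have -> : (fun j => `|(step_sum W (F0 (phi j)) - Z) w|) =
    (fun j => Num.sqrt (((step_sum W (F0 (phi j)) - Z) w) ^+ 2)).
    by apply/funext => j; rewrite sqrtr_sqr.
  by rewrite -sqrtr0; apply: continuous_cvg; [exact: sqrt_continuous|exact: cw].
by apply: filterS2 (ae _ _ hF hu1) (ae _ _ hG hu2) => w.
Unshelve. all: by end_near.
Qed.

(* Fatou's lemma along an almost surely convergent subsequence of step sums,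
   for which the equality holds. *)
Lemma step_limit_isserlis F G X Y : step_limit F X -> step_limit G Y ->
  (\int[P]_w ((X w ^+ 2) * (Y w ^+ 2))%:E <=
   (ipP X X * ipP Y Y + 2 * ipP X Y ^+ 2)%:E)%E.
Proof.
move=> /step_limit_subsequence /[apply] -[F' [G' [hF hG cae]]].
have [FM VX FX] := hF; have [GM VY GY] := hG.
pose f k w := (step_sum W (F' k) w ^+ 2 * step_sum W (G' k) w ^+ 2)%:E.
have mF k := proj1 (FL2 k hF); have mG k := proj1 (FL2 k hG).
have mf k : measurable_fun setT (f k).
  by apply/measurable_EFinP/measurable_funM; exact: measurable_funX.
have f0 k w : setT w -> (0 <= f k w)%E by rewrite lee_fin mulr_ge0 ?sqr_ge0.
have mXY : measurable_fun setT (fun w => (X w ^+ 2 * Y w ^+ 2)%:E).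
  by apply/measurable_EFinP/measurable_funM; apply: measurable_funX; [case: VX|case: VY].
have mL : measurable_fun setT (fun w => limn_einf (f^~ w)).
  rewrite (_ : (fun w => _) = (fun w => - limn_esup (-%E \o f^~ w))%E).
    apply: measurableT_comp => //; apply: measurable_fun_limn_esup => k.
    exact: measurableT_comp.
  by apply/funext => w; rewrite limn_esupN oppeK.
have -> : (\int[P]_w ((X w ^+ 2) * (Y w ^+ 2))%:E = \int[P]_w limn_einf (f^~ w))%E.
  apply: ae_eq_integral => //.
  apply: filterS cae => w [cX cY] _; apply/esym.
  apply: (fst (cvg_limn_einf_sup _)); apply: cvg_EFin; first exact: nearW.
  by apply: cvgM; apply: (@cvgM _ _ _ _ (fun k => _) (fun k => _)).
apply: (le_trans (fatou P measurableT mf f0)).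
have cX := cvg_ip psip (fun k => FL2 k hF) (fun k => FL2 k hF) VX VX FX FX.
have cY := cvg_ip psip (fun k => FL2 k hG) (fun k => FL2 k hG) VY VY GY GY.
have cXY := cvg_ip psip (fun k => FL2 k hF) (fun k => FL2 k hG) VX VY FX GY.
rewrite (fst (cvg_limn_einf_sup (l := (ipP X X * ipP Y Y + 2 * ipP X Y ^+ 2)%:E) _))//.
under eq_fun do rewrite /f (step_sum_isserlis sipH e_basis cbm (FM _) (GM _)).
apply: cvg_EFin; first exact: nearW.
apply: cvgD; first exact: (cvgM (cX _) (cY _)).
by apply: cvgM; [exact: cvg_cst|exact: (cvgM (cXY _) (cXY _))].
Qed.

End wiener_limits.

(** * A strong law of large numbers *)

Section exponential_integrals.
Context {R : realType}.
Local Notation mu := (@lebesgue_measure R).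

Lemma is_derive_expR_affine (c r t : R) :
  is_derive t 1 (fun t : R => expR (c * t + r)) (expR (c * t + r) * c).
Proof.
pose g (u : R) : R := c * u + r.
have h1 : is_derive t 1 g c.
  apply: (is_derive_eq (is_deriveD (is_deriveM (is_derive_cst c t 1) (is_derive_id t 1))
    (is_derive_cst r t 1))).
  by rewrite /GRing.scale /=; ring.
have h2 : is_derive (g t) 1 (expR : R -> R) (expR (g t)) by exact: is_derive_expR.
exact: (is_derive1_comp h2 h1).
Qed.

Lemma integral_expR_affine (c p q r : R) : c != 0 -> p <= q ->
  (\int[mu]_(t in `[p, q]) (expR (c * t + r))%:E =
   ((expR (c * q + r) - expR (c * p + r)) / c)%:E)%E.
Proof.
move=> c0; rewrite le_eqVlt => /orP[/eqP ->|pq].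
  by rewrite set_itv1 integral_set1 subrr mul0r.
pose F (t : R) := c^-1 * expR (c * t + r).
have dF (t : R) : is_derive t 1 F (expR (c * t + r)).
  have h3 := is_derive_expR_affine c r t.
  apply: (is_derive_eq (is_deriveM (is_derive_cst c^-1 t 1) h3)).
  by rewrite /GRing.scale /=; field.
have ce (t : R) : {for t, continuous (fun t : R => expR (c * t + r))}.
  exact: is_derive_continuous (is_derive_expR_affine c r t).
have cF (t : R) : {for t, continuous F} by exact: is_derive_continuous (dF t).
rewrite (continuous_FTC2 pq (F := F)).
- by rewrite -EFinB /F; congr EFin; field.
- by apply: continuous_subspaceT => t; exact: ce.
- split; first by move=> t _; case: (dF t).
    by apply: cvg_at_right_filter; exact: cF.
  by apply: cvg_at_left_filter; exact: cF.
- by move=> t _; rewrite derive1E; case: (dF t).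
Qed.

Lemma measurable_expR_affine (c r : R) (D : set R) : measurable D ->
  measurable_fun D (fun t : R => expR (c * t + r)).
Proof.
move=> mD; apply: (measurableT_comp (@measurable_expR R)).
by apply: measurable_funD => //; exact: measurable_funM.
Qed.

(** The bound does not depend on [s] or [T]; this is why the variance of the time integral grows at
    most linearly. *)
Lemma integral_expR_dist (k s T : R) : 0 < k -> 0 <= s <= T ->
  (\int[mu]_(t in `[0%R, T]) (expR (- k * `|t - s|))%:E <= (2 / k)%:E)%E.
Proof.
move=> k0 /andP[s0 sT].
have -> : `[0%R, T]%classic = `[0%R, s] `|` `]s, T] :> set R.
  by rewrite -itv_bndbnd_setU// bnd_simp.
have mE (D : set R) : measurable D -> measurable_fun D (fun t : R => (expR (- k * `|t - s|))%:E).
  move=> mD; apply/measurable_EFinP; apply: (measurableT_comp (@measurable_expR R)).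
  apply: measurable_funM => //; apply: measurableT_comp => //; exact: measurable_funB.
rewrite ge0_integral_setU//; last 2 first.
- by apply: mE; apply: measurableU => //; exact: measurable_itv.
- rewrite disj_set2E; apply/eqP/seteqP; split => // t [] /=; rewrite !in_itv /= => /andP[_ ts] /andP[st _].
  by move: (lt_le_trans st ts); rewrite ltxx.
have -> : (2 / k)%:E = ((1 / k)%:E + (1 / k)%:E)%E :> \bar R by rewrite -EFinD; congr EFin; lra.
have kn0 : k != 0 by rewrite gt_eqF.
apply: leeD.
  have -> : (\int[mu]_(t in `[0%R, s]) (expR (- k * `|t - s|))%:E =
     \int[mu]_(t in `[0%R, s]) (expR (k * t + - (k * s)))%:E)%E.
    apply: eq_integral => t; rewrite inE /= in_itv /= => /andP[_ ts]; congr (expR _)%:E.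
    by rewrite ler0_norm ?subr_le0//; ring.
  rewrite integral_expR_affine// lee_fin ler_pM2r ?invr_gt0// subrr expR0.
  by rewrite lerBlDr lerDl expR_ge0.
rewrite (@le_trans _ _ (\int[mu]_(t in `[s, T]) (expR (- k * `|t - s|))%:E)%E)//.
  apply: ge0_subset_integral => //; first exact: mE.
  by move=> t /=; rewrite !in_itv /= => /andP[/ltW -> ->].
have -> : (\int[mu]_(t in `[s, T]) (expR (- k * `|t - s|))%:E =
   \int[mu]_(t in `[s, T]) (expR (- k * t + k * s))%:E)%E.
  apply: eq_integral => t; rewrite inE /= in_itv /= => /andP[ts _]; congr (expR _)%:E.
  by rewrite ger0_norm ?subr_ge0//; ring.
rewrite integral_expR_affine ?oppr_eq0// lee_fin invrN mulrN -mulNr opprB ler_pM2r ?invr_gt0//.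
have -> : - k * s + k * s = 0 by ring.
by rewrite expR0 lerBlDr lerDl expR_ge0.
Qed.

End exponential_integrals.

Section tonelli_on_domain.
Context {R : realType} {d : measure_display} {Om : measurableType d}.
Variable P : probability Om R.
Local Notation MR := (measurableTypeR R).
Local Notation mu := (@lebesgue_measure R).
Variables (D : set MR) (f : MR * Om -> \bar R).
Hypotheses (mD : measurable D) (mf : measurable_fun setT f) (f0 : forall p, (0 <= f p)%E).

(** Extension by 0 outside [D] reduces the restricted integrals to Tonelli on the whole product. *)
Let F := (f \_ (D `*` setT)).

Let mF : measurable_fun setT F.
Proof.
apply/(measurable_restrictT f (measurableX mD measurableT)).
exact: measurable_funTS.
Qed.

Let F0 p : (0 <= F p)%E.
Proof. by apply: erestrict_ge0 => q _; exact: f0. Qed.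

Let FE t w : F (t, w) = ((fun t => f (t, w)) \_ D) t.
Proof. by rewrite /F !patchE; congr (if _ then _ else _); apply/asbool_equiv_eq; split=> [[]|]. Qed.

Lemma tonelli_measurable : measurable_fun setT (fun w => \int[mu]_(t in D) f (t, w))%E.
Proof.
have -> : (fun w => \int[mu]_(t in D) f (t, w))%E = fubini_G mu F.
  apply/funext => w; rewrite integral_mkcond /fubini_G.
  by apply: eq_integral => t _; rewrite FE.
exact: measurable_fun_fubini_tonelli_G.
Qed.

Lemma tonelli_measurable_fst : measurable_fun setT (fun t => \int[P]_w f (t, w))%E.
Proof.
have : measurable_fun setT (fubini_F P f) by exact: measurable_fun_fubini_tonelli_F.
by [].
Qed.

Lemma tonelli_dom :
  (\int[P]_w \int[mu]_(t in D) f (t, w) = \int[mu]_(t in D) \int[P]_w f (t, w))%E.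
Proof.
transitivity (\int[P]_w \int[mu]_t F (t, w))%E.
  apply: eq_integral => w _; rewrite integral_mkcond.
  by apply: eq_integral => t _; rewrite FE.
rewrite -fubini_tonelli// [RHS]integral_mkcond; apply: eq_integral => t _.
rewrite patchE; case: ifPn => tD.
  by apply: eq_integral => w _; rewrite FE patchE tD.
by apply: integral0_eq => w _; rewrite FE patchE (negbTE tD).
Qed.

End tonelli_on_domain.

Section strong_law.
Context {R : realType} {d : measure_display} {Om : measurableType d}.
Variable P : probability Om R.
Local Notation MR := (measurableTypeR R).
Local Notation mu := (@lebesgue_measure R).
Variables (g : MR * Om -> R) (v : R -> R) (C k s2 : R).
Hypothesis mg : measurable_fun setT g.
Hypotheses (C0 : 0 <= C) (k0 : 0 < k).
Hypothesis g_var : forall t, 0 <= t -> (\int[P]_w (g (t, w) ^+ 2)%:E = (v t)%:E)%E.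
Hypothesis g_cov : forall s t, 0 <= s -> 0 <= t ->
  (\int[P]_w (g (s, w) ^+ 2 * g (t, w) ^+ 2)%:E <=
   (v s * v t + C * expR (- k * `|t - s|))%:E)%E.
Hypothesis v_cvg : forall t, 0 <= t -> `|v t - s2| <= C * expR (- k * t).
Local Notation D T := (`[0%R, T]%classic : set MR).

Let G (p : MR * Om) : \bar R := (g p ^+ 2)%:E.
Let mG : measurable_fun setT G.
Proof. by apply/measurable_EFinP; exact: measurable_funX. Qed.
Let G0 p : (0 <= G p)%E. Proof. by rewrite lee_fin sqr_ge0. Qed.

Let mG1 t : measurable_fun setT (fun w => G (t, w)).
Proof. exact: measurableT_comp mG (measurable_pair1 t). Qed.
Let mG2 w : measurable_fun setT (fun t => G (t, w)).
Proof. exact: measurableT_comp mG (measurable_pair2 w). Qed.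

Let K T w : \bar R := (\int[mu]_(t in D T) G (t, w))%E.

Let mDT T : measurable (D T). Proof. exact: measurable_itv. Qed.

Let mK T : measurable_fun setT (K T).
Proof. exact: tonelli_measurable. Qed.

Let K0 T w : (0 <= K T w)%E.
Proof. by apply: integral_ge0 => t _; exact: G0. Qed.

Let v0 t : 0 <= t -> 0 <= v t.
Proof. by move=> t0; rewrite -lee_fin -g_var//; apply: integral_ge0 => w _; exact: G0. Qed.

Let mv T : measurable_fun (D T) (EFin \o v).
Proof.
have h : measurable_fun setT (fun t : MR => \int[P]_w G (t, w))%E.
  exact: (tonelli_measurable_fst P mG G0).
apply: (eq_measurable_fun (fun t : MR => \int[P]_w G (t, w))%E).
  by move=> t; rewrite inE /= in_itv /= => /andP[t0 _]; rewrite g_var.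
exact: measurable_funTS.
Qed.

Let expk_int T : 0 <= T -> (\int[mu]_(t in D T) (expR (- k * t))%:E <= (1 / k)%:E)%E.
Proof.
move=> T0; have kn0 : k != 0 by rewrite gt_eqF.
have -> : (\int[mu]_(t in D T) (expR (- k * t))%:E = \int[mu]_(t in D T) (expR (- k * t + 0))%:E)%E.
  by apply: eq_integral => t _; rewrite addr0.
rewrite integral_expR_affine ?oppr_eq0// lee_fin mulr0 !addr0 expR0 invrN mulrN -mulNr opprB.
by rewrite ler_pM2r ?invr_gt0// lerBlDr lerDl expR_ge0.
Qed.

Let s2_bound t : 0 <= t -> v t <= `|s2| + C.
Proof.
move=> t0; have e1 : expR (- k * t) <= 1.
  by rewrite -expR0 ler_expR mulNr oppr_le0 mulr_ge0// ltW.
have := v_cvg t0; rewrite ler_distl => /andP[_ h]; rewrite (le_trans h)// lerD ?ler_norm//.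
by rewrite ler_piMr.
Qed.

Let iv T : mu.-integrable (D T) (EFin \o v).
Proof.
apply: measurable_bounded_integrable => //.
- by rewrite /= lebesgue_measure_itv /=; case: ifP => _; rewrite ?ltry.
- by apply/measurable_EFinP; exact: mv.
- exists (`|s2| + C); split; first exact: num_real.
  move=> x xC t /=; rewrite in_itv /= => /andP[t0 _].
  by rewrite ger0_norm ?v0// (le_trans (s2_bound t0))// ltW.
Qed.

Definition mean_energy T : R := fine (\int[mu]_(t in D T) (v t)%:E)%E.
Let m := mean_energy.

Let mE T : (\int[mu]_(t in D T) (v t)%:E = (m T)%:E)%E.
Proof. by rewrite /m /mean_energy fineK//; apply: integrable_fin_num (iv T). Qed.

Let m_ge0 T : 0 <= m T.
Proof.
rewrite -lee_fin -mE; apply: integral_ge0 => t /=; rewrite in_itv /= => /andP[t0 _].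
by rewrite lee_fin v0.
Qed.

(** [v - s2] is dominated by a function integrable on the half-line, so the mean of the time
    integral is [s2 T] up to a constant. *)
Let m_bound T : 0 <= T -> `|m T - s2 * T| <= C / k.
Proof.
move=> T0; have iT : mu (D T) = T%:E.
  by rewrite /= lebesgue_measure_itv /= lte_fin; case: ltP => h; [rewrite sube0|congr EFin; apply/le_anti; rewrite h T0].
have is2 : mu.-integrable (D T) (EFin \o (fun=> s2)).
  apply: measurable_bounded_integrable => //; first by rewrite [X in (X < _)%E]iT ltry.
  by exists `|s2|; split; [exact: num_real|move=> x xs t _; exact: ltW].
have -> : m T - s2 * T = \int[mu]_(t in D T) (v t - s2).
  rewrite RintegralB//; congr (_ - _).
  by rewrite Rintegral_cst//; congr (_ * _); rewrite [X in fine X]iT.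
have ivs : mu.-integrable (D T) (EFin \o (fun t => v t - s2)).
  exact: (integrableB (mDT T) (iv T) is2).
apply: (le_trans (le_normr_Rintegral _ ivs)) => //.
rewrite -lee_fin /Rintegral fineK; last first.
  by apply: (integrable_fin_num (mDT T)); exact: (integrable_abse ivs).
apply: (@le_trans _ _ (\int[mu]_(t in D T) (C%:E * (expR (- k * t))%:E))%E).
  apply: ge0_le_integral => //.
  - by apply/measurable_EFinP; apply: measurableT_comp => //; apply/measurable_EFinP; case/integrableP: ivs.
  - apply/measurable_EFinP; apply: measurable_funM => //.
    apply: (measurableT_comp (@measurable_expR R)); exact: measurable_funM.
  - by move=> t; rewrite /= in_itv /= => /andP[t0 _]; rewrite lee_fin v_cvg.
rewrite ge0_integralZl//; last first.
  apply/measurable_EFinP; apply: (measurableT_comp (@measurable_expR R)); exact: measurable_funM.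
by rewrite EFinM lee_wpmul2l// -[k^-1]mul1r; exact: expk_int.
Qed.

Let EK T : (\int[P]_w K T w = (m T)%:E)%E.
Proof.
rewrite /K tonelli_dom// -mE; apply: eq_integral => t; rewrite inE /= in_itv /= => /andP[t0 _].
exact: g_var.
Qed.

(** The square of the time integral is a double integral. Two uses of Tonelli bring the expectation
    inside, where [v s * v t] integrates to the squared mean and the exponential remainder
    contributes at most [2 C / k] for each [s]. *)
Let EK2 T : 0 <= T -> (\int[P]_w (K T w * K T w) <= (m T ^+ 2 + 2 * C / k * T)%:E)%E.
Proof.
move=> T0.
have KK w : (K T w * K T w = \int[mu]_(s in D T) (G (s, w) * K T w))%E.
  by rewrite ge0_integralZr//; exact: measurable_funTS.
under eq_integral do rewrite KK.
have mGK : measurable_fun setT (fun p : MR * Om => G p * K T p.2)%E.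
  apply: emeasurable_funM => //; exact: measurableT_comp (mK T) measurable_snd.
have GK0 (p : MR * Om) : (0 <= G p * K T p.2)%E by rewrite mule_ge0.
rewrite (tonelli_dom P (mDT T) mGK GK0) /=.
have inner s : D T s -> (\int[P]_w (G (s, w) * K T w) <= (v s * m T + 2 * C / k)%:E)%E.
  move=> Ds; have s0T : 0 <= s <= T by move: Ds; rewrite /= in_itv.
  have /andP[s0 sT] := s0T.
  have mGG : measurable_fun setT (fun p : MR * Om => G (s, p.2) * G p)%E.
    apply: emeasurable_funM => //; exact: measurableT_comp (mG1 s) measurable_snd.
  have GG0 (p : MR * Om) : (0 <= G (s, p.2) * G p)%E by rewrite mule_ge0.
  have -> : (\int[P]_w (G (s, w) * K T w) = \int[P]_w \int[mu]_(t in D T) (G (s, w) * G (t, w)))%E.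
    by apply: eq_integral => w _; rewrite ge0_integralZl//; exact: measurable_funTS.
  rewrite (tonelli_dom P (mDT T) mGG GG0) /=.
  have mexp : measurable_fun (D T) (fun t : MR => expR (- k * `|t - s|)).
    apply: (measurableT_comp (@measurable_expR R)).
    apply: measurable_funM => //; apply: measurableT_comp => //; exact: measurable_funB.
  have mvR : measurable_fun (D T) v by apply/measurable_EFinP; exact: mv.
  apply: (@le_trans _ _ (\int[mu]_(t in D T) ((v s)%:E * (v t)%:E + C%:E * (expR (- k * `|t - s|))%:E))%E).
    apply: ge0_le_integral => //.
    - by move=> t _; apply: integral_ge0 => w _; exact: (GG0 (t, w)).
    - apply: measurable_funTS; exact: (tonelli_measurable_fst P mGG GG0).
    - by apply/measurable_EFinP; apply: measurable_funD; exact: measurable_funM.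
    - move=> t /=; rewrite in_itv /= => /andP[t0 _].
      exact: g_cov.
  rewrite ge0_integralD//; last 4 first.
  - by move=> t /=; rewrite in_itv /= => /andP[t0 _]; rewrite mule_ge0// lee_fin v0.
  - by apply/measurable_EFinP; exact: measurable_funM.
  - by move=> t _; rewrite mule_ge0// lee_fin expR_ge0.
  - by apply/measurable_EFinP; exact: measurable_funM.
  rewrite ge0_integralZl//; last 2 first.
  - by move=> t /=; rewrite in_itv /= => /andP[t0 _]; rewrite lee_fin v0.
  - by rewrite lee_fin v0.
  rewrite ge0_integralZl//; last exact/measurable_EFinP.
  rewrite mE EFinD EFinM leeD2l// (_ : 2 * C / k = C * (2 / k)); last by ring.
  by rewrite EFinM lee_wpmul2l//; exact: integral_expR_dist.
apply: (@le_trans _ _ (\int[mu]_(s in D T) ((m T)%:E * (v s)%:E + (2 * C / k)%:E))%E).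
  apply: ge0_le_integral => //.
  - by move=> s _; apply: integral_ge0 => w _; exact: (GK0 (s, w)).
  - apply: measurable_funTS; exact: (tonelli_measurable_fst P mGK GK0).
  - by apply: emeasurable_funD => //; apply: emeasurable_funM => //; exact: mv.
  - by move=> s Ds; rewrite -EFinM -EFinD mulrC; exact: inner.
rewrite ge0_integralD//; last 3 first.
- by move=> s /=; rewrite in_itv /= => /andP[s0 _]; rewrite mule_ge0// lee_fin ?v0// m_ge0.
- by apply: emeasurable_funM => //; exact: mv.
- by move=> s _; rewrite lee_fin divr_ge0 ?mulr_ge0// ltW.
rewrite ge0_integralZl//; last 2 first.
- by move=> t /=; rewrite in_itv /= => /andP[t0 _]; rewrite lee_fin v0.
- by rewrite lee_fin m_ge0.
rewrite mE integral_cst// -EFinM -expr2 EFinD leeD2l// (EFinM (2 * C / k) T) lee_wpmul2l//.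
  by rewrite lee_fin divr_ge0 ?mulr_ge0// ltW.
by rewrite /= lebesgue_measure_itv /= lte_fin; case: ltP => h; rewrite ?sube0// lee_fin.
Qed.

Let T_ (n : nat) : R := n.+1%:R ^+ 2.
Let T_gt0 n : 0 < T_ n. Proof. by rewrite exprn_gt0. Qed.

(** [fine] turns an infinite integral into 0; by [K_lty] this happens on a null set only. *)
Let kr n w : R := fine (K (T_ n) w).

Let K_lty T : {ae P, forall w, K T w \is a fin_num}.
Proof.
have iK : P.-integrable setT (K T).
  apply/integrableP; split => //.
  rewrite (eq_integral (K T)) => [|w _]; last by rewrite gee0_abs.
  by rewrite EK ltry.
by apply: filterS (integrable_ae measurableT iK) => w; apply.
Qed.

Let mkr n : measurable_fun setT (kr n).
Proof. exact: measurableT_comp (mK (T_ n)). Qed.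

Let kr2 n : (\int[P]_w (kr n w ^+ 2)%:E <= (m (T_ n) ^+ 2 + 2 * C / k * T_ n)%:E)%E.
Proof.
rewrite (le_trans _ (EK2 (ltW (T_gt0 n))))//.
rewrite (ae_eq_integral (fun w => K (T_ n) w * K (T_ n) w)%E)//.
- by apply/measurable_EFinP; exact: measurable_funX.
- exact: emeasurable_funM.
- by apply: filterS (K_lty (T_ n)) => w h _; rewrite /kr expr2 EFinM fineK.
Qed.

Let kr1 n : (\int[P]_w (kr n w)%:E = (m (T_ n))%:E)%E.
Proof.
rewrite -EK; apply: ae_eq_integral => //; first exact/measurable_EFinP.
by apply: filterS (K_lty (T_ n)) => w h _; rewrite /kr fineK.
Qed.

Let kr_var n : (\int[P]_w ((kr n w / T_ n - m (T_ n) / T_ n) ^+ 2)%:E <=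
  (2 * C / k / T_ n)%:E)%E.
Proof.
have ik2 : P.-integrable setT (EFin \o (fun w => kr n w ^+ 2)).
  apply/integrableP; split; first by apply/measurable_EFinP; exact: measurable_funX.
  rewrite (eq_integral (fun w => (kr n w ^+ 2)%:E)) => [|w _].
    exact: le_lt_trans (kr2 n) (ltry _).
  by rewrite /= ger0_norm ?sqr_ge0.
have ik1 : P.-integrable setT (EFin \o kr n).
  apply/integrableP; split; first exact/measurable_EFinP.
  rewrite (eq_integral (fun w => (kr n w)%:E)) => [|w _]; first by rewrite kr1 ltry.
  by rewrite /= ger0_norm// fine_ge0.
have ic (c : R) : P.-integrable setT (EFin \o (fun=> c)).
  exact: finite_measure_integrable_cst.
set c := m (T_ n); set t := T_ n.
have t0 : 0 < t by exact: T_gt0.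
pose f1 w := t ^- 2 * kr n w ^+ 2.
pose f2 w := (- 2 * c * t ^- 2) * kr n w.
pose f3 (w : Om) := c ^+ 2 * t ^- 2.
have E w : (kr n w / t - c / t) ^+ 2 = f1 w + (f2 w + f3 w).
  by rewrite /f1 /f2 /f3; field; rewrite gt_eqF.
have i1 : P.-integrable setT (EFin \o f1) by exact: (integrableZl measurableT (t ^- 2) ik2).
have i2 : P.-integrable setT (EFin \o f2) by exact: (integrableZl measurableT (- 2 * c * t ^- 2) ik1).
have i3 : P.-integrable setT (EFin \o f3) by exact: ic.
have i23 : P.-integrable setT (EFin \o (fun w => f2 w + f3 w)) by exact: (integrableD measurableT i2 i3).
have i123 : P.-integrable setT (EFin \o (fun w => f1 w + (f2 w + f3 w))).
  exact: (integrableD measurableT i1 i23).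
under eq_integral do rewrite E.
rewrite -[leLHS]fineK; last exact: (integrable_fin_num measurableT i123).
rewrite lee_fin -[leLHS]/(\int[P]_w (f1 w + (f2 w + f3 w))).
rewrite RintegralD// RintegralD//.
have -> : \int[P]_w f3 w = c ^+ 2 * t ^- 2.
  by rewrite /Rintegral /f3 integral_cst//= probability_setT mule1.
have -> : \int[P]_w f2 w = - 2 * c * t ^- 2 * c.
  by rewrite /f2 RintegralZl//; congr (_ * _); rewrite /Rintegral kr1.
have -> : \int[P]_w f1 w = t ^- 2 * \int[P]_w (kr n w ^+ 2) by rewrite /f1 RintegralZl.
have h2 : \int[P]_w (kr n w ^+ 2) <= c ^+ 2 + 2 * C / k * t.
  rewrite -lee_fin /Rintegral fineK; first exact: kr2.
  exact: (integrable_fin_num measurableT ik2).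
have -> : 2 * C / k / t = t ^- 2 * (c ^+ 2 + 2 * C / k * t) + (- 2 * c * t ^- 2 * c + c ^+ 2 * t ^- 2).
  by field; rewrite !gt_eqF.
by rewrite lerD2r ler_wpM2l// invr_ge0 exprn_ge0// ltW.
Qed.

Let inv_sqr_series : (\sum_(n <oo) (2 * C / k / T_ n)%:E < +oo)%E.
Proof.
have A0 : 0 <= 2 * C / k by rewrite divr_ge0 ?mulr_ge0// ltW.
have F0 n : 0 <= 2 * C / k / T_ n by rewrite divr_ge0// ltW.
(* Telescoping comparison [1 / n^2 <= 2 (1 / n - 1 / (n + 1))] for [n >= 1]. *)
pose G_ n : R := 2 * (2 * C / k) * (1 - n.+1%:R^-1).
have part N : \sum_(0 <= n < N) 2 * C / k / T_ n <= G_ N.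
  elim: N => [|N IH]; first by rewrite big_geq// /G_ invr1 subrr mulr0.
  rewrite big_nat_recr//= (le_trans (lerD IH (lexx _)))//.
  have n1 : 0 < N.+1%:R :> R by rewrite ltr0n.
  have n2 : 0 < N.+2%:R :> R by rewrite ltr0n.
  rewrite /G_ /T_ -subr_ge0.
  have -> : 2 * (2 * C / k) * (1 - N.+2%:R^-1) - (2 * (2 * C / k) * (1 - N.+1%:R^-1) + 2 * C / k / N.+1%:R ^+ 2)
    = (2 * C / k) * (2 * (N.+1%:R^-1 - N.+2%:R^-1) - N.+1%:R ^- 2) by field; rewrite !gt_eqF.
  rewrite mulr_ge0// -(@natr1 R N.+1).
  have -> : 2 * (N.+1%:R^-1 - (N.+1%:R + 1)^-1) - N.+1%:R ^- 2 =
    (N.+1%:R - 1) / (N.+1%:R ^+ 2 * (N.+1%:R + 1)) :> R.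
    by field; rewrite !gt_eqF// addr_gt0.
  apply: divr_ge0; first by rewrite subr_ge0 ler1n.
  by apply: mulr_ge0; rewrite ?sqr_ge0// addr_ge0// ltW.
apply: (@le_lt_trans _ _ (2 * (2 * C / k))%:E); last exact: ltry.
apply: lime_le; first by apply: is_cvg_nneseries => n _ _; rewrite lee_fin.
near=> N; rewrite sumEFin lee_fin; apply: (le_trans (part N)); rewrite /G_.
apply: ler_piMr; first exact: mulr_ge0.
by rewrite lerBlDr lerDl invr_ge0.
Unshelve. all: by end_near.
Qed.

Let kr_cvg : {ae P, forall w, kr n w / T_ n @[n --> \oo] --> s2}.
Proof.
have mf n : measurable_fun setT (fun w => (kr n w / T_ n - m (T_ n) / T_ n) ^+ 2).
  by apply: measurable_funX; apply: measurable_funB => //; exact: measurable_funM.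
have fin : (\sum_(n <oo) \int[P]_w ((kr n w / T_ n - m (T_ n) / T_ n) ^+ 2)%:E < +oo)%E.
  apply: (le_lt_trans _ inv_sqr_series); apply: lee_nneseries => n _ *; last exact: kr_var.
  by apply: integral_ge0 => w _; rewrite lee_fin sqr_ge0.
have cT : (T_ n)^-1 @[n --> \oo] --> (0 : R).
  apply: (@squeeze_cvgr _ _ _ _ (fun=> 0) harmonic); last exact: cvg_harmonic.
  - near=> n; rewrite invr_ge0 ltW//= /harmonic lef_pV2 ?posrE// /T_ expr2.
    by rewrite ler_peMl// ler1n.
  - exact: cvg_cst.
have cm : m (T_ n) / T_ n @[n --> \oo] --> s2.
  apply: (@cvg_norm_le _ _ _ _ _ (fun n => C / k * (T_ n)^-1)); last exact: cvg0_mull.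
  near=> n; have t0 := T_gt0 n.
  have -> : m (T_ n) / T_ n - s2 = (m (T_ n) - s2 * T_ n) / T_ n by field; rewrite gt_eqF.
  rewrite normrM [`|_^-1|]ger0_norm ?invr_ge0 ?(ltW t0)// ler_wpM2r ?invr_ge0 ?(ltW t0)//.
  by rewrite m_bound// ltW.
apply: filterS (ae_cvg0_summable mf (fun n w => sqr_ge0 _) fin) => w cw.
have c0 : kr n w / T_ n - m (T_ n) / T_ n @[n --> \oo] --> (0 : R).
  apply: (@cvg_norm_le _ _ _ _ _ (fun n => Num.sqrt ((kr n w / T_ n - m (T_ n) / T_ n) ^+ 2))).
    by near=> n; rewrite subr0 sqrtr_sqr.
  by have := cvg_comp _ _ cw (@sqrt_continuous R 0); rewrite sqrtr0.
have -> : (fun n => kr n w / T_ n) = (fun n => kr n w / T_ n - m (T_ n) / T_ n + m (T_ n) / T_ n).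
  by apply/funext => n; rewrite subrK.
by rewrite -[X in _ --> X]add0r; exact: cvgD.
Unshelve. all: by end_near.
Qed.

(* The averages over [0, (n+1)^2] have variance O((n+1)^-2), which is summable;
   between these times the average is monotone up to a factor tending to 1. *)
Theorem strong_law : {ae P, forall w,
  (forall T, \int[mu]_(t in D T) (g (t, w) ^+ 2)%:E < +oo)%E /\
  T^-1 * (\int[mu]_(t in D T) (g (t, w) ^+ 2)) @[T --> +oo] --> s2}.
Proof.
have K_all : {ae P, forall w, forall n, K (T_ n) w \is a fin_num}.
  exact: (ae_foralln (fun n => K_lty (T_ n))).
apply: filterS2 K_all kr_cvg => w fK ck.
have Kmono (T T' : R) : T <= T' -> (K T w <= K T' w)%E.
  move=> TT; apply: ge0_subset_integral => //; first exact: measurable_funTS.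
  by move=> t; rewrite /= !in_itv /= => /andP[-> /le_trans ->].
have dom (T : R) : exists n, T <= T_ n.
  exists (Num.truncn T); rewrite /T_ expr2; have := Num.Theory.truncnS_gt T => h.
  by apply: (le_trans (ltW h)); apply: ler_peMl => //; rewrite ler1n.
have Klty T0 : (K T0 w < +oo)%E.
  have [n Tn] := dom T0; rewrite (le_lt_trans (Kmono _ _ Tn))// ltey_eq.
  by rewrite (fK n).
split => //.
have Kfin T : K T w \is a fin_num by rewrite ge0_fin_numE.
have fmono T T' : T <= T' -> fine (K T w) <= fine (K T' w).
  by move=> TT; rewrite fine_le// Kmono.
change (T^-1 * fine (K T w) @[T --> +oo] --> s2).
(* For [T >= 1], the largest [n] with [T_ n <= T]: the predecessor compensates for
   [T_ n = (n + 1)^2]. *)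
pose q (T : R) := (Num.truncn (Num.sqrt T)).-1.
have q_oo : q T @[T --> +oo] --> \oo.
  apply/cvgnyPge => A; near=> T.
  have TA : A.+1%:R ^+ 2 <= T by near: T; exact: nbhs_pinfty_ge.
  have sT : A.+1%:R <= Num.sqrt T.
    by rewrite -[leLHS]ger0_norm// -sqrtr_sqr ler_wsqrtr.
  have Aq : (A < Num.truncn (Num.sqrt T))%N by rewrite truncn_gt_nat.
  by rewrite /q -ltnS prednK// (leq_ltn_trans _ Aq).
have q_near : \forall T \near +oo, T_ (q T) <= T /\ T <= T_ (q T).+1.
  near=> T.
  have T1 : 1 <= T by near: T; exact: nbhs_pinfty_ge.
  have T0 : 0 <= T by exact: le_trans T1.
  have s1 : 1 <= Num.sqrt T by rewrite -sqrtr1 ler_wsqrtr.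
  have qE : (q T).+1 = Num.truncn (Num.sqrt T) by rewrite /q prednK// truncn_gt0.
  rewrite /T_ qE -[in leRHS](sqr_sqrtr T0) -[in X in _ /\ X <= _](sqr_sqrtr T0).
  rewrite !ler_pXn2r ?nnegrE//.
  by have /andP[-> /ltW ->] := truncn_itv (sqrtr_ge0 T).
pose r n := T_ n / T_ n.+1.
have r_cvg : r n @[n --> \oo] --> (1 : R).
  have h : (n.+1%:R / n.+2%:R : R) @[n --> \oo] --> (1 : R).
    have -> : (fun n => n.+1%:R / n.+2%:R : R) = (fun n => 1 - harmonic n.+1).
      apply/funext => n; rewrite /harmonic /=.
      have n0 : n.+2%:R != 0 :> R by rewrite pnatr_eq0.
      by apply: (mulIf n0); rewrite divfK// mulrBl mulVf// mul1r -[n.+2%:R]natr1 addrK.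
    rewrite -[X in _ --> X]subr0; apply: cvgB; first exact: cvg_cst.
    by rewrite (cvg_shiftS (@harmonic R : nat -> R)); exact: cvg_harmonic.
  have -> : r = (fun n => n.+1%:R / n.+2%:R * (n.+1%:R / n.+2%:R)).
    by apply/funext => n; rewrite /r /T_ -expr2 expr_div_n.
  by rewrite -[X in _ --> X]mulr1; exact: cvgM.
have r_gt0 n : 0 < r n by rewrite divr_gt0.
have lo : kr n w / T_ n * r n @[n --> \oo] --> s2.
  by rewrite -[X in _ --> X]mulr1; exact: cvgM.
have hi : kr n.+1 w / T_ n.+1 / r n @[n --> \oo] --> s2.
  rewrite -[X in _ --> X]divr1; apply: cvgM.
    by rewrite (cvg_shiftS (fun n => kr n w / T_ n)).
  by apply: cvgV => //; exact: oner_neq0.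
apply: (squeeze_cvgr _ (cvg_comp _ _ q_oo lo) (cvg_comp _ _ q_oo hi)).
near=> T.
have [qT Tq] : T_ (q T) <= T /\ T <= T_ (q T).+1 by near: T; exact: q_near.
have T0 : 0 < T by exact: lt_le_trans qT.
have t0 := T_gt0 (q T); have t1 := T_gt0 (q T).+1.
rewrite /= /r /kr; apply/andP; split.
  rewrite mulrA divfK ?gt_eqF// mulrC; apply: ler_pM; rewrite ?invr_ge0 ?fine_ge0 ?(ltW t1)//.
  - by rewrite lef_pV2 ?posrE.
  - exact: fmono.
rewrite invf_div mulrA divfK ?gt_eqF// [leRHS]mulrC; apply: ler_pM; rewrite ?invr_ge0 ?fine_ge0 ?(ltW T0)//.
- by rewrite lef_pV2 ?posrE.
- exact: fmono.
Unshelve. all: by end_near.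
Qed.

End strong_law.

(** * Wiener integrals in the energy space *)

Section integral_monotonicity.
Context {R : realType} {d : measure_display} {T : measurableType d}.
Variable mu : {measure set T -> \bar R}.

(* [g] need not be measurable: the integral of a nonnegative function is a
   supremum over the simple functions below it. *)
Lemma le_integral_ge0 (D : set T) (f g : T -> \bar R) :
  (forall x, D x -> (0 <= f x)%E) -> (forall x, D x -> (f x <= g x)%E) ->
  (\int[mu]_(x in D) f x <= \int[mu]_(x in D) g x)%E.
Proof.
move=> f0 fg; have g0 x : D x -> (0 <= g x)%E by move=> Dx; rewrite (le_trans (f0 x Dx))// fg.
rewrite !ge0_integralE//; apply: ereal_sup_le => _ [h hf <-]; exists h => // x.
rewrite (le_trans (hf x))// !patchE; case: ifPn => // xD.
by apply: fg; rewrite -in_setE.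
Qed.

(** [g] may fail to be measurable, so [c] is not pulled out of its integral; it is divided out of
    the measurable side instead, which leaves [c = 0] as a separate case. *)
Lemma integral_le_scale (D : set T) (f : T -> R) (g : T -> \bar R) (c : R) :
  measurable D -> measurable_fun D f -> 0 <= c ->
  (forall x, D x -> 0 <= f x) -> (forall x, D x -> (0 <= g x)%E) ->
  (forall x, D x -> ((f x)%:E <= c%:E * g x)%E) ->
  (\int[mu]_(x in D) (f x)%:E <= c%:E * \int[mu]_(x in D) g x)%E.
Proof.
move=> mD mf; rewrite le_eqVlt => /orP[/eqP <-|c0] f0 g0 fg.
  rewrite mul0e integral0_eq// => x Dx; apply/le_anti/andP; split.
    by rewrite (le_trans (fg x Dx))// mul0e.
  by rewrite lee_fin f0.
have -> : (\int[mu]_(x in D) (f x)%:E = c%:E * \int[mu]_(x in D) (c^-1 * f x)%:E)%E.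
  under [in RHS]eq_integral do rewrite EFinM.
  rewrite ge0_integralZl//; [|exact/measurable_EFinP|by rewrite lee_fin invr_ge0 ltW].
  by rewrite muleA -EFinM mulfV ?gt_eqF// mul1e.
apply: lee_wpmul2l; first by rewrite lee_fin ltW.
apply: le_integral_ge0 => x Dx; first by rewrite lee_fin mulr_ge0 ?f0// invr_ge0 ltW.
rewrite EFinM -[leRHS]mul1e -(mulVf (lt0r_neq0 c0)) EFinM -muleA.
by apply: lee_wpmul2l; rewrite ?fg// lee_fin invr_ge0 ltW.
Qed.

End integral_monotonicity.

Section measurable_pairing.
Context {R : realType} {E : lmodType R} {V : set E} {ipE : E -> E -> R}.
Hypothesis sipE : semi_inner_product V ipE.

(** Measurability in [V] is stated for norm-open sets; open half-spaces bring it to real pairings.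
    By Cauchy-Schwarz a ball of the chosen radius stays in the half-space, the [+ 1] covering an [x]
    of norm 0. *)
Lemma norm_open_halfspace x c : V x -> norm_open V ipE [set y | V y /\ c < ipE y x].
Proof.
move=> Vx; split=> [y []//|y [Vy cy]].
have s0 : 0 < snorm ipE x + 1 by rewrite ltr_wpDl// snorm_ge0.
exists ((ipE y x - c) / (snorm ipE x + 1)); first by rewrite divr_gt0// subr_gt0.
move=> u Vu; rewrite ltr_pdivlMr// => h; split => //.
have := sip_le_snorm sipE (sipVB sipE Vu Vy) Vx; rewrite (sipBl sipE)// ler_norml => /andP[h1 _].
have := @snorm_ge0 _ _ ipE (u - y); lra.
Qed.

Lemma random_vector_pairing {d : measure_display} {Om : measurableType d}
    (I : Om -> E) x : random_vector V ipE I -> V x ->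
  measurable_fun setT (fun w => ipE (I w) x).
Proof.
move=> [VI mI] Vx; apply: (measurability _ (RGenOInfty.measurableE R)) => //; move=> _ [_ [c ->] <-].
rewrite setTI; have := mI _ (norm_open_halfspace c Vx).
by congr measurable; apply/seteqP; split=> w /=; rewrite in_itv /= andbT; [case|move=> h; split].
Qed.

Lemma measurable_process_pairing {d : measure_display} {Om : measurableType d}
    (X : R -> Om -> E) x : measurable_process V ipE X -> V x ->
  measurable_fun setT (fun p : measurableTypeR R * Om =>
    if 0 <= p.1 then ipE (X p.1 p.2) x else 0).
Proof.
move=> [VX mX] Vx.
have mD : measurable [set p : measurableTypeR R * Om | 0 <= p.1].
  have -> : [set p : measurableTypeR R * Om | 0 <= p.1] = fst @^-1` `[0, +oo[.
    by apply/seteqP; split=> p /=; rewrite in_itv /= andbT.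
  by rewrite -[X in measurable X]setTI; apply: measurable_fst => //; exact: measurable_itv.
have -> : [set: measurableTypeR R * Om] = [set p | 0 <= p.1] `|` ~` [set p | 0 <= p.1].
  by rewrite setUv.
apply/measurable_funU => //; [exact: measurableC|split].
- apply: (@eq_measurable_fun _ _ _ _ _ (fun p : measurableTypeR R * Om => ipE (X p.1 p.2) x)).
    by move=> p; rewrite inE /= => ->.
  apply: (measurability _ (RGenOInfty.measurableE R)) => //; move=> _ [_ [c ->] <-].
  have := mX _ (norm_open_halfspace c Vx); congr measurable.
  apply/seteqP; split=> p /=; rewrite in_itv /= andbT => -[h1 h2]; split => //.
    by case: h2.
  by split => //; exact: VX.
- apply: (eq_measurable_fun (cst (0 : R))) => [p|]; last exact: measurable_cst.
  by rewrite inE /= => /negP/negbTE ->.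
Qed.

End measurable_pairing.

Section wiener_projection.
Context {R : realType} {d : measure_display} {Om : measurableType d}.
Variable P : probability Om R.
Context {H : lmodType R} {ip : H -> H -> R}.
Hypothesis sipH : semi_inner_product setT ip.
Variable e : nat -> H.
Hypothesis e_basis : complete_orthonormal (ip := ip) e.
Variable W : R -> H -> Om -> R.
Hypothesis cbm : cylindrical_BM P ip W.
Context {E : lmodType R} {V : set E} {ipE : E -> E -> R}.
Hypothesis sipE : semi_inner_product V ipE.
Local Notation mu := (@lebesgue_measure R).
Local Notation ipP := (fun X Y : Om -> R => \int[P]_w (X w * Y w)).
Implicit Types F : seq (@elementary R E H).

(** Pairing with [x] turns an integrand with values in [V] into a scalar one, to which the results
    on [step_sum] apply. *)
Definition project F (x : E) : seq (R * R * H * R) :=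
  [seq (c.1.1.1, c.1.1.2, c.1.2, ipE c.2 x) | c <- F].

Lemma project_within M t F x : t <= M -> (forall c, c \in F -> elementary_on V t c) ->
  steps_within M (project F x).
Proof.
move=> tM hF q /mapP[c /hF]; case: c => [[[s r] h] v] [s0 sr rt _] ->.
by split => //=; exact: le_trans tM.
Qed.

Let elV t F c : (forall c, c \in F -> elementary_on V t c) -> c \in F -> V c.2.
Proof. by move=> hF /hF; case: c => [[[s r] h] v] []. Qed.

Lemma step_integralV t F w : (forall c, c \in F -> elementary_on V t c) ->
  V (step_integral W F w).
Proof.
move=> hF; rewrite /step_integral big_seq; apply: (sipV_sum sipE) => -[[[s r] h] v] cF.
by apply: (sipVZ sipE); exact: (elV hF cF).
Qed.

Lemma step_opV t F u k : (forall c, c \in F -> elementary_on V t c) ->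
  V (step_op ip F u k).
Proof.
move=> hF; rewrite /step_op big_seq; apply: (sipV_sum sipE) => -[[[s r] h] v] cF.
case: ifP => _; last exact: (sip0 sipE).
by apply: (sipVZ sipE); exact: (elV hF cF).
Qed.

Lemma step_integral_pairing t F x w : (forall c, c \in F -> elementary_on V t c) -> V x ->
  ipE (step_integral W F w) x = step_sum W (project F x) w.
Proof.
move=> hF Vx; rewrite /step_integral big_seq (sip_suml sipE)//; last first.
  by move=> [[[s r] h] v] cF; apply: (sipVZ sipE); exact: (elV hF cF).
rewrite /step_sum big_map [RHS]big_seq; apply: eq_bigr => -[[[s r] h] v] cF /=.
by rewrite (sipZl sipE) 1?mulrC//; exact: (elV hF cF).
Qed.

Lemma step_op_pairing t F x u k : (forall c, c \in F -> elementary_on V t c) -> V x ->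
  ipE (step_op ip F u k) x = ip k (step_kernel (project F x) u).
Proof.
move=> hF Vx; rewrite /step_op big_seq (sip_suml sipE)//; last first.
  move=> [[[s r] h] v] cF; case: ifP => _; last exact: (sip0 sipE).
  by apply: (sipVZ sipE); exact: (elV hF cF).
rewrite /step_kernel (sip_sumr sipH)// big_map [RHS]big_seq; apply: eq_bigr => -[[[s r] h] v] cF.
rewrite /step_term /= (sipZr sipH)//; case: ifP => _.
  by rewrite (sipZl sipE) ?mulr1n ?mul1r 1?mulrC//; exact: (elV hF cF).
by rewrite (sip0l sipE)// mulr0n !mul0r.
Qed.

Lemma step_kernel_project_after t F x u : (forall c, c \in F -> elementary_on V t c) ->
  t < u -> step_kernel (project F x) u = 0.
Proof.
move=> hF tu; rewrite /step_kernel big_map big_seq; apply: big1 => -[[[s r] h] v] /hF[_ _ rt _].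
by rewrite /step_term /= [u <= r]leNgt (le_lt_trans rt tu) andbF mulr0n mul0r scale0r.
Qed.

Section kernel.
Variables (t M : R) (Psi : R -> H -> E) (x : E) (p : R -> H) (F : nat -> seq (@elementary R E H)).
Hypotheses (tM : t <= M) (Vx : V x).
Hypothesis PsiV : forall u h, 0 <= u <= t -> V (Psi u h).
Hypothesis p_space : time_space (ip := ip) e M p.
Hypothesis pE : forall u n, 0 <= u <= t -> ip (e n) (p u) = ipE (Psi u (e n)) x.
Hypothesis p_after : forall u, t < u -> p u = 0.
Hypothesis Ft : forall k c, c \in F k -> elementary_on V t c.
Hypothesis F_cvg : (\int[mu]_(u in `[0%R, t]%classic)
   HS_sqnorm ipE e (fun h => (Psi u h - step_op ip (F k) u h)%R))%E @[k --> \oo] --> 0%E.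

Let q k u := step_kernel (project (F k) x) u - p u.

(** [q k u] represents, up to sign, the functional that pairs [Psi u - step_op] with [x]. Parseval
    sums the squares of its values at the [e n], and Cauchy-Schwarz bounds each by the squared norm
    of [x] times a Hilbert-Schmidt term. *)
Let q_HS k u : 0 <= u <= t -> ((ip (q k u) (q k u))%:E <=
  (ipE x x)%:E * HS_sqnorm ipE e (fun h => (Psi u h - step_op ip (F k) u h)%R))%E.
Proof.
move=> ut; have x0 := sip_ge0 sipE Vx.
have VD h : V (Psi u h - step_op ip (F k) u h).
  by apply: (sipVB sipE); [exact: PsiV|apply: step_opV => c; exact: Ft].
have D0 n := sip_ge0 sipE (VD (e n)).
rewrite -nneseriesZl// => [|n _]; last by rewrite lee_fin.
have c : series (fun n => ip (q k u) (e n) * ip (q k u) (e n)) @ \oo --> ip (q k u) (q k u).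
  exact: (parseval sipH e_basis).
rewrite -[X in X%:E](cvg_lim (@Rhausdorff R) c).
rewrite -EFin_lim; last by apply/cvg_ex; exists (ip (q k u) (q k u)).
have -> : EFin \o series (fun n => ip (q k u) (e n) * ip (q k u) (e n)) =
  eseries (fun n => (ip (q k u) (e n) * ip (q k u) (e n))%:E).
  by apply/funext => n; rewrite /series /eseries /= sumEFin.
apply: lee_nneseries => n _ *; first by rewrite lee_fin -expr2 sqr_ge0.
rewrite -EFinM lee_fin -expr2 mulrC.
have -> : ip (q k u) (e n) = - ipE (Psi u (e n) - step_op ip (F k) u (e n)) x.
  rewrite (sipC sipH)// /q (sipBr sipH)// pE// (sipBl sipE)//; last 2 first.
  - exact: PsiV.
  - by apply: step_opV => c'; exact: Ft.
  by rewrite (step_op_pairing _ _ (@Ft k)) // opprB.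
by rewrite sqrrN; exact: (sip_cauchy_schwarz sipE).
Qed.

(** Both kernels vanish after [t], so the distance over [[0, M]] is one over [[0, t]], where [q_HS]
    integrates to the Hilbert-Schmidt distance in the definition of the integral. A larger [M] lets
    integrals up to different times share one space. *)
Lemma project_kernel_cvg : snorm (time_ip (ip := ip) M) (step_kernel (project (F k) x) - p)
  @[k --> \oo] --> (0 : R).
Proof.
have ksip := time_sip sipH e_basis M.
have Vq k : time_space (ip := ip) e M (step_kernel (project (F k) x) - p).
  by apply: (sipVB ksip) => //; exact: step_kernel_space.
apply: (cvg_snorm0 ksip) => //.
have x0 := sip_ge0 sipE Vx.
have bound k : ((time_ip (ip := ip) M (q k) (q k))%:E <=
  (ipE x x)%:E * \int[mu]_(u in `[0%R, t]%classic)
   HS_sqnorm ipE e (fun h => (Psi u h - step_op ip (F k) u h)%R))%E.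
  have iq : mu.-integrable `[0%R, M] (EFin \o (fun u => ip (q k u) (q k u))).
    exact: (time_space_integrable sipH e_basis (Vq k) (Vq k)).
  rewrite /time_ip /Rintegral fineK; last exact: (integrable_fin_num _ iq).
  have -> : (\int[mu]_(u in `[0%R, M]) (ip (q k u) (q k u))%:E =
     \int[mu]_(u in `[0%R, t]) (ip (q k u) (q k u))%:E)%E.
    rewrite integral_mkcond [RHS]integral_mkcond; apply: eq_integral => u _.
    rewrite !patchE !mem_setE !in_itv /=; have [u0|] := leP 0 u; rewrite //=.
    have [ut|tu] := leP u t; first by rewrite (le_trans ut).
    by case: ifP => // _; rewrite /q p_after// (step_kernel_project_after _ (@Ft k))// subr0 (sip0l sipH).
  apply: integral_le_scale => //.
  - have /integrableP[/measurable_EFinP + _] := iq.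
    by apply: measurable_funS => // u /=; rewrite !in_itv /= => /andP[-> /le_trans ->].
  - by move=> u _; exact: (sip_ge0 sipH).
  - move=> u; rewrite /= in_itv /= => ut; apply: nneseries_ge0 => n _ _.
    by rewrite lee_fin (sip_ge0 sipE)//; apply: (sipVB sipE); [exact: PsiV|apply: step_opV => c; exact: Ft].
  - by move=> u; rewrite /= in_itv /=; exact: q_HS.
have c0 : ((ipE x x)%:E * \int[mu]_(u in `[0%R, t]%classic)
   HS_sqnorm ipE e (fun h => (Psi u h - step_op ip (F k) u h)%R))%E @[k --> \oo] --> 0%E.
  by rewrite -[X in _ --> X](mule0 (ipE x x)%:E); apply: cvgeZl.
have : (time_ip (ip := ip) M (q k) (q k))%:E @[k --> \oo] --> 0%E.
  apply: (squeeze_cvge _ (cvg_cst 0%E) c0); near=> k.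
  by rewrite bound andbT lee_fin; exact: (sip_ge0 ksip (Vq k)).
by move=> /fine_cvg.
Unshelve. all: by end_near.
Qed.

End kernel.

Let psip := square_integrable_sip P.

(** Each elementary integrand contributes the norm of its vector times the mean-square norm of its
    Brownian increment. *)
Lemma step_sum_project_bounded t F : (forall c, c \in F -> elementary_on V t c) ->
  exists2 C : R, 0 <= C & forall x, V x ->
    snorm ipP (step_sum W (project F x)) <= C * snorm ipE x.
Proof.
elim: F => [|[[[s r] h] v] F IH] Ft.
  exists 0 => // x _; rewrite mul0r.
  have -> : step_sum W (project [::] x) = 0 by apply/funext => w; rewrite /step_sum big_nil.
  by rewrite (snorm0 psip).
have [|C C0 hC] := IH; first by move=> c cF; apply: Ft; rewrite inE cF orbT.
have [s0 sr rt Vv] := Ft _ (mem_head _ _).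
pose D := step_sum W [:: (s, r, h, 1)].
have D2 : square_integrable P D.
  apply: (step_sum_square_integrable sipH e_basis cbm (M := t)) => q.
  by rewrite inE => /eqP ->; split.
exists (snorm ipE v * snorm ipP D + C) => [|x Vx].
  by rewrite addr_ge0// mulr_ge0// snorm_ge0.
have F2 : square_integrable P (step_sum W (project F x)).
  apply: (step_sum_square_integrable sipH e_basis cbm (M := t)).
  by apply: project_within (lexx t) _ => c cF; apply: Ft; rewrite inE cF orbT.
have -> : step_sum W (project ((s, r, h, v) :: F) x) = ipE v x *: D + step_sum W (project F x).
  apply/funext => w; rewrite /step_sum /= big_cons.
  rewrite -[RHS]/(ipE v x * D w + step_sum W (project F x) w).
  by have -> : D w = W r h w - W s h w by rewrite /D /step_sum big_seq1 /= mul1r.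
apply: (le_trans (snormD psip (sipVZ psip _ D2) F2)).
rewrite mulrDl lerD//; last exact: hC.
rewrite (snormZ psip)// mulrAC ler_wpM2r ?snorm_ge0//.
exact: (sip_le_snorm sipE).
Qed.

Section limit.
Variables (t : R) (I : Om -> E) (F : nat -> seq (@elementary R E H)).
Hypothesis rvI : random_vector V ipE I.
Hypothesis Ft : forall k c, c \in F k -> elementary_on V t c.
Hypothesis I_cvg : (\int[P]_w (ipE (I w - step_integral W (F k) w)%R
  (I w - step_integral W (F k) w)%R)%:E)%E @[k --> \oo] --> 0%E.

Let X x w := ipE (I w) x.
Let D k x : Om -> R := step_sum W (project (F k) x) - X x.

Let S2 k x : square_integrable P (step_sum W (project (F k) x)).
Proof.
apply: (step_sum_square_integrable sipH e_basis cbm (M := t)).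
by apply: project_within (lexx t) _; exact: Ft.
Qed.

Let VD k w : V (I w - step_integral W (F k) w).
Proof. by apply: (sipVB sipE); [case: rvI|exact: (step_integralV _ (@Ft k))]. Qed.

Let mD k x : V x -> measurable_fun setT (D k x).
Proof.
by move=> Vx; apply: measurable_funB; [case: (S2 k x)|exact: (random_vector_pairing sipE rvI)].
Qed.

Let D_le k x : V x -> (\int[P]_w (D k x w ^+ 2)%:E <=
  (ipE x x)%:E * \int[P]_w (ipE (I w - step_integral W (F k) w)%R
  (I w - step_integral W (F k) w)%R)%:E)%E.
Proof.
move=> Vx; apply: integral_le_scale => //.
- by apply: measurable_funX; exact: mD.
- exact: (sip_ge0 sipE).
- by move=> w _; exact: sqr_ge0.
- by move=> w _; rewrite lee_fin; exact: (sip_ge0 sipE).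
- move=> w _; rewrite -EFinM lee_fin mulrC.
  have -> : D k x w = - ipE (I w - step_integral W (F k) w) x.
    rewrite (sipBl sipE)//; [|by case: rvI|exact: (step_integralV _ (@Ft k))].
    by rewrite opprB (step_integral_pairing _ (@Ft k)).
  by rewrite sqrrN; exact: (sip_cauchy_schwarz sipE).
Qed.

(** The distances may be infinite for small [k]; one index with distance at most 1 makes every
    pairing square integrable, with a bound linear in the norm of [x]. *)
Let near_finite : exists k, (\int[P]_w (ipE (I w - step_integral W (F k) w)%R
  (I w - step_integral W (F k) w)%R)%:E <= 1)%E.
Proof.
have /fine_cvgP[fin /cvgrPdist_le/(_ 1 ltr01) c] := I_cvg.
have [N _ hN] := filterI fin c; exists N; have [finN] := hN N (leqnn N).
rewrite sub0r normrN => h; rewrite -(fineK finN) lee_fin.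
exact: le_trans (ler_norm _) h.
Qed.

Let D2 : exists k, forall x, V x -> square_integrable P (D k x) /\
  snorm ipP (D k x) <= snorm ipE x.
Proof.
have [k hk] := near_finite; exists k => x Vx.
have x0 := sip_ge0 sipE Vx.
have le : (\int[P]_w (D k x w ^+ 2)%:E <= (ipE x x)%:E)%E.
  by rewrite (le_trans (D_le k Vx))// -[leRHS]mule1 lee_wpmul2l.
have i2 : P.-integrable setT (EFin \o (fun w => D k x w ^+ 2)).
  apply/integrableP; split; first by apply/measurable_EFinP/measurable_funX; exact: mD.
  rewrite (eq_integral (fun w => (D k x w ^+ 2)%:E)) => [|w _].
    exact: le_lt_trans le (ltry _).
  by rewrite /= ger0_norm ?sqr_ge0.
split; first by split; [exact: mD|].
rewrite /snorm ler_wsqrtr// -lee_fin /Rintegral.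
under eq_integral do rewrite -expr2.
by rewrite fineK//; exact: (integrable_fin_num measurableT i2).
Qed.

Lemma pairing_square_integrable x : V x -> square_integrable P (X x).
Proof.
move=> Vx; have [k hk] := D2; have [Dk _] := hk x Vx.
have -> : X x = step_sum W (project (F k) x) - D k x by rewrite /D opprB addrC subrK.
exact: (sipVB psip).
Qed.

(* Makes the pairing with [x] continuous in [x], without measurability of [snorm (I w)]. *)
Lemma pairing_bounded : exists2 C : R, 0 <= C & forall x, V x ->
  snorm ipP (X x) <= C * snorm ipE x.
Proof.
have [k hk] := D2; have [C C0 hC] := step_sum_project_bounded (@Ft k).
exists (C + 1) => [|x Vx]; first by rewrite addr_ge0.
have VX := pairing_square_integrable Vx.
apply: (le_trans (snorm_le_dist psip VX (S2 k x))).
rewrite mulrDl mul1r lerD//; first exact: hC.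
rewrite (snorm_distC psip)//.
by have [_] := hk x Vx.
Qed.

Lemma pairing_step_limit M x : t <= M -> V x ->
  step_limit P W M (fun k => project (F k) x) (X x).
Proof.
move=> tM Vx; have VX := pairing_square_integrable Vx; split => // [k|].
  by apply: project_within tM _; exact: Ft.
have VDk k : square_integrable P (D k x) by exact: (sipVB psip).
apply: (cvg_snorm0 psip VDk).
have c0 : ((ipE x x)%:E * \int[P]_w (ipE (I w - step_integral W (F k) w)%R
  (I w - step_integral W (F k) w)%R)%:E)%E @[k --> \oo] --> 0%E.
  by rewrite -[X in _ --> X](mule0 (ipE x x)%:E); apply: cvgeZl.
have : (\int[P]_w (D k x w ^+ 2)%:E)%E @[k --> \oo] --> 0%E.
  apply: (squeeze_cvge _ (cvg_cst 0%E) c0); near=> k.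
  by rewrite D_le// andbT; apply: integral_ge0 => w _; rewrite lee_fin sqr_ge0.
move=> /fine_cvg; rewrite (_ : fine \o _ = fun k => \int[P]_w (D k x w * D k x w))//.
Unshelve. all: by end_near.
Qed.

End limit.

End wiener_projection.

(** * Covariance of the noise *)

Section wave_noise.
Context {R : realType} {d : measure_display} {Om : measurableType d}.
Variable P : probability Om R.
Context {H : lmodType R} {ip : H -> H -> R}.
Hypothesis sipH : semi_inner_product setT ip.
Variable e : nat -> H.
Hypothesis e_basis : complete_orthonormal (ip := ip) e.
Variables (al : nat -> R) (al0 : R).
Hypotheses (al0_gt0 : 0 < al0) (al_ge : forall n, al0 <= al n).
Variables A A12 : H -> H.
Local Notation dom_A12 := (diagonal_dom (ip := ip) e al).
Local Notation dom_A := (diagonal_dom (ip := ip) e (fun n => al n ^+ 2)).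
Hypothesis hA : diagonal_op (ip := ip) e dom_A (fun n => - al n) A.
Hypothesis hA12 : diagonal_op (ip := ip) e dom_A12 (fun n => Num.sqrt (al n)) A12.
Local Notation V := (energy_space (ip := ip) e al).
Local Notation ipv := (energy_ip (ip := ip) A12).
Variables a b : R.
Hypotheses (a_gt0 : 0 < a) (b_gt0 : 0 < b).
Variable S : R -> (H * H)%type -> (H * H)%type.
Hypothesis semiS : C0_semigroup V ipv S.
Hypothesis genS : generated_by V ipv S (wave_dom (ip := ip) e al) (wave_generator A a b).
Variable W : R -> H -> Om -> R.
Hypothesis cbm : cylindrical_BM P ip W.
Variables Phi1 Phi1s : H -> H.
Hypothesis Phi1_adj : forall x y, ip (Phi1 x) y = ip x (Phi1s y).
Variables (lam : nat -> R) (lam_max : R).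
Hypotheses (lam_ge0 : forall k, 0 <= lam k) (lam_le : forall k, lam k <= lam_max).
Hypothesis Phi1s_eigen : forall j k, ip (Phi1s (e j)) (Phi1s (e k)) = (j == k)%:R * lam j.
Variable I : R -> Om -> (H * H)%type.
Hypothesis hI : forall t, 0 <= t ->
  wiener_integral P V ipv ip e W t (fun u h => S (t - u) (0, Phi1 h)) (I t).
Variable z : (H * H)%type.
Hypothesis Vz : V z.
Local Notation mu := (@lebesgue_measure R).
Local Notation ipP := (fun X Y : Om -> R => \int[P]_w (X w * Y w)).
Local Notation response := (response (ip := ip) e al S z).
Local Notation mode_energy := (mode_energy (ip := ip) e al z).
Local Notation mode_variance := (mode_variance (ip := ip) e al a b z).

Let al_gt0 n : 0 < al n. Proof. exact: lt_le_trans (al_ge n). Qed.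
Let sipV : semi_inner_product V ipv := ipV_sip sipH e_basis al_gt0 hA12.
Let psip := square_integrable_sip P.
Let energy_ge0 k : 0 <= mode_energy k.
Proof. exact: mode_energy_ge0 al0_gt0 al_ge _ _. Qed.

(** The time-reversed response cut off to [[0, t]], so that integrands for different final times
    live on one interval. *)
Let rk k t : R -> R := (fun u => response k (t - u)) \_ `[0%R, t]%classic.

Let rkE k t u : rk k t u = if 0 <= u <= t then response k (t - u) else 0.
Proof. by rewrite /rk patchE mem_setE in_itv. Qed.

Let measurable_rk k t : measurable_fun setT (rk k t).
Proof.
apply/(measurable_restrictT _ (measurable_itv `[0%R, t])).
have [t0|t0] := leP 0 t; last first.
  have -> : `[0%R, t]%classic = set0.
    by apply/seteqP; split=> u //=; rewrite in_itv /= => /andP[/le_trans h /h]; rewrite leNgt t0.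
  exact: measurable_fun_set0.
have t1 : 0 < t + 1 by rewrite ltr_wpDl.
have mr : measurable_fun `[0, t + 1] (response k).
  apply: subspace_continuous_measurable_fun => //.
  exact: (@continuous_response _ _ _ sipH _ e_basis _ _ al0_gt0 al_ge _ _ hA hA12 _ _ _ semiS genS).
apply: (measurable_comp (F := `[0, t + 1]%classic)) mr _ => //.
  move=> _ [u /= + <-]; rewrite !in_itv /= => /andP[u0 ut].
  by apply/andP; split; lra.
by apply: measurable_funTS; exact: measurable_funB.
Qed.

(* The vector representing [k |-> <S (t - u) (0, Phi1 k), truncation N z>]; only
   truncations of [z] are used, since H is not assumed to be complete. *)
Definition noise_kernel N t (u : R) : H := \sum_(k < N) rk k t u *: Phi1s (e k).

Let rk_decay : exists K w : R, [/\ 0 < K, 0 < w & forall k t u,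
  rk k t u ^+ 2 <= (0 <= u <= t)%R%:R * (K * expR (- w * (t - u)) * mode_energy k)].
Proof.
have [K [w [K0 w0 h]]] := response_decay sipH e_basis al0_gt0 al_ge hA hA12 a_gt0 b_gt0 semiS genS.
exists K, w; split => // k t u; rewrite rkE.
case: ifP => [/andP[u0 ut]|_]; last by rewrite expr0n mulr0n mul0r.
by rewrite mulr1n mul1r; apply: h; rewrite subr_ge0.
Qed.

Let rk_bounded k t : exists C : R, forall u, `|rk k t u| <= C.
Proof.
have [K [w [K0 w0 h]]] := rk_decay.
exists (Num.sqrt (K * mode_energy k)) => u.
rewrite -sqrtr_sqr ler_wsqrtr// (le_trans (h k t u))//.
have B0 : 0 <= K * mode_energy k by rewrite mulr_ge0// ltW.
have [/andP[u0 ut]|_] := boolP (0 <= u <= t); last by rewrite mulr0n mul0r.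
rewrite mulr1n mul1r mulrAC ler_piMr// -expR0 ler_expR mulNr oppr_le0 mulr_ge0//.
  exact: ltW.
by rewrite subr_ge0.
Qed.

Let rk_space M k t : time_space (ip := ip) e M (fun u => rk k t u *: Phi1s (e k)).
Proof.
apply: (time_spaceZ sipH); first exact: measurable_funTS.
by have [C hC] := rk_bounded k t; exists C => u _.
Qed.

Let kernelE N t : noise_kernel N t = \sum_(k < N) (fun u => rk k t u *: Phi1s (e k)).
Proof. by apply/funext => u; rewrite /noise_kernel fct_sumE. Qed.

Let kernel_space M N t : time_space (ip := ip) e M (noise_kernel N t).
Proof.
by rewrite kernelE; apply: (sipV_sum (time_sip sipH e_basis M)) => k _; exact: rk_space.
Qed.

Let kernel_after N t u : t < u -> noise_kernel N t u = 0.
Proof.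
move=> tu; apply: big1 => k _; rewrite rkE [u <= t]leNgt tu andbF.
by rewrite scale0r.
Qed.

Let kernel_pairing N t u n : 0 <= u <= t ->
  ip (e n) (noise_kernel N t u) = ipv (S (t - u) (0, Phi1 (e n))) (truncation (ip := ip) e N z).
Proof.
move=> ut; have tu : 0 <= t - u by rewrite subr_ge0; case/andP: ut.
rewrite (ipV_noise sipH e_basis al0_gt0 al_ge hA hA12 a_gt0 b_gt0 semiS genS)//.
rewrite (sip_sumr sipH)//; apply: eq_bigr => k _.
by rewrite (sipZr sipH)// rkE ut -Phi1_adj mulrC.
Qed.

(** The covariance at times [s] and [t] of the noise in mode [k] at unit intensity; past the smaller
    time one factor is 0. *)
Definition mode_cov k s t : R := \int[mu]_(u in `[0%R, Num.max s t]) (rk k s u * rk k t u).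

Let rk_integrable M k s t : mu.-integrable `[0%R, M] (EFin \o (fun u => rk k s u * rk k t u)).
Proof.
have [C hC] := rk_bounded k s; have [C' hC'] := rk_bounded k t.
apply: measurable_bounded_integrable => //.
- by rewrite /= lebesgue_measure_itv /=; case: ifP => _; rewrite ?ltry.
- by apply: measurable_funTS; apply: measurable_funM; exact: measurable_rk.
exists (C * C'); split; first exact: num_real.
by move=> x xC u _ /=; rewrite normrM (le_trans _ (ltW xC))// ler_pM.
Qed.

Let kernel_cov N s t :
  time_ip (ip := ip) (Num.max s t) (noise_kernel N s) (noise_kernel N t) =
  \sum_(k < N) lam k * mode_cov k s t.
Proof.
set M := Num.max s t; have ksip := time_sip sipH e_basis M.
rewrite !kernelE (sip_suml ksip) => [|k _|]; last 2 first.
- exact: rk_space.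
- by rewrite -kernelE; exact: kernel_space.
apply: eq_bigr => j _; rewrite (sip_sumr ksip) => [|k _|]; [|exact: rk_space|exact: rk_space].
rewrite (bigD1 j)//= big1 ?addr0 => [|k kj].
  rewrite (time_ipZ sipH) Phi1s_eigen eqxx mul1r; under eq_Rintegral do rewrite mulrC.
  by rewrite RintegralZl.
rewrite (time_ipZ sipH) Phi1s_eigen eq_sym (inj_eq val_inj) (negbTE kj).
under eq_Rintegral do rewrite mulr0n mul0r mulr0.
by rewrite /Rintegral integral0.
Qed.

Definition noise_coord (t : R) (w : Om) : R := ipv (I t w) z.

(** The same elementary integrands are projected on the truncation and on [z]; the explicit kernel
    belongs to the truncation. *)
Lemma noise_step_limit N t M : 0 <= t -> t <= M -> exists F,
  [/\ step_limit P W M (F (truncation (ip := ip) e N z)) (fun w => ipv (I t w) (truncation (ip := ip) e N z)),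
    step_limit P W M (F z) (noise_coord t) &
    snorm (time_ip (ip := ip) M) (step_kernel (F (truncation (ip := ip) e N z) k) - noise_kernel N t)
      @[k --> \oo] --> (0 : R)].
Proof.
move=> t0 tM; have [rvI [F [Ft F_cvg I_cvg]]] := hI t0.
have VN : V (truncation (ip := ip) e N z) by exact: truncationV.
exists (fun x k => project (ipE := ipv) (F k) x); split.
- exact: (pairing_step_limit sipH e_basis cbm sipV rvI Ft I_cvg tM VN).
- exact: (pairing_step_limit sipH e_basis cbm sipV rvI Ft I_cvg tM Vz).
- apply: (project_kernel_cvg sipH e_basis sipV tM VN _ _ _ _ Ft F_cvg).
  + move=> u h /andP[u0 ut]; apply: (semigroupV semiS); first by rewrite subr_ge0.
    exact: dom_A12_0.
  + exact: kernel_space.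
  + exact: kernel_pairing.
  + exact: kernel_after.
Qed.

Let cov_truncation N s t : 0 <= s -> 0 <= t ->
  \int[P]_w (ipv (I s w) (truncation (ip := ip) e N z) * ipv (I t w) (truncation (ip := ip) e N z)) =
  \sum_(k < N) lam k * mode_cov k s t.
Proof.
move=> s0 t0; pose M := Num.max s t.
have sM : s <= M by rewrite le_max lexx.
have tM : t <= M by rewrite le_max lexx orbT.
have [F [hF _ cF]] := noise_step_limit N s0 sM; have [F' [hF' _ cF']] := noise_step_limit N t0 tM.
rewrite -kernel_cov.
exact: (step_limit_covariance sipH e_basis cbm hF hF' (kernel_space _ _ _) (kernel_space _ _ _) cF cF').
Qed.

(** [pairing_bounded] makes pairing with [I t] continuous from [V] to mean square, and truncations
    of [z] converge in [V]. *)
Let coord_cvg t : 0 <= t -> (forall N, square_integrable P (fun w => ipv (I t w) (truncation (ip := ip) e N z))) /\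
  snorm ipP ((fun w => ipv (I t w) (truncation (ip := ip) e N z)) - noise_coord t) @[N --> \oo] --> (0 : R).
Proof.
move=> t0; have [rvI [F [Ft F_cvg I_cvg]]] := hI t0.
have VN N : V (truncation (ip := ip) e N z) by exact: truncationV.
split=> [N|]; first exact: (pairing_square_integrable sipH e_basis cbm sipV rvI Ft I_cvg (VN N)).
have [C C0 hC] := pairing_bounded sipH e_basis cbm sipV rvI Ft I_cvg.
have E N : (fun w => ipv (I t w) (truncation (ip := ip) e N z)) - noise_coord t =
  (fun w => ipv (I t w) (truncation (ip := ip) e N z - z)).
  by apply/funext => w; rewrite [RHS](sipBr sipV)//; case: rvI.
apply: (@squeeze_cvgr _ _ _ _ (fun=> 0) (fun N => C * snorm ipv (truncation (ip := ip) e N z - z))).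
- near=> N; rewrite snorm_ge0 /= E hC//; exact: (sipVB sipV).
- exact: cvg_cst.
- exact: cvg0_mull (truncation_cvg sipH e_basis al_gt0 hA12 Vz).
Unshelve. all: by end_near.
Qed.

Lemma noise_square_integrable t : 0 <= t -> square_integrable P (noise_coord t).
Proof. by move=> t0; have [F [_ [_ h _] _]] := noise_step_limit 0 t0 (lexx t). Qed.

Lemma noise_cov_cvg s t : 0 <= s -> 0 <= t ->
  \sum_(k < N) lam k * mode_cov k s t @[N --> \oo] -->
  \int[P]_w (noise_coord s w * noise_coord t w).
Proof.
move=> s0 t0; have [V1 c1] := coord_cvg s0; have [V2 c2] := coord_cvg t0.
have := cvg_ip psip V1 V2 (noise_square_integrable s0) (noise_square_integrable t0) c1 c2.
rewrite (_ : (fun N => _) = (fun N => \sum_(k < N) lam k * mode_cov k s t)) => [h|]; first exact: h.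
by apply/funext => N; exact: cov_truncation.
Qed.

Lemma noise_isserlis s t : 0 <= s -> 0 <= t ->
  (\int[P]_w (noise_coord s w ^+ 2 * noise_coord t w ^+ 2)%:E <=
   (ipP (noise_coord s) (noise_coord s) * ipP (noise_coord t) (noise_coord t) +
    2 * ipP (noise_coord s) (noise_coord t) ^+ 2)%:E)%E.
Proof.
move=> s0 t0; pose M := Num.max s t.
have sM : s <= M by rewrite le_max lexx.
have tM : t <= M by rewrite le_max lexx orbT.
(* The truncation index 0 is arbitrary: only the part about [z] is kept. *)
have [F [_ hF _]] := noise_step_limit 0 s0 sM; have [F' [_ hF' _]] := noise_step_limit 0 t0 tM.
exact: (step_limit_isserlis sipH e_basis cbm hF hF').
Qed.

(** Makes the mode-by-mode bounds summable, uniformly in the number of modes. *)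
Let energy_sum N : \sum_(k < N) lam k * mode_energy k <= lam_max * ipv z z.
Proof.
apply: (@le_trans _ _ (lam_max * series mode_energy N)).
  rewrite /series /= big_mkord mulr_sumr; apply: ler_sum => k _.
  by rewrite ler_wpM2r.
rewrite ler_wpM2l ?(le_trans (lam_ge0 0))//.
have c : series mode_energy @ \oo --> ipv z z.
  exact: (cvg_mode_energy sipH e_basis al0_gt0 al_ge hA12 Vz).
have nd : nondecreasing_seq (series mode_energy).
  by apply/nondecreasing_seqP => n; rewrite -subr_ge0 seriesSB.
rewrite -(cvg_lim (@Rhausdorff R) c); apply: nondecreasing_cvgn_le => //.
by apply/cvg_ex; exists (ipv z z).
Qed.

Lemma mode_cov_decay : exists K w : R, [/\ 0 < K, 0 < w & forall k s t, 0 <= s -> 0 <= t ->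
  `|mode_cov k s t| <= K * expR (- w * `|t - s|) * mode_energy k].
Proof.
have [K [w [K0 w0 h]]] := rk_decay.
(* For [u <= s <= t] the product is at most [K * mode_energy k * expR (- w (s - u) / 2 - w (t - u) /
   2)]; integrating the exponential over [[0, s]] gives at most [expR (- (w / 2) (t - s)) / w]. *)
exists (K / w), (w / 2); split; rewrite ?divr_gt0//.
suff main k s t : 0 <= s -> s <= t ->
    `|mode_cov k s t| <= K / w * expR (- (w / 2) * (t - s)) * mode_energy k.
  move=> k s t s0 t0; have [st|ts] := leP s t.
    by rewrite [`|t - s|]ger0_norm ?subr_ge0//; exact: main.
  rewrite distrC [`|s - t|]ger0_norm; last by rewrite subr_ge0 ltW.
  have -> : mode_cov k s t = mode_cov k t s.
    by rewrite /mode_cov maxC; apply: eq_Rintegral => u _; rewrite mulrC.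
  by apply: main => //; exact: ltW.
move=> s0 st; rewrite /mode_cov (max_r st).
have B0 : 0 <= K * mode_energy k by rewrite mulr_ge0// ltW.
apply: (le_trans (le_normr_Rintegral _ (rk_integrable t k s t))) => //.
have pointwise u : 0 <= u <= t -> `|rk k s u * rk k t u| <=
    (\1_(`[0%R, s]%classic) u) * (K * mode_energy k * expR (w * u + - w * (s + t) / 2)).
  move=> ut; rewrite indicE mem_setE in_itv /=.
  have [/andP[u0 us]|us] := boolP (0 <= u <= s); last first.
    by rewrite [rk k s u]rkE (negbTE us) !mul0r normr0.
  rewrite mul1r -sqrtr_sqr; set B := K * mode_energy k in B0 *.
  have e0 := expR_ge0 (w * u + - w * (s + t) / 2).
  rewrite -[leRHS](ger0_norm (mulr_ge0 B0 e0)) -[leRHS]sqrtr_sqr ler_wsqrtr// exprMn.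
  have h1 := h k s u; have h2 := h k t u.
  rewrite us u0 mul1r in h1; rewrite ut mul1r in h2.
  apply: (le_trans (ler_pM (sqr_ge0 _) (sqr_ge0 _) h1 h2)).
  rewrite exprMn -expRM_natl le_eqVlt; apply/orP; left; apply/eqP.
  have -> : 2%:R * (w * u + - w * (s + t) / 2) = - w * (s - u) + - w * (t - u) by field.
  by rewrite expRD /B; ring.
have mi : measurable_fun `[0%R, t] (fun u => (\1_(`[0%R, s]%classic) u) *
    (K * mode_energy k * expR (w * u + - w * (s + t) / 2)) : R).
  apply: measurable_funM; first by apply: measurable_indic.
  by apply: measurable_funM => //; exact: measurable_expR_affine.
rewrite -lee_fin /Rintegral fineK; last first.
  by apply: integrable_fin_num (integrable_abse (rk_integrable t k s t)).
apply: (@le_trans _ _ (\int[mu]_(u in `[0%R, t]) ((\1_(`[0%R, s]%classic) u) *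
    (K * mode_energy k * expR (w * u + - w * (s + t) / 2)))%:E)%E).
  apply: le_integral_ge0 => u //=; rewrite in_itv /= => ut.
  by rewrite lee_fin; exact: pointwise.
have -> : (\int[mu]_(u in `[0%R, t]) ((\1_(`[0%R, s]%classic) u) *
    (K * mode_energy k * expR (w * u + - w * (s + t) / 2)))%:E =
   \int[mu]_(u in `[0%R, s]) ((K * mode_energy k)%:E * (expR (w * u + - w * (s + t) / 2))%:E))%E.
  rewrite integral_mkcond [RHS]integral_mkcond; apply: eq_integral => u _.
  rewrite !patchE indicE !mem_setE !in_itv /=.
  have [/andP[u0 us]|us] := boolP (0 <= u <= s); last by case: ifP => _ //; rewrite mul0r.
  by rewrite u0 (le_trans us st) /= mul1r -EFinM.
rewrite ge0_integralZl//; last by apply/measurable_EFinP; exact: measurable_expR_affine.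
rewrite integral_expR_affine ?gt_eqF// -EFinM lee_fin.
have -> : w * s + - w * (s + t) / 2 = - (w / 2) * (t - s) by field.
rewrite [leRHS](_ : _ = K * mode_energy k * (expR (- (w / 2) * (t - s)) / w)); last by ring.
by rewrite ler_wpM2l// ler_wpM2r ?invr_ge0 ?(ltW w0)// lerBlDr lerDl expR_ge0.
Qed.

Lemma mode_cov_diag : exists K w : R, [/\ 0 < K, 0 < w & forall k t, 0 <= t ->
  `|mode_cov k t t - mode_variance k| <= K * expR (- w * t) * mode_energy k].
Proof.
have [K [w [K0 w0 h]]] := integral_response_sqr sipH e_basis al0_gt0 al_ge hA hA12 a_gt0 b_gt0 semiS genS.
exists K, w; split => // k t t0.
have [r hr rv] := h z k t t0.
suff -> : mode_cov k t t = r by [].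
rewrite /mode_cov maxxx /Rintegral.
have -> : (\int[mu]_(u in `[0%R, t]) (rk k t u * rk k t u)%:E =
    \int[mu]_(u in `[0%R, t]) (response k (t - u) ^+ 2)%:E)%E.
  by apply: eq_integral => u; rewrite inE /= in_itv /= => ut; rewrite rkE ut.
rewrite -[RHS]/(fine r%:E) -hr; congr fine.
have [->|t_gt0] : t = 0 \/ 0 < t by move: t0; rewrite le_eqVlt => /orP[/eqP <-|]; [left|right].
  by rewrite set_itv1 !integral_set1.
(* Reversing time turns the stochastic convolution at time [t] into the integral of the squared
   response over [[0, t]]. *)
pose F (u : R) := t - u.
have cF : continuous F by move=> u; apply: cvgB; [exact: cvg_cst|exact: cvg_id].
have dF : derive1 F = cst (-1).
  apply/funext => u; rewrite derive1E /F.
  by rewrite deriveB// derive_cst derive_id sub0r.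
have := @integration_by_substitution_decreasing R F (fun u => response k u ^+ 2) 0 t t0.
rewrite dF /F subrr subr0 => -> //.
- by apply: eq_integral => u _ /=; rewrite /F /= !fctE opprK mulr1.
- by move=> x y _ _ xy; rewrite /F ltrD2l ltrN2.
- by move=> x _; exact: cvg_cst.
- exact: is_cvg_cst.
- exact: is_cvg_cst.
- split; first by move=> x _; exact: derivableB.
  + apply: cvg_at_right_filter; exact: cF.
  + apply: cvg_at_left_filter; exact: cF.
- move=> u; apply: (@continuous_comp _ _ _ (response k : subspace _ -> R) (fun x => x ^+ 2)).
    exact: (@continuous_response _ _ _ sipH _ e_basis _ _ al0_gt0 al_ge _ _ hA hA12 _ _ _ semiS genS).
  exact: exprn_continuous.
Qed.

Lemma noise_cov_decay : exists C w : R, [/\ 0 <= C, 0 < w & forall s t, 0 <= s -> 0 <= t ->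
  `|\int[P]_w (noise_coord s w * noise_coord t w)| <= C * expR (- w * `|t - s|)].
Proof.
have [K [w [K0 w0 h]]] := mode_cov_decay.
have C0 : 0 <= lam_max * ipv z z.
  by apply: mulr_ge0 (sip_ge0 sipV Vz); exact: le_trans (lam_ge0 0) (lam_le 0).
exists (K * (lam_max * ipv z z)), w; split => //; first by rewrite mulr_ge0// ltW.
move=> s t s0 t0; apply: (ler_cvg_to (cvg_norm (noise_cov_cvg s0 t0)) (cvg_cst _)); near=> N.
apply: (le_trans (ler_norm_sum _ _ _)).
apply: (@le_trans _ _ (K * expR (- w * `|t - s|) * \sum_(k < N) lam k * mode_energy k)).
  rewrite mulr_sumr; apply: ler_sum => k _; rewrite normrM ger0_norm// mulrCA.
  by rewrite ler_wpM2l// h.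
rewrite mulrAC; apply: ler_wpM2r; first exact: expR_ge0.
by apply: ler_wpM2l; [exact: ltW|exact: energy_sum].
Unshelve. all: by end_near.
Qed.

Lemma noise_var_cvg (s2 : R) : series (fun k => lam k * mode_variance k) @ \oo --> s2 ->
  exists C w : R, [/\ 0 <= C, 0 < w & forall t, 0 <= t ->
  `|\int[P]_w (noise_coord t w * noise_coord t w) - s2| <= C * expR (- w * t)].
Proof.
move=> cs; have [K [w [K0 w0 h]]] := mode_cov_diag.
have C0 : 0 <= lam_max * ipv z z.
  by apply: mulr_ge0 (sip_ge0 sipV Vz); exact: le_trans (lam_ge0 0) (lam_le 0).
exists (K * (lam_max * ipv z z)), w; split => //; first by rewrite mulr_ge0// ltW.
move=> t t0; apply: (ler_cvg_to (cvg_norm (cvgB (noise_cov_cvg t0 t0) cs)) (cvg_cst _)); near=> N.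
rewrite -[X in `|X|]/(\sum_(k < N) lam k * mode_cov k t t - series (fun k => lam k * mode_variance k) N).
rewrite /series /= big_mkord -sumrB.
apply: (le_trans (ler_norm_sum _ _ _)).
apply: (@le_trans _ _ (K * expR (- w * t) * \sum_(k < N) lam k * mode_energy k)).
  rewrite mulr_sumr; apply: ler_sum => k _; rewrite -mulrBr normrM ger0_norm// mulrCA.
  by rewrite ler_wpM2l// h.
rewrite mulrAC; apply: ler_wpM2r; first exact: expR_ge0.
by apply: ler_wpM2l; [exact: ltW|exact: energy_sum].
Unshelve. all: by end_near.
Qed.

End wave_noise.

(** * Time averages *)

Section time_average.
Context {R : realType}.
Local Notation MR := (measurableTypeR R).
Local Notation mu := (@lebesgue_measure R).
Local Notation D T := (`[0%R, T]%classic : set MR).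
Local Notation ipmu := (fun f g : MR -> R => \int[mu]_t (f t * g t)).

Let patch_integral (f : MR -> R) T :
  (\int[mu]_t (((f \_ (D T)) t) ^+ 2)%:E = \int[mu]_(t in D T) (f t ^+ 2)%:E)%E.
Proof.
rewrite [RHS]integral_mkcond; apply: eq_integral => t _.
by rewrite !patchE; case: ifP => // _; rewrite expr0n.
Qed.

Let patch_square_integrable (f : MR -> R) T : measurable_fun setT f ->
  (\int[mu]_(t in D T) (f t ^+ 2)%:E < +oo)%E -> square_integrable mu (f \_ (D T)).
Proof.
move=> mf fin; have mp : measurable_fun setT (f \_ (D T)).
  apply/(measurable_restrictT f (measurable_itv `[0%R, T])); exact: measurable_funTS.
split => //; apply/integrableP; split; first by apply/measurable_EFinP; exact: measurable_funX.
rewrite (eq_integral (fun t => (((f \_ (D T)) t) ^+ 2)%:E)) => [|t _].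
  by rewrite patch_integral.
by rewrite /= ger0_norm ?sqr_ge0.
Qed.

Let patch_sqr (f : MR -> R) T :
  ipmu (f \_ (D T)) (f \_ (D T)) = \int[mu]_(t in D T) (f t ^+ 2).
Proof. by rewrite /Rintegral -patch_integral. Qed.

(* Minkowski's inequality in L^2(0, T): [m] has a bounded L^2(0, T) norm. *)
Lemma time_average_perturb (g m : MR -> R) (s2 B w : R) :
  measurable_fun setT g -> measurable_fun setT m -> 0 < w ->
  (forall t, 0 <= t -> m t ^+ 2 <= B * expR (- w * t)) ->
  (forall T, \int[mu]_(t in D T) (g t ^+ 2)%:E < +oo)%E ->
  T^-1 * (\int[mu]_(t in D T) (g t ^+ 2)) @[T --> +oo] --> s2 ->
  T^-1 * (\int[mu]_(t in D T) ((g t + m t) ^+ 2)) @[T --> +oo] --> s2.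
Proof.
move=> mg mm w0 mB gfin gs; have sip := square_integrable_sip mu.
have B0 : 0 <= B by have := mB 0 (lexx 0); rewrite mulr0 expR0 mulr1; apply: le_trans; exact: sqr_ge0.
have m_int T : 0 <= T -> (\int[mu]_(t in D T) (m t ^+ 2)%:E <= (B / w)%:E)%E.
  move=> T0; apply: (@le_trans _ _ (\int[mu]_(t in D T) (B%:E * (expR (- w * t + 0))%:E))%E).
    apply: le_integral_ge0 => t; rewrite /= in_itv /= => /andP[t0 _]; first by rewrite lee_fin sqr_ge0.
    by rewrite lee_fin addr0; exact: mB.
  rewrite ge0_integralZl//; last by apply/measurable_EFinP; exact: measurable_expR_affine.
  rewrite integral_expR_affine ?oppr_eq0 ?gt_eqF// -EFinM lee_fin ler_wpM2l//.
  rewrite mulr0 !addr0 expR0 invrN mulrN -mulNr opprB -[leRHS]mul1r.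
  by rewrite ler_wpM2r ?invr_ge0 ?(ltW w0)// lerBlDr lerDl expR_ge0.
pose n (f : MR -> R) T := snorm ipmu (f \_ (D T)).
have Vg T : square_integrable mu (g \_ (D T)) by exact: patch_square_integrable.
have Vm T : 0 <= T -> square_integrable mu (m \_ (D T)).
  by move=> T0; apply: patch_square_integrable => //; exact: le_lt_trans (m_int T T0) (ltry _).
pose gm t := g t + m t.
have gmE T : gm \_ (D T) = g \_ (D T) + m \_ (D T).
  by apply/funext => t; rewrite /gm fctE !patchE; case: ifP => _; rewrite ?addr0.
have Vgm T : 0 <= T -> square_integrable mu (gm \_ (D T)).
  by move=> T0; rewrite gmE; exact: (sipVD sip (Vg T) (Vm T T0)).
have nm T : 0 <= T -> n m T <= Num.sqrt (B / w).
  move=> T0; rewrite /n /snorm ler_wsqrtr// patch_sqr -lee_fin /Rintegral fineK ?m_int//.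
  rewrite ge0_fin_numE ?(le_lt_trans (m_int T T0)) ?ltry//.
  by apply: integral_ge0 => t _; rewrite lee_fin sqr_ge0.
have dist T : 0 <= T -> `|n gm T - n g T| <= Num.sqrt (B / w).
  move=> T0; apply: (le_trans (dist_snorm sip (Vgm T T0) (Vg T))).
  by rewrite gmE addrAC subrr add0r; exact: nm.
(* [q T * n f T] is the root of the time average of [f^2]; perturbing [g] by [m] moves it by
   [O(q T)]. *)
pose q (T : R) := Num.sqrt T^-1.
have invT : T^-1 @[T --> +oo] --> (0 : R).
  apply/(gtr0_cvgV0 (f := id)); last exact: cvg_id.
  by near=> T; near: T; exact: nbhs_pinfty_gt.
have q0 : q T @[T --> +oo] --> (0 : R).
  by have := cvg_comp _ _ invT (@sqrt_continuous R 0); rewrite sqrtr0.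
have cd : q T * (n gm T - n g T) @[T --> +oo] --> (0 : R).
  apply: (@cvg_norm_le _ _ _ _ _ (fun T => Num.sqrt (B / w) * q T)); last exact: cvg0_mull.
  near=> T; have T0 : 0 <= T by near: T; exact: nbhs_pinfty_ge.
  by rewrite subr0 normrM mulrC [`|q T|]ger0_norm ?sqrtr_ge0// ler_wpM2r ?sqrtr_ge0// dist.
have qsqr T f : 0 <= T -> square_integrable mu (f \_ (D T)) ->
    (q T * n f T) ^+ 2 = T^-1 * \int[mu]_(t in D T) (f t ^+ 2).
  by move=> T0 Vf; rewrite exprMn sqr_sqrtr ?invr_ge0// (sqr_snorm sip Vf) patch_sqr.
have cg : q T * n g T @[T --> +oo] --> Num.sqrt s2.
  apply: cvg_trans (cvg_comp _ _ gs (@sqrt_continuous R s2)); apply: near_eq_cvg; near=> T.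
  have T0 : 0 <= T by near: T; exact: nbhs_pinfty_ge.
  by rewrite /= -(qsqr T g)// sqrtr_sqr ger0_norm// mulr_ge0 ?sqrtr_ge0.
(* Passing from roots to squares: [x^2 - y^2 = (x - y) ((x - y) + 2 y)]. *)
have c2 : q T * (n gm T - n g T) * (q T * (n gm T - n g T) + 2 * (q T * n g T)) @[T --> +oo] --> (0 : R).
  rewrite -[X in _ --> X](mul0r (0 + 2 * Num.sqrt s2)); apply: cvgM => //.
  by apply: cvgD => //; apply: cvgM => //; exact: cvg_cst.
rewrite -[s2]add0r; apply: cvg_trans (cvgD c2 gs); apply: near_eq_cvg; near=> T.
have T0 : 0 <= T by near: T; exact: nbhs_pinfty_ge.
have h1 := qsqr T gm T0 (Vgm T T0); have h2 := qsqr T g T0 (Vg T).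
transitivity (q T * (n gm T - n g T) * (q T * (n gm T - n g T) + 2 * (q T * n g T)) + (q T * n g T) ^+ 2).
  by rewrite h2.
by rewrite -h1; ring.
Unshelve. all: by end_near.
Qed.

End time_average.

Section half_line_measurability.
Context {R : realType}.

Lemma measurable_half_line (f : R -> R) :
  (forall t, 0 < t -> {within `[0, t], continuous f}) ->
  measurable_fun setT (f \_ `[0%R, +oo[%classic).
Proof.
move=> cf; apply/(measurable_restrictT f (measurable_itv `[0%R, +oo[)).
have -> : `[0%R, +oo[%classic = \bigcup_n `[0%R, n.+1%:R]%classic :> set R.
  apply/seteqP; split=> t /=.
    rewrite in_itv /= andbT => t0; exists (Num.truncn t) => //=.
    by rewrite in_itv /= t0 ltW// Num.Theory.truncnS_gt.
  by move=> [n _]; rewrite /= !in_itv /= => /andP[->].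
apply/measurable_fun_bigcup => // n.
by apply: subspace_continuous_measurable_fun => //; exact: cf.
Qed.

End half_line_measurability.

Section wave_ergodicity.
Context {R : realType} {d : measure_display} {Om : measurableType d}.
Variable P : probability Om R.
Context {H : lmodType R} {ip : H -> H -> R}.
Hypothesis sipH : semi_inner_product setT ip.
Variable e : nat -> H.
Hypothesis e_basis : complete_orthonormal (ip := ip) e.
Variables (al : nat -> R) (al0 : R).
Hypotheses (al0_gt0 : 0 < al0) (al_ge : forall n, al0 <= al n).
Variables A A12 : H -> H.
Local Notation dom_A12 := (diagonal_dom (ip := ip) e al).
Local Notation dom_A := (diagonal_dom (ip := ip) e (fun n => al n ^+ 2)).
Hypothesis hA : diagonal_op (ip := ip) e dom_A (fun n => - al n) A.
Hypothesis hA12 : diagonal_op (ip := ip) e dom_A12 (fun n => Num.sqrt (al n)) A12.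
Local Notation V := (energy_space (ip := ip) e al).
Local Notation ipv := (energy_ip (ip := ip) A12).
Variables a b : R.
Hypotheses (a_gt0 : 0 < a) (b_gt0 : 0 < b).
Variable S : R -> (H * H)%type -> (H * H)%type.
Hypothesis semiS : C0_semigroup V ipv S.
Hypothesis genS : generated_by V ipv S (wave_dom (ip := ip) e al) (wave_generator A a b).
Variable W : R -> H -> Om -> R.
Hypothesis cbm : cylindrical_BM P ip W.
Variables Phi1 Phi1s : H -> H.
Hypothesis Phi1_adj : forall x y, ip (Phi1 x) y = ip x (Phi1s y).
Variables (lam : nat -> R) (lam_max : R).
Hypotheses (lam_ge0 : forall k, 0 <= lam k) (lam_le : forall k, lam k <= lam_max).
Hypothesis Phi1s_eigen : forall j k, ip (Phi1s (e j)) (Phi1s (e k)) = (j == k)%:R * lam j.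
Variable x0 : Om -> (H * H)%type.
Hypothesis x0_V : random_vector V ipv x0.
Variable X : R -> Om -> (H * H)%type.
Hypothesis X_mild : mild_solution P V ipv ip e W S (fun h => (0, Phi1 h)) x0 X.
Variable z : (H * H)%type.
Hypothesis Vz : V z.
Local Notation mu := (@lebesgue_measure R).
Local Notation MR := (measurableTypeR R).
Local Notation ipP := (fun X Y : Om -> R => \int[P]_w (X w * Y w)).
Local Notation response := (response (ip := ip) e al S z).
Local Notation initial_response := (initial_response (ip := ip) e al S z).
Local Notation mode_variance := (mode_variance (ip := ip) e al a b z).

Let al_gt0 n : 0 < al n. Proof. exact: lt_le_trans (al_ge n). Qed.
Let sipV : semi_inner_product V ipv := ipV_sip sipH e_basis al_gt0 hA12.

(** The value 0 at negative times makes [Y] and [M] functions on the whole product, the form in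
    which the strong law takes its process. *)
Let Y (p : MR * Om) : R := if 0 <= p.1 then ipv (X p.1 p.2) z else 0.
Let M (p : MR * Om) : R := if 0 <= p.1 then ipv (S p.1 (x0 p.2)) z else 0.

Let mY : measurable_fun setT Y.
Proof. by case: X_mild => h _; exact: (measurable_process_pairing sipV h Vz). Qed.

Let measurable_coef k : measurable_fun setT (fun w => ip (x0 w).1 (e k)) /\
  measurable_fun setT (fun w => ip (x0 w).2 (e k)).
Proof.
have V1 c1 c2 : V (c1 *: e k, c2 *: e k) by exact: V_basis.
have m c1 c2 := random_vector_pairing sipV x0_V (V1 c1 c2).
split.
  apply: (eq_measurable_fun (fun w => ipv (x0 w) ((al k)^-1 *: e k, 0 *: e k))) (m _ _).
  by move=> w _; rewrite -(coef1E sipH e_basis al0_gt0 al_ge hA12)//; case: x0_V.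
apply: (eq_measurable_fun (fun w => ipv (x0 w) (0 *: e k, 1 *: e k))) (m _ _).
by move=> w _; rewrite -(coef2E sipH e_basis al0_gt0 al_ge hA12)//; case: x0_V.
Qed.

(** [S t (x0 w)] comes without joint measurability; its pairing with [z] is a limit of finite sums
    of products of a measurable function of [w] and one of [t]. *)
Let mM : measurable_fun setT M.
Proof.
pose u k : R -> R := initial_response k \_ `[0%R, +oo[%classic.
pose v k : R -> R := response k \_ `[0%R, +oo[%classic.
have mu_ k : measurable_fun setT (u k).
  apply: measurable_half_line => t.
  exact: (@continuous_initial_response _ _ _ sipH _ e_basis _ _ al0_gt0 al_ge _ _ hA hA12 _ _ a_gt0 b_gt0 _ semiS genS).
have mv k : measurable_fun setT (v k).
  apply: measurable_half_line => t.
  exact: (@continuous_response _ _ _ sipH _ e_basis _ _ al0_gt0 al_ge _ _ hA hA12 _ _ _ semiS genS).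
apply: (@measurable_fun_cvg _ _ _ setT (fun N (p : MR * Om) =>
  series (fun k => ip (x0 p.2).1 (e k) * u k p.1 + ip (x0 p.2).2 (e k) * v k p.1) N)) => [N|[t w] _].
  rewrite /series /=; apply: measurable_sum => k; have [m1 m2] := measurable_coef k.
  apply: measurable_funD; apply: measurable_funM.
  - exact: measurableT_comp m1 measurable_snd.
  - exact: measurableT_comp (mu_ k) measurable_fst.
  - exact: measurableT_comp m2 measurable_snd.
  - exact: measurableT_comp (mv k) measurable_fst.
rewrite /M /=; have [t0|t0] := leP 0 t; last first.
  have -> : series (fun k => ip (x0 w).1 (e k) * u k t + ip (x0 w).2 (e k) * v k t) = fun=> 0.
    apply/funext => N; apply: big1 => k _.
    by rewrite /u /v !patchE !mem_setE !in_itv /= leNgt t0 /= !mulr0 addr0.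
  exact: cvg_cst.
have Vx : V (x0 w) by case: x0_V.
have -> : (fun k => ip (x0 w).1 (e k) * u k t + ip (x0 w).2 (e k) * v k t) =
  (fun k => al k * ip (S t (x0 w)).1 (e k) * ip z.1 (e k) + ip (S t (x0 w)).2 (e k) * ip z.2 (e k)).
  apply/funext => k; rewrite (coef_semigroup sipH e_basis al0_gt0 al_ge hA hA12 a_gt0 b_gt0 semiS genS)//.
  by rewrite /u /v !patchE !mem_setE !in_itv /= t0.
exact: (cvg_ipV sipH e_basis al_gt0 hA12 (semigroupV semiS t0 Vx) Vz).
Qed.

Lemma wave_time_average_cvg (s2 : R) :
  series (fun k => lam k * mode_variance k) @ \oo --> s2 ->
  {ae P, forall w, T^-1 * (\int[mu]_(t in `[0%R, T]%classic) (ipv (X t w) z ^+ 2))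
    @[T --> +oo] --> s2}.
Proof.
move=> cs; have [[XV _] mild] := X_mild.
have /choice[I hI] : forall t, exists I : Om -> (H * H)%type, 0 <= t ->
    wiener_integral P V ipv ip e W t (fun u h => S (t - u) (0, Phi1 h)) I /\
    {ae P, forall w, seqv ipv (X t w) (S t (x0 w) + I w)}.
  move=> t; have [t0|t0] := leP 0 t; last by exists (fun=> 0).
  by have [I hI] := mild t t0; exists I.
have wI t (t0 : 0 <= t) := proj1 (hI t t0).
pose n := noise_coord (ip := ip) A12 I z.
pose v t := ipP (n t) (n t).
(* The integrals [I t] are chosen separately for each [t], so [n] need not be jointly measurable.
   [g] is, and equals [n t] almost surely for each [t >= 0], which is enough for moments. *)
pose g p := Y p - M p.
have mg : measurable_fun setT g by exact: measurable_funB.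
have gn t : 0 <= t -> {ae P, forall w, g (t, w) = n t w}.
  move=> t0; apply: filterS (proj2 (hI t t0)) => w h; rewrite /g /Y /M /= t0.
  have VS : V (S t (x0 w)) by apply: (semigroupV semiS t0); case: x0_V.
  have VI : V (I t w) by case: (wI t t0) => -[].
  rewrite (seqv_ipl sipV _ _ Vz h) ?(sipDl sipV)//; first by rewrite addrAC subrr add0r.
  - exact: XV.
  - exact: (sipVD sipV).
have mg1 t : measurable_fun setT (fun w => g (t, w)).
  exact: measurableT_comp mg (measurable_pair1 t).
have n2 t (t0 : 0 <= t) : square_integrable P (n t).
  exact: (noise_square_integrable sipH e_basis al0_gt0 al_ge hA hA12 a_gt0 b_gt0 semiS genS cbm Phi1_adj wI Vz).
have g_var t : 0 <= t -> (\int[P]_w (g (t, w) ^+ 2)%:E = (v t)%:E)%E.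
  move=> t0; have [mn i2] := n2 t t0.
  rewrite /v /Rintegral fineK; last exact: (integrable_fin_num measurableT i2).
  apply: ae_eq_integral => //.
  - by apply/measurable_EFinP; exact: measurable_funX.
  - by apply/measurable_EFinP; exact: measurable_funM.
  - by apply: filterS (gn t t0) => w /= ->.
have [C1 [w1 [C10 w10 cov]]] := noise_cov_decay sipH e_basis al0_gt0 al_ge hA hA12 a_gt0 b_gt0 semiS genS cbm Phi1_adj lam_ge0 lam_le Phi1s_eigen wI Vz.
have [C2 [w2 [C20 w20 var]]] := noise_var_cvg sipH e_basis al0_gt0 al_ge hA hA12 a_gt0 b_gt0 semiS genS cbm Phi1_adj lam_ge0 lam_le Phi1s_eigen wI Vz cs.
(* Isserlis' formula squares the covariance, which doubles the rate [w1] and gives [2 * C1^2]; the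
   minimum and the sum serve both estimates at once. *)
pose C := 2 * C1 ^+ 2 + C2; pose k := Num.min (2 * w1) w2.
have C0 : 0 <= C by rewrite addr_ge0// mulr_ge0// sqr_ge0.
have k0 : 0 < k by rewrite lt_min w20 mulr_gt0.
have exp_le w r : k <= w -> 0 <= r -> expR (- w * r) <= expR (- k * r).
  by move=> kw r0; rewrite ler_expR ler_wpM2r// lerN2.
have g_cov s t : 0 <= s -> 0 <= t ->
    (\int[P]_w (g (s, w) ^+ 2 * g (t, w) ^+ 2)%:E <=
     (v s * v t + C * expR (- k * `|t - s|))%:E)%E.
  move=> s0 t0.
  have -> : (\int[P]_w (g (s, w) ^+ 2 * g (t, w) ^+ 2)%:E =
      \int[P]_w (n s w ^+ 2 * n t w ^+ 2)%:E)%E.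
    apply: ae_eq_integral => //.
    - by apply/measurable_EFinP; apply: measurable_funM; exact: measurable_funX.
    - by apply/measurable_EFinP; apply: measurable_funM; apply: measurable_funX; case: (n2 _ s0); case: (n2 _ t0).
    - by apply: filterS2 (gn s s0) (gn t t0) => w /= -> ->.
  apply: (le_trans (noise_isserlis sipH e_basis al0_gt0 al_ge hA hA12 a_gt0 b_gt0 semiS genS cbm Phi1_adj wI Vz s0 t0)).
  rewrite lee_fin lerD2l.
  have r2 : ipP (n s) (n t) ^+ 2 <= (C1 * expR (- w1 * `|t - s|)) ^+ 2.
    by rewrite -real_normK ?num_real// ler_pXn2r ?nnegrE ?mulr_ge0 ?expR_ge0//; exact: cov.
  apply: (@le_trans _ _ (2 * C1 ^+ 2 * expR (- k * `|t - s|))); last first.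
    by rewrite ler_wpM2r ?expR_ge0// lerDl.
  rewrite -mulrA ler_wpM2l//; apply: (le_trans r2).
  rewrite exprMn ler_wpM2l ?sqr_ge0// -expRM_natl mulrA mulrN.
  by rewrite exp_le// ge_min lexx.
have v_cvg t : 0 <= t -> `|v t - s2| <= C * expR (- k * t).
  move=> t0; apply: (le_trans (var t t0)); apply: ler_pM => //.
  - by rewrite lerDr mulr_ge0// sqr_ge0.
  - by rewrite exp_le// ge_min lexx orbT.
have [K [w [K0 w0 stable]]] := semigroup_stable sipH e_basis al0_gt0 al_ge hA hA12 a_gt0 b_gt0 semiS genS.
apply: filterS (strong_law mg C0 k0 g_var g_cov v_cvg) => om [gfin glim].
have Vx : V (x0 om) by case: x0_V.
(* On a fixed path the mean part decays exponentially, with a constant that depends on the path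
   through [x0]. *)
have := @time_average_perturb R (fun t => g (t, om)) (fun t => M (t, om)) s2
  (K * ipv (x0 om) (x0 om) * ipv z z) w
  (measurableT_comp mg (measurable_pair2 om)) (measurableT_comp mM (measurable_pair2 om)) w0 _ gfin glim.
have -> : (fun T => T^-1 * (\int[mu]_(t in `[0%R, T]) ((g (t, om) + M (t, om)) ^+ 2))) =
  (fun T => T^-1 * (\int[mu]_(t in `[0%R, T]) (ipv (X t om) z ^+ 2))).
  apply/funext => T; congr (_ * _); apply: eq_Rintegral => t.
  by rewrite inE /= in_itv /= => /andP[t0 _]; rewrite /g subrK /Y /= t0.
apply => t t0; rewrite /M /= t0.
have VS := semigroupV semiS t0 Vx.
apply: (le_trans (sip_cauchy_schwarz sipV VS Vz)).
rewrite [leRHS](_ : _ = K * expR (- w * t) * ipv (x0 om) (x0 om) * ipv z z); last by ring.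
by rewrite ler_wpM2r ?(sip_ge0 sipV)//; exact: stable.
Qed.

End wave_ergodicity.

(** * The estimators *)

Section positive_sequences.
Context {R : realType}.

(** Provides the [al0] on which all uniform rates rest: from some index on the terms are at least 1,
    and finitely many others have a positive minimum. *)
Lemma cvgy_lower_bound (u : nat -> R) : (forall n, 0 < u n) ->
  u n @[n --> \oo] --> +oo -> exists2 m : R, 0 < m & forall n, m <= u n.
Proof.
move=> u0 /cvgryPge/(_ 1)[N _ hN].
have [m m0 hm] : exists2 m : R, 0 < m & forall n, (n < N)%N -> m <= u n.
  elim: N {hN} => [|N [m m0 hm]]; first by exists 1.
  exists (Num.min m (u N)); first by rewrite lt_min m0 u0.
  move=> n; rewrite ltnS leq_eqVlt => /orP[/eqP ->|nN]; first by rewrite ge_min lexx orbT.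
  by rewrite ge_min hm.
exists (Num.min m 1); first by rewrite lt_min m0 ltr01.
move=> n; have [Nn|nN] := leqP N n; last by rewrite ge_min hm.
by rewrite ge_min [1 <= _](hN n Nn) orbT.
Qed.

Lemma term_le_limit (u : nat -> R) (l : R) k : (forall n, 0 <= u n) ->
  series u @ \oo --> l -> u k <= l.
Proof.
move=> u0 cu; have nd : nondecreasing_seq (series u).
  by apply/nondecreasing_seqP => n; rewrite -subr_ge0 seriesSB.
apply: (@le_trans _ _ (series u k.+1)).
  by rewrite /series /= big_nat_recr//= lerDr sumr_ge0.
rewrite -(cvg_lim (@Rhausdorff R) cu); apply: nondecreasing_cvgn_le => //.
by apply/cvg_ex; exists l.
Qed.

End positive_sequences.

Section wave_estimators.
Context {R : realType} {d : measure_display} {Om : measurableType d}.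
Variable P : probability Om R.
Context {H : lmodType R} {ip : H -> H -> R}.
Hypothesis sipH : semi_inner_product setT ip.
Variable e : nat -> H.
Hypothesis e_basis : complete_orthonormal (ip := ip) e.
Variable al : nat -> R.
Hypotheses (al_gt0 : forall n, 0 < al n) (al_infty : al n @[n --> \oo] --> +oo).
Variables A A12 : H -> H.
Local Notation dom_A12 := (diagonal_dom (ip := ip) e al).
Local Notation dom_A := (diagonal_dom (ip := ip) e (fun n => al n ^+ 2)).
Hypothesis hA : diagonal_op (ip := ip) e dom_A (fun n => - al n) A.
Hypothesis hA12 : diagonal_op (ip := ip) e dom_A12 (fun n => Num.sqrt (al n)) A12.
Local Notation V := (energy_space (ip := ip) e al).
Local Notation ipv := (energy_ip (ip := ip) A12).
Local Notation ip12 := (graph_ip (ip := ip) A12).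
Variables Phi1 Phi1s Q : H -> H.
Hypothesis Phi1_adj : forall x y, ip (Phi1 x) y = ip x (Phi1s y).
Hypothesis hQ : forall x, Q x = Phi1 (Phi1s x).
Variable lam : nat -> R.
Hypotheses (lam_gt0 : forall n, 0 < lam n) (lam_summable : cvgn (series lam)).
Hypothesis Q_eigen : forall n, seqv ip (Q (e n)) (lam n *: e n).
Variables a b : R.
Hypotheses (a_gt0 : 0 < a) (b_gt0 : 0 < b).
Variable S : R -> (H * H)%type -> (H * H)%type.
Hypothesis semiS : C0_semigroup V ipv S.
Hypothesis genS : generated_by V ipv S (wave_dom (ip := ip) e al) (wave_generator A a b).
Variable W : R -> H -> Om -> R.
Hypothesis cbm : cylindrical_BM P ip W.
Variable x0 : Om -> (H * H)%type.
Hypothesis x0_V : random_vector V ipv x0.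
Variable X : R -> Om -> (H * H)%type.
Hypothesis X_mild : mild_solution P V ipv ip e W S (fun h => (0, Phi1 h)) x0 X.
Variable z : (H * H)%type.
Hypothesis Vz : V z.
Local Notation mu := (@lebesgue_measure R).
Local Notation mode_variance := (mode_variance (ip := ip) e al a b z).
Local Notation J := (time_avg ipv X z).

Let sipV : semi_inner_product V ipv := ipV_sip sipH e_basis al_gt0 hA12.

Let lam_ge0 k : 0 <= lam k. Proof. exact: ltW. Qed.

Let lam_le k : lam k <= limn (series lam).
Proof. exact: term_le_limit. Qed.

Let ip_Q_eigen j x : ip (Q (e j)) x = lam j * ip (e j) x.
Proof. by rewrite (seqv_ipl sipH _ _ _ (Q_eigen j))// (sipZl sipH). Qed.

Let Phi1s_eigen j k : ip (Phi1s (e j)) (Phi1s (e k)) = (j == k)%:R * lam j.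
Proof. by rewrite -Phi1_adj -hQ ip_Q_eigen (ip_basis e_basis) mulrC. Qed.

(** [Q] is symmetric as the product of [Phi1] and its adjoint: moving it onto [e k] extends the
    eigenvalue relation from basis vectors to the coefficients of any [Q x]. *)
Let ip_Q x k : ip (Q x) (e k) = lam k * ip x (e k).
Proof.
rewrite hQ Phi1_adj (sipC sipH)// -Phi1_adj -hQ ip_Q_eigen.
by rewrite (sipC sipH).
Qed.

Let q1 := ip12 (Q z.1) z.1.
Let q2 := ip (Q z.2) z.2.

(** [lam] is bounded by its sum, so [Q] multiplies coefficients by bounded factors and preserves the
    domain. *)
Let dom_Q : dom_A12 (Q z.1).
Proof.
rewrite /diagonal_dom /=.
apply: (@series_le_cvg _ _ (fun n => limn (series lam) ^+ 2 * (al n * ip z.1 (e n) ^+ 2))).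
- by move=> n; rewrite mulr_ge0 ?sqr_ge0// ltW.
- by move=> n; rewrite mulr_ge0 ?sqr_ge0// mulr_ge0 ?sqr_ge0// ltW.
- move=> n; rewrite ip_Q exprMn mulrCA; apply: ler_wpM2r.
    by rewrite mulr_ge0 ?sqr_ge0// ltW.
  by rewrite ler_pXn2r// nnegrE ?lam_ge0// (le_trans (lam_ge0 0)).
- exact: (is_cvg_seriesZ Vz).
Qed.

Let q1_cvg : series (fun n => lam n * (al n * ip z.1 (e n) ^+ 2)) @ \oo --> q1.
Proof.
have -> : (fun n => lam n * (al n * ip z.1 (e n) ^+ 2)) =
    (fun n => al n * ip (Q z.1) (e n) * ip z.1 (e n)).
  by apply/funext => n; rewrite ip_Q; ring.
exact: (cvg_ipA12 sipH e_basis al_gt0 hA12 dom_Q Vz).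
Qed.

Let q2_cvg : series (fun n => lam n * ip z.2 (e n) ^+ 2) @ \oo --> q2.
Proof.
have -> : (fun n => lam n * ip z.2 (e n) ^+ 2) = (fun n => ip (Q z.2) (e n) * ip z.2 (e n)).
  by apply/funext => n; rewrite ip_Q; ring.
exact: (parseval sipH e_basis).
Qed.

Let q1_term n : lam n * (al n * ip z.1 (e n) ^+ 2) <= q1.
Proof.
apply: (@term_le_limit _ (fun n => lam n * (al n * ip z.1 (e n) ^+ 2))) => // k.
by rewrite mulr_ge0// mulr_ge0 ?sqr_ge0// ltW.
Qed.

Let q2_term n : lam n * ip z.2 (e n) ^+ 2 <= q2.
Proof.
apply: (@term_le_limit _ (fun n => lam n * ip z.2 (e n) ^+ 2)) => // k.
by rewrite mulr_ge0 ?sqr_ge0//.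
Qed.

Let q1_ge0 : 0 <= q1.
Proof. by apply: le_trans (q1_term 0); rewrite mulr_ge0// mulr_ge0 ?sqr_ge0// ltW. Qed.

Let q2_ge0 : 0 <= q2.
Proof. by apply: le_trans (q2_term 0); rewrite mulr_ge0 ?sqr_ge0. Qed.

Let coef_eq0 x : (forall n, ip x (e n) = 0) -> ip x x = 0.
Proof.
move=> h; apply: (cvg_uniq (@parseval _ _ _ sipH _ e_basis x x)).
rewrite (_ : series _ = fun=> 0); first exact: cvg_cst.
by apply/funext => N; apply: big1 => n _; rewrite h mulr0.
Qed.

(** Every mode is excited, [lam n > 0], so a vanishing quadratic form forces all coefficients to
    vanish. This gives the nonzero denominators below. *)
Let q1_eq0 n : q1 = 0 -> ip z.1 (e n) = 0.
Proof.
move=> h; have := q1_term n; rewrite h => h0; apply/eqP.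
have : 0 < lam n * al n by rewrite mulr_gt0.
rewrite -sqrf_eq0 eq_le sqr_ge0 andbT => la.
by rewrite -(ler_pM2l la) mulr0 -mulrA.
Qed.

Let q2_eq0 n : q2 = 0 -> ip z.2 (e n) = 0.
Proof.
move=> h; have := q2_term n; rewrite h => h0; apply/eqP.
by rewrite -sqrf_eq0 eq_le sqr_ge0 andbT -(ler_pM2l (lam_gt0 n)) mulr0.
Qed.

Let s2 : R := (q2 + q1 / b) / (4 * a).

Let s2_cvg : series (fun k => lam k * mode_variance k) @ \oo --> s2.
Proof.
have -> : series (fun k => lam k * mode_variance k) = (fun N =>
    (series (fun n => lam n * ip z.2 (e n) ^+ 2) N +
     series (fun n => lam n * (al n * ip z.1 (e n) ^+ 2)) N / b) / (4 * a)).
  apply/funext => N; rewrite /series /= !mulr_suml -big_split /= mulr_suml.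
  by apply: eq_bigr => k _; rewrite /mode_variance; field; rewrite !gt_eqF.
apply: cvgM; last exact: cvg_cst.
by apply: cvgD => //; apply: cvgM => //; exact: cvg_cst.
Qed.

Let J_cvg : {ae P, forall w, J T w @[T --> +oo] --> s2}.
Proof.
have [al0 al0_gt0 al_ge] := cvgy_lower_bound al_gt0 al_infty.
exact: (wave_time_average_cvg sipH e_basis al0_gt0 al_ge hA hA12 a_gt0 b_gt0 semiS genS cbm
  Phi1_adj lam_ge0 lam_le Phi1s_eigen x0_V X_mild Vz s2_cvg).
Qed.

Lemma estimator_a_cvg : ~ seqv ipv z 0 -> {ae P, forall w,
  1 / (4 * b * J T w) * q1 + 1 / (4 * J T w) * q2 @[T --> +oo] --> a}.
Proof.
move=> z0; have s_gt0 : 0 < s2.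
  rewrite divr_gt0 ?mulr_gt0// lt_neqAle addr_ge0 ?divr_ge0 ?(ltW b_gt0)// andbT eq_sym.
  rewrite paddr_eq0 ?divr_ge0 ?(ltW b_gt0)// mulf_eq0 invr_eq0 (gt_eqF b_gt0) orbF.
  apply/negP => /andP[/eqP h2 /eqP h1]; apply: z0.
  rewrite /seqv subr0 /snorm.
  suff -> : ipv z z = 0 by rewrite sqrtr0.
  apply: (cvg_uniq (@cvg_ipV _ _ _ sipH _ e_basis _ al_gt0 _ hA12 _ _ Vz Vz)).
  rewrite (_ : series _ = fun=> 0); first exact: cvg_cst.
  by apply/funext => N; apply: big1 => n _; rewrite q1_eq0// q2_eq0// !mulr0 addr0.
apply: filterS J_cvg => w cJ.
(* The estimator is a continuous function of [J T] near the limit [s2 > 0], where its value is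
   [a]. *)
have aE : a = 1 / (4 * b * s2) * q1 + 1 / (4 * s2) * q2.
  have s0 : s2 != 0 by rewrite gt_eqF.
  have qE : q2 = 4 * a * s2 - q1 / b by rewrite /s2; field; rewrite !gt_eqF.
  by rewrite qE; field; rewrite s0 gt_eqF.
rewrite [X in _ --> X]aE; apply: cvgD; apply: cvgM; try exact: cvg_cst.
- apply: cvgM; first exact: cvg_cst.
  apply: cvgV; first by apply: lt0r_neq0; do !apply: mulr_gt0 => //.
  by apply: cvgM => //; exact: cvg_cst.
- apply: cvgM; first exact: cvg_cst.
  apply: cvgV; first by apply: lt0r_neq0; do !apply: mulr_gt0 => //.
  by apply: cvgM => //; exact: cvg_cst.
Qed.

Lemma estimator_b_cvg : ~ seqv ip z.1 0 -> {ae P, forall w,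
  q1 / (4 * a * J T w - q2) @[T --> +oo] --> b}.
Proof.
move=> z0; have q_gt0 : 0 < q1.
  rewrite lt_neqAle q1_ge0 andbT eq_sym; apply/eqP => h; apply: z0.
  by rewrite /seqv subr0 /snorm coef_eq0 ?sqrtr0// => n; exact: q1_eq0.
apply: filterS J_cvg => w cJ.
(* The denominator tends to [q1 / b], positive because [z.1] is not null. *)
have qE : 4 * a * s2 - q2 = q1 / b by rewrite /s2; field; rewrite !gt_eqF.
have bE : b = q1 / (4 * a * s2 - q2) by rewrite qE; field; rewrite !gt_eqF.
rewrite [X in _ --> X]bE; apply: cvgM; first exact: cvg_cst.
apply: cvgV; first by rewrite qE gt_eqF// divr_gt0.
by apply: cvgB; [apply: cvgM => //; exact: cvg_cst|exact: cvg_cst].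
Qed.

End wave_estimators.

Unset Implicit Arguments.

Theorem theorem3p2
  (R : realType) (d : nat)
  (* the bounded domain D with smooth boundary; H is L^2(D) *)
  (leb : {measure set (borel_Rd R d) -> \bar R}) (hleb : is_lebesgue leb)
  (D : set 'rV[R]_d) (D_open : open D) (D_connected : connected D)
  (D_neq0 : D !=set0) (D_bounded : bounded_set D)
  (D_smooth : smooth_boundary D)
  (H := L2 (restrict_leb leb D_open) : lmodType R)
  (ip := L2ip (mu := restrict_leb leb D_open) : H -> H -> R)
  (e : nat -> H) (e_basis : orthonormal_basis e)
  (* the operators A and (-A)^{1/2} *)
  (al : nat -> R) (al_gt0 : forall n, 0 < al n)
  (al_infty : al n @[n --> \oo] --> +oo)
  (A A12 : H -> H)
  (hA : diagonal_on (dom_A e al) e (fun n => - al n) A)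
  (hA12 : diagonal_on (dom_A12 e al) e (fun n => Num.sqrt (al n)) A12)
  (* the operators Phi1 and Q = Phi1 Phi1^* *)
  (Phi1 Phi1s Q : H -> H) (Phi1_HS : hilbert_schmidt e Phi1)
  (Phi1_adj : adjoint_of Phi1 Phi1s)
  (hQ : forall x, Q x = Phi1 (Phi1s x))
  (lam : nat -> R) (lam_gt0 : forall n, 0 < lam n)
  (lam_summable : cvgn (series lam))
  (Q_eigen : forall n, seqv ip (Q (e n)) (lam n *: e n))
  (* the space V and the semigroup S *)
  (V := Vspace e al : set (H * H)%type)
  (a b : R) (a_gt0 : 0 < a) (b_gt0 : 0 < b)
  (S : R -> (H * H)%type -> (H * H)%type)
  (S_semigroup : C0_semigroup V (ipV A12) S)
  (S_generator : generated_by V (ipV A12) S (dom_wave e al) (wave_op A a b))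
  (* the noise, the initial condition and the mild solution *)
  (dO : measure_display) (Om : measurableType dO) (P : probability Om R)
  (B : R -> H -> Om -> R) (B_cylindrical : cylindrical_BM P ip B)
  (x0 : Om -> (H * H)%type) (x0_V : random_vector V (ipV A12) x0)
  (x0_sqint : (\int[P]_w (ipV A12 (x0 w) (x0 w))%:E < +oo)%E)
  (x0_indep : independent_families P (sigma_vector V (ipV A12) x0)
                (sigma_process B))
  (X : R -> Om -> (H * H)%type)
  (X_mild : mild_solution P V (ipV A12) ip e B S
              (fun h => noise_op Phi1 (0, h)) x0 X)
  (z : (H * H)%type) (z_V : V z)
  (J := time_avg (ipV A12) X z : R -> Om -> R) :
  (~ seqv (ipV A12) z 0 ->
   {ae P, forall w,
     (1 / (4 * b * J T w) * ipA12 A12 (Q z.1) z.1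
      + 1 / (4 * J T w) * ip (Q z.2) z.2) @[T --> +oo] --> a})
  /\
  (~ seqv ip z.1 0 ->
   {ae P, forall w,
     (ipA12 A12 (Q z.1) z.1 / (4 * a * J T w - ip (Q z.2) z.2))
       @[T --> +oo] --> b}).
Proof.
have sipH := L2ip_sip (restrict_leb leb D_open).
split=> z0.
- exact: (estimator_a_cvg sipH e_basis al_gt0 al_infty hA hA12 Phi1_adj hQ lam_gt0 lam_summable
    Q_eigen a_gt0 b_gt0 S_semigroup S_generator B_cylindrical x0_V X_mild z_V z0).
- exact: (estimator_b_cvg sipH e_basis al_gt0 al_infty hA hA12 Phi1_adj hQ lam_gt0 lam_summable
    Q_eigen a_gt0 b_gt0 S_semigroup S_generator B_cylindrical x0_V X_mild z_V z0).
Qed.
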